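(* Assume that $$\mathbb{E}\Big[\sum_{i\in\mathbb{N}_+} y_i^{(0)}(\xi)\big(\log^+ y_i^{(0)}(\xi)\big)^2\Big]<\infty,$$ $$\mathbb{E}\Big[\Big(\sum_{i\in\mathbb{N}_+} y_i^{(0)}(\xi)\Big)\Big|\log\Big(\sum_{i\in\mathbb{N}_+} y_i^{(0)}(\xi)\Big)\Big|\Big]<\infty,$$ and $$\mathbb{E}\Big[\sum_{i\in\mathbb{N}_+} y_i^{(0)}(\xi)\log y_i^{(0)}(\xi)\Big]<0 .$$ Then the functional equation $$\phi(\xi,u)=E_\xi\Big[\prod_{i\in\mathbb{N}_+}\phi\big(T\xi,u\,y_i^{(0)}(\xi)\big)\Big]\quad\text{for all }u\ge 0\text{ and }\tau\text{-a.e. }\xi$$ has a unique solution $\phi$ in $\mathcal{L}_1$.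
   Context: Environment. $\mathbb{N}=\{0,1,2,\dots\}$, $\mathbb{N}_+=\{1,2,\dots\}$. The random environment $\xi=(\xi_n)_{n\in\mathbb{N}}$ is an i.i.d. sequence with values in a measurable space $(\Theta,\mathcal{E})$; $\tau$ denotes its law on $(\Theta^{\mathbb{N}},\mathcal{E}^{\otimes\mathbb{N}})$. $T$ is the shift: $T(\xi_0,\xi_1,\dots)=(\xi_1,\xi_2,\dots)$. To each value of $\xi_n$ corresponds (measurably) a distribution $\eta(\xi_n)$ on sequences of non-negative numbers that are ultimately zero. Given $\xi$, for each $n$ the random sequence $\bar Y^{(n)}=(y_1^{(n)}(\xi),y_2^{(n)}(\xi),\dots)$ has law $\eta(\xi_n)$ (so the law of $y^{(0)}_i(\xi)$, $i\in\mathbb{N}_+$, depends only on $\xi_0$). $P_\xi$, $E_\xi$ denote the quenched probability and expectation (given $\xi$). $\mathbb{P}$ is the annealed law, $\int g\,d\mathbb{P}=\int_{\Theta^{\mathbb{N}}}\big(\int g(\xi,y)\,dP_\xi(y)\big)d\tau(\xi)$ for positive measurable $g$, with expectation $\mathbb{E}$. Convention: $0\log 0=0$. Standing assumption: for each $n\in\mathbb{N}$ and $\tau$-a.e. $\xi$, $$E_\xi\Big[\sum_{i\in\mathbb{N}_+}y_i^{(n)}(\xi)\Big]=1,\qquad P_\xi\Big[\sum_{i\in\mathbb{N}_+}\mathbf{1}_{\{y_i^{(n)}(\xi)>0\}}<\infty\Big]=1,\qquad \mathbb{E}\log\Big[E_\xi\sum_{i\in\mathbb{N}_+}\mathbf{1}_{\{y_i^{(n)}(\xi)>0\}}\Big]>0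 .$$ Class $\mathcal{L}_c$ ($c>0$): the set of functions $\phi(\xi,u)=\int_{[0,\infty)}e^{-ux}\mu_\xi(dx)$, $u\ge 0$, $\xi\in\Theta^{\mathbb{N}}$, where $(\mu_\xi)_{\xi}$ is a (measurable in $\xi$) family of probability distributions on $[0,\infty)$ with $\mathbb{E}\int x\,\mu_\xi(dx)=c$. One also writes $\phi(\xi,u)=E_\xi e^{-uZ(\xi)}$ with $Z(\xi)$ of law $\mu_\xi$ under $P_\xi$. Two elements of $\mathcal{L}_c$ are identified when they agree for $\tau$-a.e. $\xi$ and all $u\ge0$. *)

(* Defs.v *)
From HB Require Import structures.
From mathcomp Require Import all_boot all_order all_algebra finmap.
From mathcomp Require Import all_classical all_reals all_analysis.

Set Implicit Arguments.
Unset Strict Implicit.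
Unset Printing Implicit Defensive.
Import Order.TTheory GRing.Theory Num.Theory.
Import numFieldNormedType.Exports.

Local Open Scope classical_set_scope.
Local Open Scope ring_scope.
Local Open Scope ereal_scope.

(* An alias of [nat -> T], carrying the product sigma-algebra. *)
Definition seq_space (T : Type) := nat -> T.

HB.instance Definition _ (T : pointedType) := Pointed.copy (seq_space T) (nat -> T).

Definition measure_seq_display : measure_display -> measure_display.
Proof. exact. Qed.

Section product_sigma_algebra.
Context d (T : measurableType d).

Definition seq_coord (n : nat) (x : seq_space T) : T := x n.

Definition seq_measurable : set (set (seq_space T)) :=
  <<s \bigcup_n preimage_set_system [set: seq_space T] (seq_coord n) measurable >>.

Let seq_measurable0 : seq_measurable set0.
Proof. exact: sigma_algebra0. Qed.

Let seq_measurableC A : seq_measurable A -> seq_measurable (~` A).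
Proof. exact: sigma_algebraC. Qed.

Let seq_measurable_bigcup (F : (set (seq_space T))^nat) :
  (forall i, seq_measurable (F i)) -> seq_measurable (\bigcup_i F i).
Proof. exact: sigma_algebra_bigcup. Qed.

HB.instance Definition _ := @isMeasurable.Build (measure_seq_display d)
  (seq_space T) seq_measurable
  seq_measurable0 seq_measurableC seq_measurable_bigcup.

End product_sigma_algebra.

Definition seq_shift (T : Type) (xi : seq_space T) : seq_space T := fun n => xi n.+1.

Definition iid_law d (T : measurableType d) (R : realType)
    (tau : probability (seq_space T) R) : Prop :=
  (forall n (A : set T), measurable A ->
     tau (seq_coord n @^-1` A) = tau (seq_coord 0 @^-1` A)) /\
  (forall (J : {fset nat}) (A : nat -> set T), (forall n, measurable (A n)) ->
     tau (\bigcap_(n in [set` J]) seq_coord n @^-1` A n) =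
     \prod_(n <- J) tau (seq_coord n @^-1` A n)).

(* The term of index i of a sequence stands for y_(i+1). *)
Definition offspring_seq (R : realType) : set (seq_space R) :=
  [set y | (forall i, (0 <= y i)%R) /\ \forall i \near \oo, y i = 0%R].

Section functionals.
Context {R : realType}.
Implicit Type y : seq_space R.

Definition total_mass y : \bar R := \sum_(0 <= i <oo) (y i)%:E.

Definition num_positive y : \bar R :=
  \sum_(0 <= i <oo) (\1_[set r : R | (0 < r)%R] (y i))%:E.

Definition logplus (r : R) : R := Num.max 0%R (ln r).

Definition sum_ylogplus2 y : \bar R :=
  \sum_(0 <= i <oo) (y i * logplus (y i) ^+ 2)%:E.

(* [ln 0 = 0], so the convention 0 log 0 = 0 holds. *)
Definition sum_ylog y : \bar R := \sum_(0 <= i <oo) (y i * ln (y i))%:E.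

(* [lne] is the logarithm with values in [-oo, +oo]; the product vanishes at
   total mass 0 because [0 * +oo = 0] in [\bar R]. *)
Definition mass_abslog_mass y : \bar R :=
  total_mass y * `| lne (total_mass y) |.

End functionals.

Section annealed.
Context d d' (Theta : measurableType d) (Omega : measurableType d').
Context (R : realType) (tau : probability (seq_space Theta) R).
Context (P : R.-pker (seq_space Theta) ~> Omega).

(* A nonnegative g is integrated by iterated integration; a signed g through its
   positive and negative parts.  As [+oo - +oo = -oo] in [\bar R], an inequality
   [annealed g < 0] is informative only when the positive part has a finite
   expectation. *)
Definition annealed (g : seq_space Theta -> Omega -> \bar R) : \bar R :=
  \int[tau]_xi \int[P xi]_w ((g xi)^\+ w) -
  \int[tau]_xi \int[P xi]_w ((g xi)^\- w).

(* Values of [phi xi u] at u < 0 are irrelevant. *)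
Definition laplace_class (c : R) (phi : seq_space Theta -> R -> R) : Prop :=
  exists mu : R.-pker (seq_space Theta) ~> R,
    [/\ forall xi, mu xi `[0%R, +oo[%classic = 1,
        annealed (fun xi _ => \int[mu xi]_(x in `[0%R, +oo[%classic) x%:E) = c%:E
      & forall xi (u : R), (0 <= u)%R ->
          (phi xi u)%:E = \int[mu xi]_(x in `[0%R, +oo[%classic) (expR (- (u * x)))%:E].

Definition solves_functional_equation (Y0 : Omega -> seq_space R)
    (phi : seq_space Theta -> R -> R) : Prop :=
  {ae tau, forall xi, forall u : R, (0 <= u)%R ->
    (phi xi u)%:E =
    \int[P xi]_w
      (limn (fun n => \prod_(i < n) phi (seq_shift xi) (u * Y0 w i))%R)%:E}.

End annealed.

(* Main.v *)
(** Since [xi_0] is independent of [T xi], a statistic of [phi(T xi, .)] averaged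
    over the environment transforms under the smoothing map
    [S phi (xi, u) = E_xi (prod_i phi (T xi, u y_i))] through the size-biased
    offspring law only: it is averaged over [u t] with [t] distributed as
    [E (sum_i y_i delta_{y_i})], a probability measure under which [log t] has
    negative drift by assumption.

    Existence.  Starting from [e^{-u}], the iterates of [S] increase by Jensen's
    inequality.  With [D_n u = E (1 - (1 - phi_n (xi, u)) / u)] one has
    [D_{n+1} u <= E D_n (u t) + E kappa (u M) / u], where
    [kappa s = e^{-s} - 1 + s] and [M = sum_i y_i].  The error terms are summable
    along geometric sequences because [E M log^+ M] is finite, and the negative
    drift then keeps [D_n u] away from 1, uniformly in [n], for some [u].  The
    limit of the iterates is thus a fixed point of positive mean, which is
    rescaled to mean 1.

    Uniqueness.  The mean of a solution satisfies [m xi <= m (T xi)], hence, by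
    the zero-one law and [E m = 1], [m <= 1].  For two solutions,
    [G u = E |phi - psi| / u] is bounded, tends to 0 at 0 and satisfies
    [G u <= E G (u t)]; the negative drift forces [G = 0]. *)
Require Import Defs.
From HB Require Import structures.
From mathcomp Require Import all_boot all_order all_algebra finmap.
From mathcomp Require Import all_classical all_reals all_analysis.
From mathcomp Require Import measurable_realfun ring lra zify.

Set Implicit Arguments.
Unset Strict Implicit.
Unset Printing Implicit Defensive.
Import Order.TTheory GRing.Theory Num.Theory.
Import numFieldNormedType.Exports.

Local Open Scope classical_set_scope.
Local Open Scope ring_scope.
Local Open Scope ereal_scope.

(** * Kernels *)

(** The class asks for a probability kernel, so a pointwise limit of Laplace transforms is not
    enough: the limiting laws have to depend measurably on the environment. Every family of laws is
    therefore carried by one jointly measurable variable [Z (xi, s)], with [s] uniform on [0, 1].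
    The substitution [exp (- Z)] takes values in [0, 1] and turns Laplace transforms at the integers
    into moments; its quantile functions converge at almost every level, and their upper limit is
    measurable in both arguments. Products, scalings, mixtures and limits of Laplace transforms are
    then operations on variables.

    The random walk with steps [log t] is never constructed. Its steps are truncated below and
    rounded up to a lattice, and one inequality for monotone functions on the integers takes the
    place of a renewal argument. It serves twice: with summable errors for [D_n], where it gives a
    bound uniform in [n], and without errors for [G], where it is a contraction. *)

Section kernel_precomposition.
Context d1 d2 d3 (X : measurableType d1) (Y : measurableType d2)
  (X' : measurableType d3) (R : realType).
Variables (k : R.-pker X ~> Y) (g : X' -> X).

(** The proof of measurability is an argument so that the kernel instances below can be inferred
    from the term. *)
Definition kpre of measurable_fun [set: X'] g :
  X' -> {measure set Y -> \bar R} := fun x => k (g x).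

Hypothesis mg : measurable_fun [set: X'] g.

Let kpre_measurable (A : set Y) : measurable A ->
  measurable_fun [set: X'] (kpre mg ^~ A).
Proof. by move=> mA; exact: measurableT_comp (measurable_kernel k A mA) mg. Qed.

HB.instance Definition _ := isKernel.Build _ _ _ _ _ (kpre mg) kpre_measurable.

Let kpre_prob x : kpre mg x [set: Y] = 1.
Proof. exact: prob_kernel. Qed.

HB.instance Definition _ := Kernel_isProbability.Build _ _ _ _ _
  (kpre mg) kpre_prob.

End kernel_precomposition.

Section kernel_image.
Context d1 d2 d3 d4 (X : measurableType d1) (Y : measurableType d2)
  (X' : measurableType d3) (Z : measurableType d4) (R : realType).
Variables (k : R.-pker X ~> Y) (g : X' -> X) (f : X' * Y -> Z).
Hypotheses (mg : measurable_fun [set: X'] g)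
  (mf : measurable_fun [set: X' * Y] f).

Let f_pair2 x : measurable_fun [set: Y] (fun y => f (x, y)).
Proof. exact: measurable_fun_pair2. Qed.

Definition kimage of measurable_fun [set: X'] g &
    measurable_fun [set: X' * Y] f :=
  fun x : X' => pushforward (k (g x)) (fun y => f (x, y)).

Let kimage0 x : kimage mg mf x set0 = 0.
Proof. by rewrite /kimage /pushforward preimage_set0 measure0. Qed.

Let kimage_ge0 x A : 0 <= kimage mg mf x A.
Proof. exact: measure_ge0. Qed.

Let kimage_additive x : semi_sigma_additive (kimage mg mf x).
Proof.
have := @measure_semi_sigma_additive _ _ _ (pushforward (k (g x)) (fun y => f (x, y))).
exact.
Qed.

HB.instance Definition _ x := isMeasure.Build _ _ _
  (kimage mg mf x) (kimage0 x) (kimage_ge0 x) (@kimage_additive x).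

(** [kimage] is a set function that bears a measure structure at each point; bundling its values
    gives the map on which the kernel structure is declared. *)
Definition mkimage : X' -> {measure set Z -> \bar R} := kimage mg mf.

Let mkimage_measurable (A : set Z) : measurable A ->
  measurable_fun [set: X'] (mkimage ^~ A).
Proof.
move=> mA.
pose B := f @^-1` A.
have mB : measurable B by rewrite -[B]setTI; exact: mf.
rewrite (_ : mkimage ^~ A = fun x => kpre k mg x (xsection B x)); last first.
  by apply/funext => x; rewrite /mkimage /kimage /pushforward xsectionE.
exact: (measurable_fun_xsection_finite_kernel (kpre k mg) (mem_set mB)).
Qed.

HB.instance Definition _ := isKernel.Build _ _ _ _ _ mkimage mkimage_measurable.

Let mkimage_prob x : mkimage x [set: Z] = 1.
Proof.
rewrite [LHS](_ : _ = k (g x) ((fun y => f (x, y)) @^-1` [set: Z]))//.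
by rewrite preimage_setT prob_kernel.
Qed.

HB.instance Definition _ := Kernel_isProbability.Build _ _ _ _ _
  mkimage mkimage_prob.

Lemma integral_kimage x (h : Z -> \bar R) : measurable_fun [set: Z] h ->
  (forall z, 0 <= h z) -> \int[mkimage x]_z h z = \int[k (g x)]_y h (f (x, y)).
Proof.
move=> mh h0; rewrite [LHS](_ : _ = \int[pushforward (k (g x)) (fun y => f (x, y))]_z h z)//.
by rewrite (ge0_integral_pushforward (f_pair2 x)) ?preimage_setT// => y _.
Qed.

End kernel_image.

Section kernel_of_probability.
Context d d' (X : measurableType d) (Y : measurableType d') (R : realType).
Variable P : probability Y R.

Definition kcst of X : {measure set Y -> \bar R} := P.

Let kcst_measurable (A : set Y) : measurable A ->
  measurable_fun [set: X] (kcst ^~ A).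
Proof. by move=> _; exact: measurable_cst. Qed.

HB.instance Definition _ := isKernel.Build _ _ _ _ _ kcst kcst_measurable.

Let kcst_prob x : kcst x [set: Y] = 1.
Proof. exact: probability_setT. Qed.

HB.instance Definition _ := Kernel_isProbability.Build _ _ _ _ _ kcst kcst_prob.

End kernel_of_probability.

Section mixture.
Context d d' (X : measurableType d) (Y : measurableType d') (R : realType).
Variables (P : probability X R) (k : R.-pker X ~> Y).

Let msnd : measurable_fun [set: unit * X] (@snd unit X).
Proof. exact: measurable_snd. Qed.

(** A composition of kernels started from the one-point space, so that the integration formula for
    composed kernels applies. *)
Definition mixture : set Y -> \bar R :=
  mkcomp (@kcst _ _ unit X R P) (kpre k msnd) tt.

HB.instance Definition _ := Measure.on mixture.

Lemma integral_mixture (h : Y -> \bar R) : measurable_fun [set: Y] h ->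
  (forall z, 0 <= h z) -> \int[mixture]_y h y = \int[P]_x \int[k x]_y h y.
Proof.
by move=> mh h0; rewrite [LHS]integral_kcomp.
Qed.

Let mixture_setT : mixture [set: Y] = 1.
Proof.
rewrite -[LHS]mul1e -integral_cst// integral_mixture//.
under eq_integral do rewrite integral_cst// prob_kernel mul1e.
by rewrite integral_cst// mul1e; exact: probability_setT.
Qed.

HB.instance Definition _ := Measure_isProbability.Build _ _ _ mixture mixture_setT.

End mixture.

Lemma pker_le1 d d' (X : measurableType d) (Y : measurableType d')
  (R : realType) (k : R.-pker X ~> Y) x (A : set Y) : measurable A -> k x A <= 1.
Proof. by move=> mA; rewrite -(@prob_kernel _ _ _ _ _ k x); apply: le_measure; rewrite ?inE. Qed.

(** * Quantiles *)

Section quantile.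
Context {R : realType}.

Let uniform01 : {measure set (measurableTypeR R) -> \bar R} :=
  uniform_prob (@ltr01 R).

Let idR : measurableTypeR R -> R := id.

(* The uniform law of [0, 1], on [R] with its own measurable structure rather
   than on [measurableTypeR R]. *)
Definition unif : set R -> \bar R := pushforward uniform01 idR.

Let unif0 : unif set0 = 0.
Proof. exact: (measure0 uniform01). Qed.

Let unif_ge0 A : 0 <= unif A.
Proof. exact: (measure_ge0 uniform01). Qed.

Let unif_additive : semi_sigma_additive unif.
Proof. exact: (@measure_semi_sigma_additive _ _ _ uniform01). Qed.

HB.instance Definition _ := isMeasure.Build _ R R unif
  unif0 unif_ge0 unif_additive.

Lemma unifE (A : set R) : measurable A ->
  unif A = lebesgue_measure (A `&` `[0%R, 1%R]%classic : set (measurableTypeR R)).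
Proof.
move=> mA; pose B : set (measurableTypeR R) := A.
have mB : measurable B by [].
rewrite [LHS](_ : _ = uniform01 B)// -/(B `&` _).
rewrite -[B in LHS]setIT -[LHS]integral_indic// integral_uniform//.
- by rewrite subr0 invr1 mul1e integral_indic.
- exact/measurable_EFinP.
Qed.

Let unif_setT : unif setT = 1.
Proof.
rewrite unifE// setTI [LHS]lebesgue_measure_itv/= lte_fin ltr01.
by rewrite -EFinB subr0.
Qed.

HB.instance Definition _ := Measure_isProbability.Build _ R R unif unif_setT.

Lemma unif_itvNyo (b : R) : (0 <= b <= 1)%R ->
  unif [set x | (x < b)%R] = b%:E.
Proof.
move=> /andP[b0 b1].
have -> : [set x | (x < b)%R] = `]-oo, b[%classic.
  by apply/seteqP; split=> x /=; rewrite in_itv.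
rewrite unifE//.
have -> : `]-oo, b[%classic `&` `[0%R, 1%R]%classic = `[0%R, b[%classic.
  apply/seteqP; split=> x /=; rewrite !in_itv/=.
    by move=> [-> /andP[->]].
  by move=> /andP[x0 xb]; rewrite x0 (le_trans (ltW xb)).
rewrite [LHS]lebesgue_measure_itv/= lte_fin -EFinB subr0.
case: ifPn => //; rewrite -leNgt => b0'.
by congr (_%:E); apply/eqP; rewrite eq_le b0 b0'.
Qed.

Lemma unif_set1 (a : R) : unif [set a] = 0.
Proof.
rewrite unifE//; apply/eqP; rewrite eq_le measure_ge0 andbT.
rewrite -(lebesgue_measure_set1 a); apply: le_measure; rewrite ?inE//.
by apply: measurableI.
Qed.

(** The right rays are stable under intersection, generate the Borel sets and exhaust the line. *)
Lemma measure_rays_unique (m1 m2 : {measure set R -> \bar R}) :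
  (forall a : R, m1 [set x | (a < x)%R] = m2 [set x | (a < x)%R]) ->
  (forall a : R, m1 [set x | (a < x)%R] < +oo) ->
  forall A, measurable A -> m1 A = m2 A.
Proof.
have rayE (a : R) : [set x | (a < x)%R] = `]a, +oo[%classic.
  by apply/seteqP; split=> x /=; rewrite in_itv/= andbT.
move=> m12 m1oo A mA.
apply: (@measure_unique _ R R (@RGenOInfty.G R)
  (fun n : nat => [set x | (- n%:R < x)%R])) => //.
- exact: RGenOInfty.measurableE.
- move=> _ _ [a ->] [b ->]; exists (Num.max a b).
  apply/seteqP; split=> x /=; rewrite !in_itv/= !andbT gt_max.
    by move=> [-> ->].
  by move=> /andP.
- by move=> i; exists (- i%:R)%R.
- apply/seteqP; split=> // x _; exists (Num.bound `|x|) => //=.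
  rewrite ltrNl (le_lt_trans (ler_norm _))// normrN.
  exact: archi_boundP (normr_ge0 _).
- by move=> _ [a ->]; rewrite -rayE.
Qed.

Context d d' (X : measurableType d) (W : measurableType d').
Variables (k : R.-pker X ~> W) (T : X * W -> R).
Hypotheses (mT : measurable_fun [set: X * W] T)
  (T01 : forall p, (0 <= T p <= 1)%R).

Let mTx x : measurable_fun [set: W] (fun w => T (x, w)).
Proof. exact: measurable_fun_pair2. Qed.

Let mTgt x (a : R) : measurable [set w | (a < T (x, w))%R].
Proof.
rewrite -[X in measurable X]setTI; have := mTx x measurableT.
move=> /(_ `]a, +oo[%classic (measurable_itv _)); congr (measurable (_ `&` _)).
by apply/seteqP; split=> w /=; rewrite in_itv/= andbT.
Qed.

Definition tail x (a : R) : \bar R := k x [set w | (a < T (x, w))%R].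

(** The quantile is read from the top, hence nonincreasing in the level [p.2]. The element 0 keeps
    the set nonempty and the constraint [a < 1] keeps it bounded. *)
Definition quantile (p : X * R) : R :=
  sup [set a | a = 0%R \/ (0 <= a < 1)%R /\ p.2%:E < tail p.1 a].

Let tail_nincr x a b : (a <= b)%R -> tail x b <= tail x a.
Proof.
move=> ab; apply: le_measure; rewrite ?inE; [exact: mTgt|exact: mTgt|].
by move=> w /=; exact: le_lt_trans.
Qed.

Let quantile_has_sup p :
  has_sup [set a | a = 0%R \/ (0 <= a < 1)%R /\ p.2%:E < tail p.1 a].
Proof.
split; first by exists 0%R; left.
by exists 1%R => a [->//|[/andP[_ /ltW]]].
Qed.

(** The nontrivial direction rests on the right continuity of [tail x]. *)
Lemma quantile_gtE x s (a : R) : (0 <= a < 1)%R ->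
  (a < quantile (x, s))%R = (s%:E < tail x a).
Proof.
move=> /andP[a0 a1]; apply/idP/idP.
  move=> /(sup_gt (quantile_has_sup (x, s)).1) [b /=] [->|[/andP[b0 b1] sb ab]]; first by rewrite ltNge a0.
  exact: lt_le_trans sb (tail_nincr _ (ltW ab)).
move=> sa.
(* These points decrease to [a], and the denominator [n + 2] keeps them below 1. The events
   [b n < T] increase to [a < T], so by continuity from below some [b n > a] still belongs to the
   set defining the quantile. *)
pose b (n : nat) : R := (a + (1 - a) / n.+2%:R)%R.
have b1 n : (0 <= b n < 1)%R.
  apply/andP; split; first by rewrite addr_ge0// divr_ge0 ?subr_ge0 ?ltW.
  by rewrite -ltrBrDl ltr_pdivrMr// ltr_pMr ?subr_gt0// ltr1n.
have [n sn] : exists n, s%:E < tail x (b n).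
  apply/not_existsP => H.
  have := @nondecreasing_cvg_mu _ _ _ (k x)
    (fun n => [set w | (b n < T (x, w))%R]).
  have -> : \bigcup_n [set w | (b n < T (x, w))%R] = [set w | (a < T (x, w))%R].
    apply/seteqP; split => [w [n _] /=|w /= aw].
      by apply: le_lt_trans; rewrite lerDl divr_ge0 ?subr_ge0 ?ltW.
    have Tp : (0 < T (x, w) - a)%R by rewrite subr_gt0.
    exists (Num.bound ((1 - a) / (T (x, w) - a)))%N => //=.
    rewrite -ltrBrDl ltr_pdivrMr// mulrC -ltr_pdivrMr//.
    apply: lt_trans (archi_boundP _) _.
      by rewrite divr_ge0 ?subr_ge0 ?ltW.
    by rewrite ltr_nat; exact: leqnSn.
  move=> /(_ (fun n => mTgt _ _) (mTgt _ _)) cv.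
  suff : tail x a <= s%:E by rewrite leNgt sa.
  have {}cv : k x [set w | (b n < T (x, w))%R] @[n --> \oo] --> tail x a.
    apply: cv => m n mn; apply/subsetPset => w /= bw; apply: le_lt_trans bw.
    rewrite lerD2l; apply: ler_wpM2l; first by rewrite subr_ge0 ltW.
    by rewrite lef_pV2 ?posrE// ler_nat !ltnS.
  apply: cvge_le cv.
  by apply: nearW => n /=; have /negP := H n; rewrite -leNgt.
apply: (@lt_le_trans _ _ (b n)).
  by rewrite ltrDl divr_gt0// subr_gt0.
by apply: (sup_upper_bound (quantile_has_sup _)); right.
Qed.

Lemma quantile01 p : (0 <= quantile p <= 1)%R.
Proof.
apply/andP; split.
  by apply: (sup_upper_bound (quantile_has_sup _)); left.
apply: ge_sup; first exact: (quantile_has_sup _).1.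
by move=> a [->//|[/andP[_ /ltW]]].
Qed.

(** For thresholds in [0, 1[, [quantile_gtE] turns the superlevel set into a comparison of two
    measurable functions; the other thresholds give everything or nothing. *)
Lemma measurable_quantile : measurable_fun [set: X * R] quantile.
Proof.
apply: (measurability _ (@RGenOInfty.measurableE R)) => _ [_ [a ->] <-].
rewrite setTI.
have [a0|a0] := ltP a 0%R.
  rewrite [X in measurable X](_ : _ = setT)//.
  apply/seteqP; split=> // p _; rewrite /= in_itv/= andbT (lt_le_trans a0)//.
  by have /andP[] := quantile01 p.
have [a1|a1] := leP 1%R a.
  rewrite [X in measurable X](_ : _ = set0)//.
  apply/seteqP; split=> // p; rewrite /= in_itv/= andbT ltNge (le_trans _ a1)//.
  by have /andP[] := quantile01 p.
have mtail : measurable_fun [set: X] (tail ^~ a).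
  rewrite (_ : tail ^~ a = fun x => k x (xsection [set p | (a < T p)%R] x)).
    apply: (measurable_fun_xsection_finite_kernel k); rewrite inE.
    rewrite -[X in measurable X]setTI; have := mT measurableT.
    move=> /(_ `]a, +oo[%classic (measurable_itv _)); congr (measurable (_ `&` _)).
    by apply/seteqP; split=> w /=; rewrite in_itv/= andbT.
  by apply/funext => x; rewrite xsectionE.
rewrite [X in measurable X](_ : _ = [set: X * R] `&`
    (fun p => p.2%:E < tail p.1 a) @^-1` [set true]).
  apply: measurable_fun_lte => //.
    by apply/measurable_EFinP; exact: measurable_snd.
  exact: measurableT_comp mtail measurable_fst.
rewrite setTI; apply/seteqP; split=> -[x s] /=;
  rewrite in_itv/= andbT quantile_gtE ?a0//.
Qed.

(** Inverse transform sampling: the quantile at a uniform level gives every right ray the mass that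
    it has under the law of [T (x, .)]. *)
Lemma integral_quantile x (h : R -> \bar R) : measurable_fun [set: R] h ->
  (forall t, 0 <= h t) ->
  \int[k x]_w h (T (x, w)) = \int[unif]_s h (quantile (x, s)).
Proof.
move=> mh h0.
have mq : measurable_fun [set: R] (fun s => quantile (x, s)).
  exact: measurable_fun_pair2 measurable_quantile.
transitivity (\int[pushforward (k x) (fun w => T (x, w))]_t h t).
  by rewrite (ge0_integral_pushforward (mTx x))// preimage_setT.
transitivity (\int[pushforward unif (fun s => quantile (x, s))]_t h t); last first.
  by rewrite (ge0_integral_pushforward mq)// preimage_setT.
apply: eq_measure_integral => A mA _.
apply: measure_rays_unique mA => a; last first.
  rewrite /= /pushforward; apply: (@le_lt_trans _ _ 1); last exact: ltry.
  exact: (pker_le1 k x (mTgt x a)).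
have Ek : pushforward (k x) (fun w => T (x, w)) [set t | (a < t)%R] = tail x a by [].
rewrite [LHS]Ek {Ek}.
rewrite [RHS](_ : _ = unif [set s | (a < quantile (x, s))%R])//.
have [a0|a0] := ltP a 0%R.
  rewrite (_ : [set s | _] = setT) ?probability_setT.
    rewrite /tail (_ : [set w | _] = setT) ?prob_kernel//.
    apply/seteqP; split=> // w _ /=; rewrite (lt_le_trans a0)//.
    by have /andP[] := T01 (x, w).
  apply/seteqP; split=> // s _ /=; rewrite (lt_le_trans a0)//.
  by have /andP[] := quantile01 (x, s).
have [a1|a1] := leP 1%R a.
  rewrite (_ : [set s | _] = set0) ?measure0.
    rewrite /tail (_ : [set w | _] = set0) ?measure0//.
    apply/seteqP; split=> // w /=; rewrite ltNge (le_trans _ a1)//.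
    by have /andP[] := T01 (x, w).
  apply/seteqP; split=> // s /=; rewrite ltNge (le_trans _ a1)//.
  by have /andP[] := quantile01 (x, s).
have t1 : tail x a <= 1 by exact: pker_le1.
have tf : tail x a \is a fin_num.
  by rewrite ge0_fin_numE ?(le_lt_trans t1) ?ltry.
rewrite (_ : [set s | _] = [set s | (s < fine (tail x a))%R]).
  by rewrite unif_itvNyo ?fineK// fine_ge0//= -lee_fin fineK.
apply/seteqP; split=> s /=; by rewrite quantile_gtE ?a0// -lte_fin fineK.
Qed.

End quantile.

(** * The continuity theorem for Laplace transforms *)

Section separating_polynomial.
Context {R : realType}.
Implicit Types (x a b e : R) (N M : nat).
Local Open Scope ring_scope.

Lemma bernoulli_ge x M : 0 <= x <= 1 -> 1 - M%:R * x <= (1 - x) ^+ M.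
Proof.
move=> /andP[x0 x1]; elim: M => [|M IH]; first by rewrite mul0r subr0.
rewrite exprS; apply: le_trans (ler_wpM2l _ IH); last by rewrite subr_ge0.
rewrite -subr_ge0 (_ : _ - _ = M%:R * x ^+ 2) ?mulr_ge0 ?sqr_ge0//.
by rewrite -natr1; ring.
Qed.

Lemma bernoulli_le x M : 0 <= x <= 1 -> (1 - x) ^+ M * (1 + M%:R * x) <= 1.
Proof.
move=> /andP[x0 x1]; elim: M => [|M IH]; first by rewrite mul0r addr0 mulr1.
rewrite exprS -mulrA mulrCA; apply: le_trans IH.
apply: ler_wpM2l; first by rewrite exprn_ge0// subr_ge0.
rewrite -subr_ge0 (_ : _ - _ = M.+1%:R * x ^+ 2) ?mulr_ge0 ?sqr_ge0//.
by rewrite -natr1; ring.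
Qed.

(* The polynomials (1 - t^N)^M are nearly the indicator function of [0, a] away
   from the gap ]a, b[: choose N with (a/b)^N small, then M about 1/(e b^N). *)
Lemma separating_power a b e : 0 <= a < b -> b <= 1 -> 0 < e ->
  exists N M, forall t, 0 <= t <= 1 ->
    [/\ t <= a -> 1 - e <= (1 - t ^+ N) ^+ M,
        b <= t -> (1 - t ^+ N) ^+ M <= e
      & 0 <= (1 - t ^+ N) ^+ M <= 1].
Proof.
move=> /andP[a0 ab] b1 e0.
have b0 : 0 < b by exact: le_lt_trans ab.
have q0 : 0 <= a / b by rewrite divr_ge0// ltW.
have q1 : `|a / b| < 1 by rewrite ger0_norm// ltr_pdivrMr// mul1r.
(* Below this threshold, [M a^N <= (e^-1 + b^N) (a/b)^N] is at most [e]. *)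
have d0 : 0 < e / (e^-1 + 1) by rewrite divr_gt0// addr_gt0// invr_gt0.
have [N qN] : exists N, (a / b) ^+ N < e / (e^-1 + 1).
  have /cvgrPdist_lt /(_ _ d0) [N _ /(_ N (leqnn _))] := cvg_expr q1.
  by rewrite sub0r normrN ger0_norm ?exprn_ge0// => ?; exists N.
have bN : 0 < b ^+ N by rewrite exprn_gt0.
pose y := (e * b ^+ N)^-1.
have y0 : 0 <= y by rewrite invr_ge0 mulr_ge0 ?ltW.
exists N, (Num.truncn y).+1 => t /andP[t0 t1].
have /andP[yl yu] := truncn_itv y0.
have tN0 : 0 <= t ^+ N by exact: exprn_ge0.
have tN1 : t ^+ N <= 1 by exact: exprn_ile1.
have tN : 0 <= t ^+ N <= 1 by rewrite tN0.
split.
- move=> ta; apply: le_trans (bernoulli_ge _ tN).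
  rewrite lerD2l lerN2.
  apply: (@le_trans _ _ ((y + 1) * a ^+ N)).
    have tNa : t ^+ N <= a ^+ N by apply: lerXn2r => //; rewrite nnegrE.
    by apply: ler_pM => //; rewrite -natr1 lerD2r.
  have -> : a ^+ N = (a / b) ^+ N * b ^+ N.
    by rewrite -exprMn divfK// gt_eqF.
  have bN1 : b ^+ N <= 1 by exact: exprn_ile1 (ltW b0) b1.
  have -> : (y + 1) * ((a / b) ^+ N * b ^+ N) = (e^-1 + b ^+ N) * (a / b) ^+ N.
    rewrite /y; field; rewrite ?gt_eqF//.
  move: qN; rewrite ltr_pdivlMr ?addr_gt0 ?invr_gt0// => /ltW; apply: le_trans.
  by rewrite mulrC; apply: ler_wpM2l; rewrite ?exprn_ge0// lerD2l.
- move=> bt.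
  have := bernoulli_le (Num.truncn y).+1 tN.
  set M := (Num.truncn y).+1; set p := (1 - _) ^+ _ => pM.
  have p0 : 0 <= p by rewrite exprn_ge0// subr_ge0.
  have : p * e^-1 <= 1.
    apply: le_trans pM; apply: ler_wpM2l => //.
    apply: (@le_trans _ _ (M%:R * b ^+ N)).
      rewrite -ler_pdivrMr//; apply/ltW; apply: le_lt_trans yu.
      by rewrite /y invfM.
    rewrite -[leLHS]add0r; apply: lerD => //; apply: ler_wpM2l => //.
    by apply: lerXn2r => //; rewrite nnegrE// ltW.
  by rewrite ler_pdivrMr// mul1r.
- by rewrite exprn_ge0 ?subr_ge0//= exprn_ile1 ?subr_ge0// gerBl.
Qed.

Lemma cvg_powR (t : nat -> R) (l u : R) : 0 < u -> (forall n, 0 <= t n) ->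
  t n @[n --> \oo] --> l -> (t n `^ u)%R @[n --> \oo] --> (l `^ u)%R.
Proof.
move=> u0 t0 tl.
have l0 : 0 <= l.
  rewrite -(cvg_lim _ tl)//; apply: limr_ge; first by apply/cvg_ex; exists l.
  exact: nearW.
move: l0; rewrite le_eqVlt => /predU1P[l0|l0].
  rewrite -l0 powR0 ?gt_eqF//; apply/cvgrPdist_lt => e e0.
  have d0 : 0 < e `^ u^-1 by exact: powR_gt0.
  move/cvgrPdist_lt : tl => /(_ _ d0); apply: filterS => n.
  rewrite -l0 !sub0r !normrN ger0_norm// ger0_norm ?powR_ge0// => tn.
  have -> : e = (e `^ u^-1) `^ u.
    by rewrite -powRrM mulVf ?gt_eqF// powRr1// ltW.
  by apply: gt0_ltr_powR; rewrite ?nnegrE// ltW.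
have tpos : \forall n \near \oo, 0 < t n by exact: (cvgr_gt l).
apply: (@cvg_trans _ ((expR (u * ln (t n))) @[n --> \oo])).
  apply: near_eq_cvg; near=> n; rewrite /powR gt_eqF//.
  by near: n.
rewrite /powR gt_eqF//.
apply: (@cvg_comp _ _ _ (fun n => u * ln (t n)) expR); last exact: continuous_expR.
apply: cvgMl_tmp; apply: (@cvg_comp _ _ _ t (@ln R)) tl _; exact: continuous_ln.
Unshelve. all: by end_near. Qed.

End separating_polynomial.

Section oscillation.
Context {R : realType}.
Implicit Types u : nat -> R.

(** One inequality is weak and the other strict, so that for quantiles they are the negation of
    [quantile_gtE] and [quantile_gtE] itself. *)
Definition oscillates u (a b : R) : Prop :=
  (forall K, exists2 n, (K <= n)%N & (u n <= a)%R) /\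
  (forall K, exists2 n, (K <= n)%N & (b < u n)%R).

(** The infimum of the eventual upper bounds is the upper limit. A sequence that returns below
    [inf S - e] infinitely often oscillates between any two rationals of the interval from
    [inf S - e] to [inf S]. Rationals are used because there are countably many pairs of them. *)
Lemma no_oscillation_cvg u : (forall n, 0 <= u n <= 1)%R ->
  (forall a b : rat, (0 <= ratr a :> R)%R -> (ratr a < ratr b :> R)%R ->
    (ratr b < 1 :> R)%R -> ~ oscillates u (ratr a) (ratr b)) ->
  cvgn u.
Proof.
move=> u01 noosc.
pose S := [set a : R | (0 <= a)%R /\ exists K, forall n, (K <= n)%N -> (u n <= a)%R].
have S1 : S 1%R by split => //; exists 0%N => n _; have /andP[] := u01 n.
have infS : has_inf S by split; [exists 1%R|exists 0%R => a []].
apply/cvg_ex; exists (inf S); apply/cvgrPdist_lt => e e0.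
have [a [a0 [K Ka]] ae] : exists2 a, S a & (a < inf S + e)%R.
  by apply: inf_lt; [exists 1%R|rewrite ltrDl].
have [M HM] : exists M, forall n, (M <= n)%N -> (inf S - e < u n)%R.
  apply: contrapT => H.
  have io : forall M, exists2 n, (M <= n)%N & (u n <= inf S - e)%R.
    move=> M; apply: contrapT => H2; apply: H; exists M => n Mn.
    by rewrite ltNge; apply/negP => un; apply: H2; exists n.
  have l0 : (0 <= inf S - e)%R.
    by have [n _] := io 0%N; apply: le_trans; have /andP[] := u01 n.
  have /rat_in_itvoo [p] : (inf S - e < inf S)%R by rewrite gtrBl.
  rewrite in_itv/= => /andP[lp pl].
  have /rat_in_itvoo [q] := pl; rewrite in_itv/= => /andP[pq ql].
  have infS1 : (inf S <= 1)%R by exact: ge_inf infS.2 _ S1.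
  apply: (noosc p q) => //.
  - exact: le_trans l0 (ltW lp).
  - exact: lt_le_trans ql _.
  split=> M.
    by have [n Mn un] := io M; exists n => //; apply: le_trans un (ltW lp).
  apply: contrapT => H2.
  suff : (inf S <= ratr q)%R by rewrite leNgt ql.
  apply: ge_inf infS.2 _ _; split.
    exact/ltW/(le_lt_trans (le_trans l0 (ltW lp))).
  exists M => n Mn; rewrite leNgt; apply/negP => qu.
  by apply: H2; exists n.
exists (maxn K M) => // n /=; rewrite geq_max => /andP[Kn Mn].
rewrite ltr_norml; apply/andP; split.
  by rewrite ltrBrDl ltrBlDr (le_lt_trans (Ka _ Kn)).
by rewrite ltrBlDl -ltrBlDr HM.
Qed.

End oscillation.

(* Families of laws are encoded by random variables on [0, 1] that are jointly
   measurable in the parameter; a kernel yields such a family by its quantiles. *)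
Definition laplace_rep (R : realType) d (X : measurableType d)
    (phi : X -> R -> R) : Prop :=
  exists Z : X * R -> R,
    [/\ measurable_fun [set: X * R] Z, (forall p, (0 <= Z p)%R)
      & forall x (u : R), (0 <= u)%R ->
          (phi x u)%:E = \int[unif]_s (expR (- (u * Z (x, s))))%:E].

Lemma integrable01 d (T : measurableType d) (R : realType)
    (P : probability T R) (f : T -> R) : measurable_fun [set: T] f ->
  (forall t, 0 <= f t <= 1)%R -> P.-integrable [set: T] (EFin \o f).
Proof.
move=> mf f01; apply: measurable_bounded_integrable => //.
  by rewrite (le_lt_trans (@probability_le1 _ _ _ P _ _))// ltry.
exists 1%R; split; first exact: num_real.
move=> M M1 t _; have /andP[f0 f1] := f01 t.
by rewrite /= ger0_norm// (le_trans f1)// ltW.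
Qed.

Lemma Rintegral01E d (T : measurableType d) (R : realType)
    (P : probability T R) (f : T -> R) : measurable_fun [set: T] f ->
  (forall t, 0 <= f t <= 1)%R -> (\int[P]_t f t)%R%:E = \int[P]_t (f t)%:E.
Proof.
move=> mf f01; rewrite /Rintegral fineK//.
exact: (integrable_fin_num measurableT (integrable01 P mf f01)).
Qed.

Section quantile_laplace.
Context {R : realType} d (X : measurableType d).

(** [Q] stands for [exp (- Z)]. Since [ln 0 = 0], the variable [- ln Q] takes the value 0 where [Z]
    should be infinite, and is correct only because [Q] vanishes on a null set of levels. *)
Lemma laplace_rep_quantile (phi : X -> R -> R) (Q : X * R -> R) :
  measurable_fun [set: X * R] Q -> (forall p, 0 <= Q p <= 1)%R ->
  (forall x (u : R), (0 <= u)%R -> (phi x u)%:E = \int[unif]_s (Q (x, s) `^ u)%:E) ->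
  (forall x, unif [set s | Q (x, s) = 0%R] = 0) ->
  laplace_rep phi.
Proof.
move=> mQ Q01 phiE Q0; exists (fun p => - ln (Q p))%R; split.
- by apply: measurableT_comp => //; exact: measurableT_comp mQ.
- by move=> p; rewrite oppr_ge0 ln_le0//; have /andP[] := Q01 p.
move=> x u u0; rewrite phiE//.
have mQx : measurable_fun [set: R] (fun s => Q (x, s)).
  exact: measurable_fun_pair2 mQ.
apply: ae_eq_integral => //.
- by apply/measurable_EFinP; exact: (measurableT_comp (measurable_powR u) mQx).
- apply/measurable_EFinP; apply: measurableT_comp => //; apply: measurableT_comp => //.
  apply: measurable_funM => //; apply: measurableT_comp => //.
  exact: measurableT_comp mQx.
exists [set s | Q (x, s) = 0%R]; split; last 1 first.
- move=> s /= H; apply: contrapT => /eqP Qn0; apply: H => _.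
  by rewrite /powR (negbTE Qn0) mulrN opprK.
- by rewrite -[X in measurable X]setTI; exact: (mQx measurableT [set 0%R]).
- exact: Q0.
Qed.

(** Replacing [exp (- Z)] by its quantile function keeps all Laplace transforms and reduces an
    arbitrary auxiliary space [W] to uniform levels. The quantile vanishes with probability 0
    because [exp (- Z)] never does. *)
Lemma laplace_rep_kernel d' (W : measurableType d') (k : R.-pker X ~> W)
    (Z : X * W -> R) (phi : X -> R -> R) :
  measurable_fun [set: X * W] Z -> (forall p, (0 <= Z p)%R) ->
  (forall x (u : R), (0 <= u)%R ->
    (phi x u)%:E = \int[k x]_w (expR (- (u * Z (x, w))))%:E) ->
  laplace_rep phi.
Proof.
move=> mZ Z0 phiE; pose T p : R := expR (- Z p).
have mT : measurable_fun [set: X * W] T.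
  by apply: measurableT_comp => //; exact: measurableT_comp.
have T01 p : (0 <= T p <= 1)%R.
  by rewrite expR_ge0 /= -expR0 ler_expR oppr_le0.
apply: (@laplace_rep_quantile phi (quantile k T)).
- exact: measurable_quantile.
- exact: quantile01.
- move=> x u u0; rewrite phiE//.
  rewrite -(@integral_quantile _ _ _ _ _ k T mT T01 x (fun t => (t `^ u)%:E)).
  + apply: eq_integral => w _; rewrite /T /powR gt_eqF ?expR_gt0//.
    by rewrite expRK mulrN.
  + by apply/measurable_EFinP; exact: measurable_powR.
  + by move=> t; rewrite lee_fin powR_ge0.
- move=> x; pose h (t : R) : \bar R := (\1_[set 0%R] t)%:E.
  have mh : measurable_fun [set: R] h by exact/measurable_EFinP.
  have h0 t : 0 <= h t by rewrite lee_fin.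
  have mQx : measurable_fun [set: R] (fun s => quantile k T (x, s)).
    by apply: measurable_fun_pair2; exact: measurable_quantile.
  have mA : measurable [set s | quantile k T (x, s) = 0%R].
    rewrite -[X in measurable X]setTI; exact: (mQx measurableT [set 0%R]).
  rewrite -[X in unif X]setIT -integral_indic//.
  have := integral_quantile k mT T01 x mh h0.
  rewrite [X in _ = X -> _](_ : _ = \int[unif]_s
    (\1_[set s | quantile k T (x, s) = 0%R] s)%:E)//.
  move=> <-; apply: integral0_eq => w _.
  by rewrite /h indicE memNset//= => /eqP; rewrite gt_eqF ?expR_gt0.
Qed.

End quantile_laplace.

Lemma near_limit_le (R : realType) (l x y e : R) :
  (`|l - x| < e -> `|l - y| < e -> x + e <= y + 3 * e)%R.
Proof. by rewrite !ltr_norml => /andP[? ?] /andP[? ?]; lra. Qed.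

Lemma ge0_integralD_cst d (T : measurableType d) (R : realType)
    (P : probability T R) (f : T -> R) (e : R) : measurable_fun [set: T] f ->
  (forall t, 0 <= f t)%R -> (0 <= e)%R ->
  \int[P]_t (f t + e)%:E = \int[P]_t (f t)%:E + e%:E.
Proof.
move=> mf f0 e0; under eq_integral do rewrite EFinD.
rewrite (@ge0_integralD _ _ _ P _ measurableT (EFin \o f) (cst e%:E))//.
- by rewrite integral_cst// [X in _ * X](@probability_setT _ _ _ P) mule1.
- by move=> t _; rewrite lee_fin.
- exact/measurable_EFinP.
Qed.

Section laplace_continuity.
Context {R : realType} d (X : measurableType d).
Variables (phi_ : nat -> X -> R -> R) (phi : X -> R -> R).
Hypotheses (phi_rep : forall n, laplace_rep (phi_ n))
  (phi_cvg : forall x (u : R), (0 <= u)%R -> phi_ n x u @[n --> \oo] --> phi x u)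
  (phi_cvg1 : forall x (e : R), (0 < e)%R ->
    exists2 u : R, (0 < u)%R & (1 - e <= phi x u)%R).

Let Z n : X * R -> R := projT1 (cid (phi_rep n)).

Let mZ n : measurable_fun [set: X * R] (Z n).
Proof. by rewrite /Z; case: cid => ? []. Qed.

Let Z0 n p : (0 <= Z n p)%R.
Proof. by rewrite /Z; case: cid => ? []. Qed.

Let phiE n x (u : R) : (0 <= u)%R ->
  (phi_ n x u)%:E = \int[unif]_s (expR (- (u * Z n (x, s))))%:E.
Proof. by rewrite /Z; case: cid => ? [? ?]; exact. Qed.

Let T n (p : X * R) : R := expR (- Z n p).

Let mT n : measurable_fun [set: X * R] (T n).
Proof. by apply: measurableT_comp => //; exact: measurableT_comp. Qed.

Let T01 n p : (0 <= T n p <= 1)%R.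
Proof. by rewrite expR_ge0 /= -expR0 ler_expR oppr_le0. Qed.

Let mTx n x : measurable_fun [set: R] (fun s => T n (x, s)).
Proof. exact: measurable_fun_pair2 (mT n). Qed.

Let k : R.-pker X ~> R := kcst unif.

Let Q n := quantile k (T n).

(** The factor [t ^+ j] makes the family stable under expanding one factor [1 - t ^+ N]. The means
    of these polynomials then converge by induction on [M], from the moments of order [j], which are
    the Laplace transforms at [j]. *)
Let mixed (N M j : nat) (t : R) : R := ((1 - t ^+ N) ^+ M * t ^+ j)%R.

Let mixed01 N M j t : (0 <= t <= 1)%R -> (0 <= mixed N M j t <= 1)%R.
Proof.
move=> /andP[t0 t1]; have tN1 : (t ^+ N <= 1)%R by exact: exprn_ile1.
have tN0 : (0 <= t ^+ N)%R by exact: exprn_ge0.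
rewrite /mixed mulr_ge0 ?exprn_ge0 ?subr_ge0//=.
by rewrite mulr_ile1 ?exprn_ge0 ?exprn_ile1 ?subr_ge0// gerBl.
Qed.

Let mmixed N M j : measurable_fun [set: R] (mixed N M j).
Proof.
apply: measurable_funM; apply: measurable_funX => //.
by apply: measurable_funB => //; exact: measurable_funX.
Qed.

Let mmixedT n x N M j : measurable_fun [set: R] (fun s => mixed N M j (T n (x, s))).
Proof. exact: measurableT_comp (mmixed N M j) (mTx n x). Qed.

Let mean n x N M j : R := (\int[unif]_s mixed N M j (T n (x, s)))%R.

Let mean_cvg x N M j : cvgn (fun n => mean n x N M j).
Proof.
elim: M j => [|M IH] j.
  apply/cvg_ex; exists (phi x j%:R); have := @phi_cvg x _ (ler0n R j).
  apply: cvg_trans; apply: near_eq_cvg; apply: nearW => n; apply: EFin_inj.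
  rewrite phiE// /mean Rintegral01E//.
  - apply: eq_integral => s _.
    by rewrite /mixed expr0 mul1r /T -expRM_natl mulrN.
  - by move=> s; apply: mixed01.
have -> : (fun n => mean n x N M.+1 j) =
    (fun n => mean n x N M j - mean n x N M (j + N))%R.
  apply/funext => n; rewrite /mean -RintegralB//.
  - apply: eq_Rintegral => s _.
    by rewrite /mixed exprD exprSr; ring.
  - by apply: integrable01 => // s; exact: mixed01.
  - by apply: integrable01 => // s; exact: mixed01.
exact: is_cvgB.
Qed.

Let mgt n x (a : R) : measurable [set s | (a < T n (x, s))%R].
Proof.
rewrite -[X in measurable X]setTI; have := mTx n x measurableT.
move=> /(_ `]a, +oo[%classic (measurable_itv _)); congr (measurable (_ `&` _)).
by apply/seteqP; split=> w /=; rewrite in_itv/= andbT.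
Qed.

(** A polynomial close to 0 below [a] and close to 1 above [b] lies, up to a small error, between
    the indicators of the two tails, and its mean converges. The gap between [a] and [b] absorbs
    possible atoms of the limit law. *)
Let tail_compare x (a b e : R) : (0 <= a < b)%R -> (b <= 1)%R -> (0 < e)%R ->
  exists K, forall n m, (K <= n)%N -> (K <= m)%N ->
    tail k (T m) x b <= tail k (T n) x a + e%:E.
Proof.
move=> ab b1 e0.
(* Two quarters are spent on the polynomial comparisons, two on the distances of [C n] and [C m] to
   their limit. *)
have e4 : (0 < e / 4)%R by rewrite divr_gt0.
have [N [M sep]] := separating_power ab b1 e4.
pose c n s : R := (1 - mixed N M 0 (T n (x, s)))%R.
have c01 n s : (0 <= c n s <= 1)%R.
  have /andP[g0 g1] := mixed01 N M 0 (T01 n (x, s)).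
  by rewrite subr_ge0 g1 gerBl.
have mc n : measurable_fun [set: R] (c n) by exact: measurable_funB.
pose C n : R := (\int[unif]_s c n s)%R.
have CE n : (C n)%:E = \int[unif]_s (c n s)%:E by rewrite Rintegral01E.
have Ccvg : cvgn C.
  have -> : C = (fun n => 1 - mean n x N M 0)%R.
    apply/funext => n; rewrite /C /mean /c RintegralB//.
    - by rewrite Rintegral_cst// [X in fine X](_ : _ = 1) ?mulr1//; exact: probability_setT.
    - by apply: integrable01 => // s; rewrite ler01 lexx.
    - by apply: integrable01 => // s; exact: mixed01.
  by apply: is_cvgB; [exact: is_cvg_cst|exact: mean_cvg].
have tailE n a' : tail k (T n) x a' =
    \int[unif]_s (\1_[set s | (a' < T n (x, s))%R] s)%:E.
  by rewrite integral_indic ?setIT//; exact: mgt.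
have upper n : tail k (T n) x b <= (C n + e / 4)%:E.
  rewrite EFinD CE tailE -ge0_integralD_cst//; [|by move=> s; have /andP[] := c01 n s|exact: ltW].
  apply: ge0_le_integral => //.
  - by apply/measurable_EFinP; apply: measurable_indic; exact: mgt.
  - by apply/measurable_EFinP; exact: measurable_funD.
  move=> s _; rewrite lee_fin indicE.
  have [s1 s2 s3] := sep _ (T01 n (x, s)).
  case: (boolP (_ \in _)) => [|_] /=.
    by rewrite inE /= /c /mixed expr0 mulr1 => /ltW /s2 ?; lra.
  by apply: addr_ge0; [have /andP[] := c01 n s|exact: ltW].
have lower n : (C n)%:E <= tail k (T n) x a + (e / 4)%:E.
  rewrite CE tailE -ge0_integralD_cst; [|by apply: measurable_indic; exact: mgt|by []|exact: ltW].
  apply: ge0_le_integral => //.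
  - by move=> s _; rewrite lee_fin; have /andP[] := c01 n s.
  - exact/measurable_EFinP.
  - by apply/measurable_EFinP; apply: measurable_funD => //; exact: mgt.
  move=> s _; rewrite lee_fin indicE.
  have [s1 s2 s3] := sep _ (T01 n (x, s)).
  case: (boolP (_ \in _)) => [_|] /=.
    by have /andP[_ c1] := c01 n s; apply: le_trans c1 _; rewrite lerDl ltW.
  rewrite notin_setE /= /c /mixed expr0 mulr1 => /negP; rewrite -leNgt => /s1 ?.
  by lra.
have [l /cvgrPdist_lt /(_ _ e4) [K _ HK]] := (cvg_ex _).1 Ccvg.
exists K => n m Kn Km.
have := HK _ Kn; have := HK _ Km; rewrite /= => Hm Hn.
apply: le_trans (upper m) _.
apply: (@le_trans _ _ ((C n)%:E + (3 * (e / 4))%:E)).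
  by rewrite -EFinD lee_fin; exact: near_limit_le Hm Hn.
apply: (le_trans (leeD (lower n) (lexx _))).
rewrite -addeA -EFinD leeD2l// lee_fin -[X in (X + _)%R]mul1r -mulrDl.
by rewrite -(@natrD _ 1 3) mulrC divfK.
Qed.

Let Q01 n p : (0 <= Q n p <= 1)%R.
Proof. exact: quantile01. Qed.

(** At most one level oscillates. For two such levels [s < s'] there are arbitrarily large [n] and
    [m] with [tail n a <= s] and [s' < tail m b], which [tail_compare] excludes for an error of half
    of [s' - s]. *)
Let oscillation_null x (a b : R) : (0 <= a)%R -> (a < b)%R -> (b < 1)%R ->
  unif.-negligible [set s | oscillates (fun n => Q n (x, s)) a b].
Proof.
move=> a0 ab b1; have a1 : (a < 1)%R by exact: lt_trans ab b1.
have b0 : (0 <= b)%R by exact: le_trans a0 (ltW ab).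
have uniq s s' : oscillates (fun n => Q n (x, s)) a b ->
    oscillates (fun n => Q n (x, s')) a b -> ~ (s < s')%R.
  move=> [loa _] [_ hib] ss'.
  have e0 : (0 < (s' - s) / 2)%R by rewrite divr_gt0// subr_gt0.
  have ab0 : (0 <= a < b)%R by rewrite a0.
  have [K HK] := tail_compare x ab0 (ltW b1) e0.
  have [n Kn] := loa K; rewrite leNgt quantile_gtE ?a0// -leNgt => ns.
  have [m Km] := hib K; rewrite quantile_gtE ?b0// => ms.
  have := lt_le_trans ms (le_trans (HK _ _ Kn Km) (leeD ns (lexx _))).
  by rewrite -EFinD lte_fin; lra.
have [[s0 Es0]|E0] := pselect (exists s, oscillates (fun n => Q n (x, s)) a b).
  exists [set s0]; split; [exact: measurable_set1|exact: unif_set1|].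
  move=> s /= Es; apply/eqP; rewrite eq_le; apply/andP; split; rewrite leNgt.
    by apply/negP; exact: uniq.
  by apply/negP; exact: uniq.
by exists set0; split => // s /= Es; apply: E0; exists s.
Qed.

Let Q_cvg_ae x : {ae unif, forall s, cvgn (fun n => Q n (x, s))}.
Proof.
pose F n : set R := if @choice.unpickle (rat * rat)%type n is Some (a, b) then
  if [&& 0 <= ratr a :> R, ratr a < ratr b :> R & ratr b < 1 :> R]%R then
    [set s | oscillates (fun n => Q n (x, s)) (ratr a) (ratr b)]
  else set0 else set0.
have : unif.-negligible (\bigcup_n F n).
  apply: negligible_bigcup => n; rewrite /F.
  case: choice.unpickle => [[a b]|]; last exact: negligible_set0.
  case: ifPn => [/and3P[a0 ab b1]|_]; last exact: negligible_set0.
  exact: oscillation_null.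
apply: negligibleS => s /= H; apply: contrapT => H2; apply: H.
apply: no_oscillation_cvg => // a b a0 ab b1 osc; apply: H2.
exists (choice.pickle (a, b)); first exact: Logic.I.
by rewrite /F choice.pickleK a0 ab b1; exact: osc.
Qed.

(** The upper limit is defined and measurable everywhere, and is the limit at almost every level. *)
Let Qsup p : R := limn_sup (fun n => Q n p).

Let Q_bound p : bounded_fun (fun n => Q n p).
Proof.
exists 1%R; split; first exact: num_real.
move=> M M1 n _; have /andP[q0 q1] := Q01 n p.
by rewrite /= ger0_norm// (le_trans q1)// ltW.
Qed.

Let mQsup : measurable_fun [set: X * R] Qsup.
Proof.
apply: measurable_fun_limn_sup.
- by move=> p _; exists 1%R => _ [n _ <-]; have /andP[] := Q01 n p.
- by move=> p _; exists 0%R => _ [n _ <-]; have /andP[] := Q01 n p.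
- by move=> n; exact: measurable_quantile.
Qed.

Let Qsup01 p : (0 <= Qsup p <= 1)%R.
Proof.
have ubn n : has_ubound (sdrop (fun n => Q n p) n).
  by exists 1%R => _ [m _ <-]; have /andP[] := Q01 m p.
have sups01 n : (0 <= sups (fun n => Q n p) n <= 1)%R.
  apply/andP; split.
    have /andP[q0 _] := Q01 n p; apply: le_trans q0 _.
    by apply: ub_le_sup => //; exists n => /=.
  apply: ge_sup; first by exists (Q n p); exists n => /=.
  by move=> _ [m _ <-]; have /andP[] := Q01 m p.
rewrite /Qsup limn_supE//; apply/andP; split.
  apply: lb_le_inf; first by exists (sups (fun n => Q n p) 0%N); exists 0%N.
  by move=> _ [n _ <-]; have /andP[] := sups01 n.
apply: (@le_trans _ _ (sups (fun n => Q n p) 0%N)).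
  apply: ge_inf; last by exists 0%N.
  by exists 0%R => _ [n _ <-]; have /andP[] := sups01 n.
by have /andP[] := sups01 0%N.
Qed.

Let powR01 (t u : R) : (0 <= u)%R -> (0 <= t <= 1)%R -> (0 <= t `^ u <= 1)%R.
Proof.
move=> u0 /andP[t0 t1]; rewrite powR_ge0/= (_ : 1%R = (1 `^ u)%R); last by rewrite powR1.
by apply: ge0_ler_powR => //; rewrite nnegrE.
Qed.

Let phi_lim x (u : R) : (0 < u)%R -> (phi x u)%:E = \int[unif]_s (Qsup (x, s) `^ u)%:E.
Proof.
move=> u0.
have mpow (f : R -> R) : measurable_fun [set: R] f ->
    measurable_fun [set: R] (fun s => (f s `^ u)%:E).
  by move=> mf; apply/measurable_EFinP; exact: (measurableT_comp (measurable_powR u) mf).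
have mQx n : measurable_fun [set: R] (fun s => Q n (x, s)).
  by apply: measurable_fun_pair2; exact: measurable_quantile.
have cv : \int[unif]_s (Q n (x, s) `^ u)%:E @[n --> \oo] -->
    \int[unif]_s (Qsup (x, s) `^ u)%:E.
  have [] := @dominated_convergence _ _ _ unif setT measurableT
    (fun n s => (Q n (x, s) `^ u)%:E) (fun s => (Qsup (x, s) `^ u)%:E) (cst 1)
    (fun n => mpow _ (mQx n)) (mpow _ (measurable_fun_pair2 x mQsup)).
  - apply: filterS (Q_cvg_ae x) => s cvs _; apply: cvg_EFin; first exact: nearW.
    apply: cvg_powR => //; first by move=> n; have /andP[] := Q01 n (x, s).
    by rewrite /Qsup cvg_limn_supE.
  - by apply: integrable01 => // s; rewrite ler01 lexx.
  - apply: aeW => s n _; have /andP[q0 q1] := powR01 (ltW u0) (Q01 n (x, s)).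
    by rewrite lee_fin ger0_norm.
  - by [].
have cv2 : (phi_ n x u)%:E @[n --> \oo] --> (phi x u)%:E.
  by apply: cvg_EFin; [exact: nearW|exact: phi_cvg (ltW u0)].
apply: (cvg_unique _ cv2) => //; apply: cvg_trans cv; apply: near_eq_cvg.
apply: nearW => n; rewrite phiE ?ltW//.
rewrite -(integral_quantile k (mT n) (T01 n) x (mpow _ (@measurable_id _ _ setT))).
  apply: eq_integral => s _; rewrite /T /powR gt_eqF ?expR_gt0//.
  by rewrite expRK mulrN.
by move=> t; rewrite lee_fin powR_ge0.
Qed.

(* The quantiles of exp(-Z_n) are compared through the moments of exp(-Z_n), and
   converge at every level except at most one for each pair of rationals. *)
Lemma laplace_rep_cvg : laplace_rep phi.
Proof.
have mQx x : measurable_fun [set: R] (fun s => Qsup (x, s)).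
  exact: measurable_fun_pair2 mQsup.
apply: (laplace_rep_quantile mQsup Qsup01).
  move=> x u; rewrite le_eqVlt => /predU1P[<-|/phi_lim//].
  under eq_integral do rewrite powRr0.
  rewrite integral_cst// [X in _ * X](@probability_setT _ _ _ unif) mule1.
  have H : phi_ n x 0%R @[n --> \oo] --> phi x 0%R by exact: phi_cvg.
  congr EFin; apply: (cvg_unique _ H) => //.
  have -> : (fun n => phi_ n x 0%R) = cst 1%R; last exact: cvg_cst.
  apply/funext => n; apply: EFin_inj; rewrite phiE//.
  under eq_integral do rewrite mul0r oppr0 expR0.
  by rewrite integral_cst// [X in _ * X](@probability_setT _ _ _ unif) mule1.
(* [A] is the event that mass escapes to infinity. The power [u] of [Qsup] vanishes there, so
   [phi x u + unif A <= 1]; as [phi x u] comes arbitrarily close to 1 for suitable [u > 0], [A] is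
   null. *)
move=> x; set A := [set s | _].
have mA : measurable A.
  by rewrite -[X in measurable X]setTI; exact: (mQx x measurableT [set 0%R]).
apply/eqP; rewrite eq_le measure_ge0 andbT; apply/lee_addgt0Pr => e e0.
rewrite add0e; have [u u0 ue] := @phi_cvg1 x e e0.
have mp : measurable_fun [set: R] (fun s => (Qsup (x, s) `^ u)%:E).
  by apply/measurable_EFinP; exact: (measurableT_comp (measurable_powR u) (mQx x)).
have : (phi x u)%:E + unif A <= 1.
  rewrite phi_lim// -[X in unif X]setIT -integral_indic// -ge0_integralD//; first last.
  - exact/measurable_EFinP.
  - by move=> s _; rewrite lee_fin powR_ge0.
  apply: (@le_trans _ _ (\int[unif]_s (cst 1 s))).
    apply: ge0_le_integral => //.
    - by move=> s _; rewrite adde_ge0// lee_fin powR_ge0.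
    - by apply: emeasurable_funD => //; exact/measurable_EFinP.
    move=> s _; rewrite indicE; case: (boolP (_ \in A)) => [|_].
      by rewrite inE /A /= => ->; rewrite powR0 ?gt_eqF// add0e.
    by rewrite adde0 lee_fin; have /andP[] := powR01 (ltW u0) (Qsup01 (x, s)).
  by rewrite integral_cst// [X in _ * X](@probability_setT _ _ _ unif) mule1.
have A1 : unif A <= 1 by exact: probability_le1.
have Af : unif A \is a fin_num by rewrite ge0_fin_numE// (le_lt_trans A1)// ltry.
rewrite -(fineK Af) -EFinD !lee_fin; lra.
Qed.

End laplace_continuity.

(** * Laplace transforms of families of laws *)

Section kernel_bind.
Context d1 d2 d3 (X : measurableType d1) (Y : measurableType d2)
  (Z : measurableType d3) (R : realType).
Variables (l : R.-pker X ~> Y) (k : R.-pker (X * Y) ~> Z).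

Definition kbind : X -> {measure set Z -> \bar R} := mkcomp l k.

Let kbind_measurable (A : set Z) : measurable A ->
  measurable_fun [set: X] (kbind ^~ A).
Proof. exact: measurable_fun_mkcomp_sfinite. Qed.

HB.instance Definition _ := isKernel.Build _ _ _ _ _ kbind kbind_measurable.

Let kbind_prob x : kbind x [set: Z] = 1.
Proof.
rewrite [LHS](_ : _ = \int[l x]_y k (x, y) [set: Z])//.
under eq_integral do rewrite prob_kernel.
by rewrite integral_cst// prob_kernel mule1.
Qed.

HB.instance Definition _ := Kernel_isProbability.Build _ _ _ _ _ kbind kbind_prob.

Lemma integral_kbind x (f : Z -> \bar R) : (forall z, 0 <= f z) ->
  measurable_fun [set: Z] f ->
  \int[kbind x]_z f z = \int[l x]_y \int[k (x, y)]_z f z.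
Proof. exact: integral_kcomp. Qed.

End kernel_bind.

Section laplace_closure.
Context {R : realType} d (X : measurableType d).
Implicit Types phi psi : X -> R -> R.

Lemma laplace_rep01 phi x (u : R) : laplace_rep phi -> (0 <= u)%R ->
  (0 <= phi x u <= 1)%R.
Proof.
move=> [Z [mZ Z0 phiE]] u0; rewrite -!lee_fin phiE//; apply/andP; split.
  by apply: integral_ge0 => s _; rewrite lee_fin expR_ge0.
apply: (@le_trans _ _ (\int[unif]_s (cst 1 s))).
  apply: ge0_le_integral => //.
  - apply/measurable_EFinP; apply: measurableT_comp => //.
    apply: measurableT_comp => //; apply: measurable_funM => //.
    exact: measurable_fun_pair2 mZ.
  - by move=> s _; rewrite lee_fin -expR0 ler_expR oppr_le0 mulr_ge0.
by rewrite integral_cst// [X in _ * X](@probability_setT _ _ _ unif) mule1.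
Qed.

Lemma laplace_rep_scale d' (X' : measurableType d') phi (g : X' -> X)
    (c : X' -> R) : laplace_rep phi -> measurable_fun [set: X'] g ->
  measurable_fun [set: X'] c -> (forall x, 0 <= c x)%R ->
  laplace_rep (fun x u => phi (g x) (u * c x)%R).
Proof.
move=> [Z [mZ Z0 phiE]] mg mc c0.
exists (fun p => c p.1 * Z (g p.1, p.2))%R; split.
- apply: measurable_funM; first exact: measurableT_comp.
  apply: (measurableT_comp mZ); apply: measurable_fun_pair => //.
  exact: measurableT_comp mg measurable_fst.
- by move=> p; rewrite mulr_ge0.
- move=> x u u0; rewrite (phiE _ _ (mulr_ge0 u0 (c0 x))).
  by apply: eq_integral => s _; rewrite mulrA.
Qed.

(** The sum of two variables driven by independent uniform levels; [laplace_rep_kernel] brings the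
    pair of levels back to one. *)
Lemma laplace_rep_mul phi psi : laplace_rep phi -> laplace_rep psi ->
  laplace_rep (fun x u => phi x u * psi x u)%R.
Proof.
move=> [Z1 [mZ1 Z10 phiE]] [Z2 [mZ2 Z20 psiE]].
apply: (@laplace_rep_kernel _ _ _ _ _ (@kcst _ _ X _ R (unif \x unif))
  (fun p => Z1 (p.1, p.2.1) + Z2 (p.1, p.2.2))%R).
- apply: measurable_funD.
    apply: (measurableT_comp mZ1).
    by apply: measurable_fun_pair => //; apply: measurableT_comp.
  apply: (measurableT_comp mZ2).
  by apply: measurable_fun_pair => //; apply: measurableT_comp.
- by move=> p; rewrite addr_ge0.
move=> x u u0; pose f (s t : R) : R := expR (- (u * (Z1 (x, s) + Z2 (x, t)))).
have m1 : measurable_fun [set: R] (fun s => expR (- (u * Z1 (x, s)))).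
  apply: measurableT_comp => //; apply: measurableT_comp => //.
  by apply: measurable_funM => //; exact: measurable_fun_pair2 mZ1.
have m2 : measurable_fun [set: R] (fun s => expR (- (u * Z2 (x, s)))).
  apply: measurableT_comp => //; apply: measurableT_comp => //.
  by apply: measurable_funM => //; exact: measurable_fun_pair2 mZ2.
rewrite [RHS](_ : _ = \int[unif \x unif]_w
    ((expR (- (u * Z1 (x, w.1)))) * (expR (- (u * Z2 (x, w.2)))))%:E); last first.
  by apply: eq_integral => w _; rewrite -expRD -opprD -mulrDr.
rewrite fubini_tonelli1//; last first.
  apply/measurable_EFinP; apply: measurable_funM.
    exact: measurableT_comp m1 measurable_fst.
  exact: measurableT_comp m2 measurable_snd.
have psi0 : 0 <= (psi x u)%:E.
  by rewrite psiE//; apply: integral_ge0 => s _; rewrite lee_fin expR_ge0.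
rewrite EFinM phiE// -ge0_integralZr//; last exact/measurable_EFinP.
apply: eq_integral => s _; rewrite /fubini_F /= psiE//.
by rewrite -ge0_integralZl//; exact/measurable_EFinP.
Qed.

Lemma laplace_rep_mixture d' (V : measurableType d') (k : R.-pker X ~> V)
    (f : X * V -> R -> R) phi : laplace_rep f ->
  (forall x (u : R), (0 <= u)%R -> (phi x u)%:E = \int[k x]_v (f (x, v) u)%:E) ->
  laplace_rep phi.
Proof.
move=> [Z [mZ Z0 fE]] phiE.
pose K := mkimage (@kcst _ _ (X * V)%type R R unif) (@measurable_id _ _ setT) mZ.
(* The kernel draws [v], then the value of [Z]. That value is nonnegative almost surely; the
   absolute value makes the variable nonnegative on the whole line. *)
apply: (@laplace_rep_kernel _ _ _ _ _ (kbind k K) (fun p => `|p.2|%R)).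
- by apply: measurableT_comp => //; exact: measurable_snd.
- by move=> p; exact: normr_ge0.
move=> x u u0; have mE : measurable_fun [set: R] (fun z => (expR (- (u * `|z|)))%:E).
  apply/measurable_EFinP; apply: measurableT_comp => //.
  by apply: measurableT_comp => //; exact: measurable_funM.
rewrite phiE// integral_kbind//.
apply: eq_integral => v _; rewrite integral_kimage//.
by rewrite fE//; apply: eq_integral => s _; rewrite /= ger0_norm.
Qed.

End laplace_closure.

(** * Slopes of Laplace transforms and their limits at the origin *)

Section compensated_exponential.
Context {R : realType}.
Implicit Types a b s u v z : R.
Local Open Scope ring_scope.

Definition kappa s : R := expR (- s) - 1 + s.

Lemma kappa_ge0 s : 0 <= kappa s.
Proof. by have := expR_ge1Dx (- s); rewrite /kappa; lra. Qed.

Lemma kappa_nd a b : 0 <= a -> a <= b -> kappa a <= kappa b.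
Proof.
move=> a0 ab; rewrite /kappa.
have ea : expR (- a) <= 1 by rewrite -expR0 ler_expR oppr_le0.
have := expR_ge1Dx (- (b - a)).
have -> : expR (- b) = expR (- a) * expR (- (b - a)).
  by rewrite -expRD; congr expR; ring.
have := expR_ge0 (- a); set x := expR (- a) in ea *; set y := expR _.
by nra.
Qed.

Lemma kappa_le s : 0 <= s -> kappa s <= s /\ kappa s <= s ^+ 2.
Proof.
move=> s0; have s1 : 0 < 1 + s by rewrite ltr_pwDl.
have e1 : expR (- s) * (1 + s) <= 1.
  by rewrite expRN mulrC ler_pdivrMr ?expR_gt0// mul1r expR_ge1Dx.
have e2 : expR (- s) <= 1 by rewrite -expR0 ler_expR oppr_le0.
by rewrite /kappa; split; nra.
Qed.

(** Concavity of [1 - exp (- u z)] in [u], derived from [1 + x <= exp x] at [x = u z] and at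
    [x = u z - v z]. *)
Lemma expR_slope_nincr u v z : 0 < u -> u <= v -> 0 <= z ->
  (1 - expR (- (v * z))) / v <= (1 - expR (- (u * z))) / u.
Proof.
move=> u0 uv z0; have v0 : 0 < v by exact: lt_le_trans uv.
have h0 := expR_ge1Dx (u * z).
have h1 := expR_ge1Dx (u * z - v * z).
have e0 : expR 0 = expR (- (u * z)) * expR (u * z) :> R.
  by rewrite -expRD addNr.
have e1 : expR (- (v * z)) = expR (- (u * z)) * expR (u * z - v * z).
  by rewrite -expRD; congr expR; ring.
have x0 := expR_gt0 (- (u * z)).
rewrite expR0 in e0.
rewrite ler_pdivrMr// mulrAC ler_pdivlMr//.
move: e0 e1 h0 h1 x0; set x := expR (- (u * z)); set y := expR (u * z).
set w := expR (u * z - v * z) => e0 -> h0 h1 x0.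
have k0 : x * (1 + u * z) <= 1 by rewrite [leRHS]e0 ler_pM2l.
have k1 : x * (1 + (u * z - v * z)) <= x * w by rewrite ler_pM2l.
have : (v - u) * (x * (1 + u * z)) <= (v - u) * 1.
  by apply: ler_wpM2l; rewrite ?subr_ge0.
have : u * (x * (1 + (u * z - v * z))) <= u * (x * w).
  by apply: ler_wpM2l; rewrite // ltW.
lra.
Qed.

Lemma expR_slope_bounds u z : 0 < u -> 0 <= z ->
  z - u * z ^+ 2 <= (1 - expR (- (u * z))) / u <= z.
Proof.
move=> u0 z0; have uz0 : 0 <= u * z by rewrite mulr_ge0// ltW.
have [_] := kappa_le uz0; have := kappa_ge0 (u * z); rewrite /kappa => k0 k1.
rewrite ler_pdivlMr// ler_pdivrMr// (mulrC z u).
have -> : (z - u * z ^+ 2) * u = u * z - (u * z) ^+ 2 by ring.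
by apply/andP; split; lra.
Qed.

End compensated_exponential.

Section laplace_slope.
Context {R : realType} d (T : measurableType d) (mu : {measure set T -> \bar R}).
Hypothesis mu1 : mu [set: T] = 1.
Variables (Z : T -> R) (L : R -> R).
Hypotheses (mZ : measurable_fun [set: T] Z) (Z0 : forall t, (0 <= Z t)%R)
  (LE : forall u : R, (0 <= u)%R -> (L u)%:E = \int[mu]_t (expR (- (u * Z t)))%:E).

Let mexp u : measurable_fun [set: T] (fun t => expR (- (u * Z t))).
Proof.
apply: measurableT_comp => //; apply: measurableT_comp => //.
exact: measurable_funM.
Qed.

Let msl u : measurable_fun [set: T] (fun t => (((1 - expR (- (u * Z t))) / u)%:E)).
Proof.
apply/measurable_EFinP; apply: measurable_funM => //.
exact: measurable_funB.
Qed.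

Lemma laplace_slopeE (u : R) : (0 < u)%R ->
  ((1 - L u) / u)%:E = \int[mu]_t ((1 - expR (- (u * Z t))) / u)%:E.
Proof.
move=> u0.
have e1 t : (0 <= 1 - expR (- (u * Z t)))%R.
  by rewrite subr_ge0 -expR0 ler_expR oppr_le0 mulr_ge0// ltW.
have I1 : \int[mu]_t (1 - expR (- (u * Z t)))%:E = (1 - L u)%:E.
  have : \int[mu]_t (1 - expR (- (u * Z t)))%:E + (L u)%:E = 1.
    rewrite LE ?ltW// -ge0_integralD//.
    - under eq_integral do rewrite -EFinD subrK.
      by rewrite integral_cst// mul1e.
    - by move=> t _; rewrite lee_fin.
    - exact/measurable_EFinP/measurable_funB.
    - exact/measurable_EFinP.
  rewrite EFinB => <-; rewrite addeK//.
under eq_integral do rewrite EFinM.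
rewrite ge0_integralZr//.
- by rewrite I1 EFinM.
- exact/measurable_EFinP/measurable_funB.
- by move=> t _; rewrite lee_fin.
- by rewrite lee_fin invr_ge0 ltW.
Qed.

Lemma laplace_slope_ge0 (u : R) : (0 < u)%R -> (0 <= (1 - L u) / u)%R.
Proof.
move=> u0; rewrite -lee_fin laplace_slopeE//; apply: integral_ge0 => t _.
rewrite lee_fin divr_ge0 ?subr_ge0 ?(ltW u0)//.
by rewrite -expR0 ler_expR oppr_le0 mulr_ge0// ltW.
Qed.

Lemma laplace_slope_nincr (u v : R) : (0 < u)%R -> (u <= v)%R ->
  ((1 - L v) / v <= (1 - L u) / u)%R.
Proof.
move=> u0 uv; have v0 : (0 < v)%R by exact: lt_le_trans uv.
rewrite -lee_fin !laplace_slopeE//; apply: ge0_le_integral => //.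
- move=> t _; rewrite lee_fin divr_ge0 ?subr_ge0 ?(ltW v0)//.
  by rewrite -expR0 ler_expR oppr_le0 mulr_ge0// ltW.
- by move=> t _; rewrite lee_fin expR_slope_nincr.
Qed.

(** Monotone convergence of the slopes along [1 / (n + 1)]; the limiting mean may be infinite. *)
Lemma laplace_slope_cvg :
  ((1 - L n.+1%:R^-1) / n.+1%:R^-1)%:E @[n --> \oo] --> \int[mu]_t (Z t)%:E.
Proof.
pose g n t : \bar R := ((1 - expR (- (n.+1%:R^-1 * Z t))) / n.+1%:R^-1)%:E.
have n0 n : (0 < n.+1%:R^-1 :> R)%R by rewrite invr_gt0.
have -> : (fun n => ((1 - L n.+1%:R^-1) / n.+1%:R^-1)%:E) =
    (fun n => \int[mu]_t g n t) by apply/funext => n; rewrite laplace_slopeE.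
have glim t : g n t @[n --> \oo] --> (Z t)%:E.
  apply: cvg_EFin; first exact: nearW.
  apply: (@squeeze_cvgr _ _ _ _ (fun n => Z t - n.+1%:R^-1 * Z t ^+ 2)%R (cst (Z t))).
  - by apply: nearW => n; exact: expR_slope_bounds.
  - rewrite -[X in _ --> X]subr0; apply: cvgB; first exact: cvg_cst.
    rewrite -[X in _ --> X](mul0r (Z t ^+ 2)%R); apply: cvgMr_tmp.
    exact: cvg_harmonic.
  - exact: cvg_cst.
have -> : \int[mu]_t (Z t)%:E = \int[mu]_t limn (g ^~ t).
  by apply: eq_integral => t _; apply/esym/cvg_lim => //; exact: glim.
apply: cvg_monotone_convergence => //.
- by move=> n; exact: msl.
- move=> n t _; rewrite lee_fin divr_ge0 ?subr_ge0 ?(ltW (n0 n))//.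
  by rewrite -expR0 ler_expR oppr_le0 mulr_ge0// ltW.
- move=> t _ n m nm; rewrite lee_fin expR_slope_nincr//.
  by rewrite lef_pV2 ?posrE// ler_nat ltnS.
Qed.

Lemma laplace_cvg (u : nat -> R) (l : R) : (forall n, 0 <= u n)%R -> (0 <= l)%R ->
  u n @[n --> \oo] --> l -> L (u n) @[n --> \oo] --> L l.
Proof.
move=> u0 l0 ul.
suff H : (L (u n))%:E @[n --> \oo] --> (L l)%:E by exact: (fine_cvg H).
have -> : (fun n => (L (u n))%:E) = (fun n => \int[mu]_t (expR (- (u n * Z t)))%:E).
  by apply/funext => n; rewrite LE.
rewrite LE//.
have [] := @dominated_convergence _ _ _ mu setT measurableT
  (fun n t => (expR (- (u n * Z t)))%:E) (fun t => (expR (- (l * Z t)))%:E) (cst 1).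
- by move=> n; exact/measurable_EFinP.
- exact/measurable_EFinP.
- apply: aeW => t _; apply: cvg_EFin; first exact: nearW.
  apply: (@cvg_comp _ _ _ (fun n => - (u n * Z t))%R expR); last exact: continuous_expR.
  by apply: cvgN; exact: cvgMr_tmp.
- apply/integrableP; split => //; under eq_integral do rewrite /= normr1.
  by rewrite integral_cst// mul1e mu1 ltry.
- apply: aeW => t n _; rewrite /= lee_fin ger0_norm ?expR_ge0//.
  by rewrite -expR0 ler_expR oppr_le0 mulr_ge0.
- by [].
Qed.

End laplace_slope.

Section laplace_mean.
Context {R : realType} d (X : measurableType d).
Implicit Types (phi : X -> R -> R) (x : X) (u v : R).

Definition slope phi x u : R := ((1 - phi x u) / u)%R.

(* The mean of the law with Laplace transform [phi x], read off as the slope of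
   [phi x] at the origin. *)
Definition lmean phi x : \bar R := limn (fun n => (slope phi x n.+1%:R^-1)%:E).

Lemma lmean_kernel d' (W : measurableType d') (k : R.-pker X ~> W)
    (Z : X * W -> R) phi : measurable_fun [set: X * W] Z ->
  (forall p, 0 <= Z p)%R ->
  (forall x u, (0 <= u)%R ->
    (phi x u)%:E = \int[k x]_w (expR (- (u * Z (x, w))))%:E) ->
  forall x, lmean phi x = \int[k x]_w (Z (x, w))%:E.
Proof.
move=> mZ Z0 phiE x; apply/cvg_lim => //.
by apply: (laplace_slope_cvg (prob_kernel x) (measurable_fun_pair2 x mZ)) => // u; exact: phiE.
Qed.

Variable phi : X -> R -> R.
Hypothesis phi_rep : laplace_rep phi.

Let Z : X * R -> R := projT1 (cid phi_rep).

Let mZ : measurable_fun [set: X * R] Z.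
Proof. by rewrite /Z; case: cid => ? []. Qed.

Let mZx x : measurable_fun [set: R] (fun s => Z (x, s)).
Proof. exact: measurable_fun_pair2 mZ. Qed.

Let Z0 p : (0 <= Z p)%R.
Proof. by rewrite /Z; case: cid => ? []. Qed.

Let phiE x u : (0 <= u)%R ->
  (phi x u)%:E = \int[unif]_s (expR (- (u * Z (x, s))))%:E.
Proof. by rewrite /Z; case: cid => ? [? ?]; exact. Qed.

Let unif1 : (unif : {measure set R -> \bar R}) [set: R] = 1.
Proof. exact: probability_setT. Qed.

Lemma slope_ge0 x u : (0 < u)%R -> (0 <= slope phi x u)%R.
Proof. exact: (laplace_slope_ge0 unif1 (mZx x) (fun s => Z0 (x, s)) (@phiE x)). Qed.

Lemma slope_nincr x u v : (0 < u)%R -> (u <= v)%R ->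
  (slope phi x v <= slope phi x u)%R.
Proof. exact: (laplace_slope_nincr unif1 (mZx x) (fun s => Z0 (x, s)) (@phiE x)). Qed.

Lemma laplace_rep_cvg_arg x (u : nat -> R) (l : R) : (forall n, 0 <= u n)%R ->
  (0 <= l)%R -> u n @[n --> \oo] --> l -> phi x (u n) @[n --> \oo] --> phi x l.
Proof. exact: (laplace_cvg unif1 (mZx x) (fun s => Z0 (x, s)) (@phiE x)). Qed.

Lemma laplace_rep0 x : phi x 0 = 1%R.
Proof.
apply: EFin_inj; rewrite phiE//; under eq_integral do rewrite mul0r oppr0 expR0.
by rewrite integral_cst// unif1 mule1.
Qed.

Lemma lmean_cvg x : (slope phi x n.+1%:R^-1)%:E @[n --> \oo] --> lmean phi x.
Proof.
have H := laplace_slope_cvg unif1 (mZx x) (fun s => Z0 (x, s)) (@phiE x).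
by rewrite /lmean (cvg_lim _ H).
Qed.

Lemma slope_le_lmean x u : (0 < u)%R -> (slope phi x u)%:E <= lmean phi x.
Proof.
move=> u0; apply: (@cvge_ge _ _ _ _ _ _ _ _ (@lmean_cvg x)).
near=> n; rewrite lee_fin; apply: slope_nincr; first by rewrite invr_gt0.
rewrite -[leRHS]invrK lef_pV2 ?posrE ?invr_gt0//.
apply: (@le_trans _ _ n%:R); last by rewrite ler_nat.
by near: n; exact: nbhs_infty_ger.
Unshelve. all: by end_near. Qed.

Lemma lmean_ge0 x : 0 <= lmean phi x.
Proof.
by apply: le_trans (@slope_le_lmean x 1 ltr01); rewrite lee_fin slope_ge0.
Qed.

Lemma measurable_laplace u : (0 <= u)%R -> measurable_fun [set: X] (phi ^~ u).
Proof.
move=> u0; apply/measurable_EFinP.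
have -> : EFin \o phi ^~ u = (fun x => \int[unif]_s (expR (- (u * Z (x, s))))%:E).
  by apply/funext => x /=; rewrite phiE.
apply: (@measurable_fun_fubini_tonelli_F _ _ _ _ _ unif
  (fun p => (expR (- (u * Z p)))%:E)).
- apply/measurable_EFinP; apply: measurableT_comp => //.
  by apply: measurableT_comp => //; exact: measurable_funM.
- by move=> p; rewrite lee_fin expR_ge0.
Qed.

Lemma measurable_slope u : (0 < u)%R -> measurable_fun [set: X] (slope phi ^~ u).
Proof.
move=> u0; apply: measurable_funM => //; apply: measurable_funB => //.
exact: measurable_laplace (ltW u0).
Qed.

Lemma measurable_lmean : measurable_fun [set: X] (lmean phi).
Proof.
apply: (emeasurable_fun_cvg (fun n x => (slope phi x n.+1%:R^-1)%:E)).
- by move=> n; apply/measurable_EFinP; apply: measurable_slope; rewrite invr_gt0.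
- by move=> x _; exact: lmean_cvg.
Qed.

End laplace_mean.

(** Measurability in both arguments at once: the family scaled by [h] is evaluated at 1. *)
Lemma measurable_laplace_comp {R : realType} d (X : measurableType d) d'
    (Y : measurableType d') (phi : X -> R -> R) (g : Y -> X) (h : Y -> R) :
  laplace_rep phi -> measurable_fun [set: Y] g -> measurable_fun [set: Y] h ->
  (forall y, 0 <= h y)%R -> measurable_fun [set: Y] (fun y => phi (g y) (h y)).
Proof.
move=> phi_rep mg mh h0.
have := measurable_laplace (laplace_rep_scale phi_rep mg mh h0) ler01.
by under [X in measurable_fun _ X]eq_fun do rewrite mul1r.
Qed.

Definition push_measure d d' (T1 : measurableType d) (T2 : measurableType d')
    (R : realType) (m : {measure set T1 -> \bar R}) (f : T1 -> T2)
    (mf : measurable_fun [set: T1] f) : {measure set T2 -> \bar R}.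
Proof. by refine (pushforward m f : {measure set T2 -> \bar R}). Defined.

(** * Independent environments *)

Section iid_environment.
Context {R : realType} d (Theta : measurableType d).
Local Notation X := (seq_space Theta).
Implicit Types A B : nat -> set Theta.

Lemma measurable_seq_coord n : measurable_fun [set: X] (@seq_coord _ Theta n).
Proof.
move=> _ A mA; apply: sub_sigma_algebra; exists n => //; exists A => //.
Qed.

Definition cylinder n A : set X := [set x | forall i, (i < n)%N -> A i (x i)].

Lemma cylinderS n A :
  cylinder n.+1 A = seq_coord 0 @^-1` A 0%N `&`
    @seq_shift Theta @^-1` cylinder n (fun i => A i.+1).
Proof.
apply/seteqP; split => [x H|x [H0 H] [|i] ilt]; last exact: H.
- by split; [exact: (H 0%N)|move=> i ilt; exact: (H i.+1)].
- exact: H0.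
Qed.

Lemma measurable_cylinder n A : (forall i, measurable (A i)) ->
  measurable (cylinder n A).
Proof.
move=> mA; have -> : cylinder n A =
    \bigcap_i (if (i < n)%N then seq_coord i @^-1` A i else setT).
  apply/seteqP; split => [x H i _|x H i ilt]; first by case: ifP => // /H.
  by have := H i Logic.I; rewrite ilt.
apply: bigcapT_measurable => i; case: ifP => // _.
by rewrite -[X in measurable X]setTI; exact: measurable_seq_coord.
Qed.

Definition cylinders : set (set X) :=
  [set C | exists n A, (forall i, measurable (A i)) /\ C = cylinder n A].

Lemma measurable_seqE : @measurable _ X = <<s cylinders >>.
Proof.
apply/seteqP; split.
  apply: smallest_sub; first exact: smallest_sigma_algebra.
  move=> _ [n _ [A mA <-]]; rewrite setTI; apply: sub_sigma_algebra.
  exists n.+1, (fun i => if i == n then A else setT); split.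
    by move=> i; case: ifP.
  apply/seteqP; split => [x /= Ax i _|x H].
    by case: eqVneq => [->|].
  by have := H n (ltnSn n); rewrite eqxx.
apply: smallest_sub; first exact: sigma_algebra_measurable.
by move=> _ [n [A [mA ->]]]; exact: measurable_cylinder.
Qed.

Lemma seq_measure_unique (m1 m2 : {measure set X -> \bar R}) :
  m1 setT < +oo ->
  (forall n A, (forall i, measurable (A i)) -> m1 (cylinder n A) = m2 (cylinder n A)) ->
  forall C, measurable C -> m1 C = m2 C.
Proof.
move=> m1oo m12; apply: (@measure_unique _ R X cylinders (fun=> setT)) => //.
- exact: measurable_seqE.
- move=> _ _ [n [A [mA ->]]] [m [B [mB ->]]].
  exists (maxn n m), (fun i => (if (i < n)%N then A i else setT) `&`
                               (if (i < m)%N then B i else setT)); split.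
    by move=> i; apply: measurableI; case: ifP.
  apply/seteqP; split => [x [HA HB] i _|x H].
    by split; case: ifP => // ?; [exact: HA|exact: HB].
  split=> i ilt; have := H i; rewrite leq_max ilt ?orbT => /(_ isT) [].
    by [].
  by [].
- by move=> _; exists 0%N, (fun=> setT); split => //; apply/seteqP.
- by rewrite bigcup_const//; exists 0%N.
- by move=> _ [n [A [mA ->]]]; exact: m12.
Qed.

Lemma measurable_seq_shift : measurable_fun [set: X] (@seq_shift Theta).
Proof.
apply: (measurability _ measurable_seqE) => _ [_ [n [A [mA ->]]] <-].
rewrite setTI (_ : _ @^-1` _ = cylinder n.+1 (fun i => if i is j.+1 then A j else setT)).
  by apply: measurable_cylinder; case.
apply/seteqP; split => [x H [//|i] ilt|x H i ilt]; first exact: H.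
exact: (H i.+1).
Qed.

Variable tau : probability X R.
Hypothesis tau_iid : iid_law tau.

Lemma iid_cylinder n A : (forall i, measurable (A i)) ->
  tau (cylinder n A) = \prod_(i < n) tau (seq_coord 0 @^-1` A i).
Proof.
move=> mA; have [same indep] := tau_iid.
pose J := seq_fset tt (iota 0 n).
have -> : cylinder n A = \bigcap_(i in [set` J]) seq_coord i @^-1` A i.
  apply/seteqP; split => x H i /=; rewrite ?seq_fsetE ?mem_iota.
    by move=> ilt; apply: H; move: ilt.
  by move=> ilt; apply: H; rewrite /= seq_fsetE mem_iota.
rewrite indep//.
rewrite (perm_big _ (seq_fset_perm tt (iota 0 n))) /= undup_id ?iota_uniq//.
rewrite -[n in iota 0 n]subn0 big_mkord; apply: eq_bigr => i _.
exact: same.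
Qed.

(** For fixed [A], both sides are finite measures in [B]. They agree on cylinders, since a cylinder
    with [A] put in front is again a cylinder. *)
Lemma iid_shift_indep (A : set Theta) (B : set X) : measurable A -> measurable B ->
  tau (seq_coord 0 @^-1` A `&` @seq_shift Theta @^-1` B) =
  tau (seq_coord 0 @^-1` A) * tau B.
Proof.
move=> mA.
have mA0 : measurable (seq_coord 0 @^-1` A : set X).
  by rewrite -[X in measurable X]setTI; exact: measurable_seq_coord.
pose m1 : {measure set X -> \bar R} := push_measure (mrestr tau mA0) measurable_seq_shift.
have tA0 : (0 <= fine (tau (seq_coord 0 @^-1` A : set X)))%R.
  by apply: fine_ge0; exact: measure_ge0.
pose m2 : {measure set X -> \bar R} := mscale (NngNum tA0) tau.
have tAE : tau (seq_coord 0 @^-1` A : set X) =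
    (fine (tau (seq_coord 0 @^-1` A : set X)))%:E.
  by rewrite fineK//; exact: fin_num_measure.
move=> mB; rewrite setIC tAE.
rewrite [LHS](_ : _ = m1 B)// [RHS](_ : _ = m2 B)//.
apply: seq_measure_unique mB.
  apply: (@le_lt_trans _ _ 1); last exact: ltry.
  rewrite [leLHS](_ : _ = tau (@seq_shift Theta @^-1` setT `&` seq_coord 0 @^-1` A))//.
  by rewrite preimage_setT setTI; exact: probability_le1.
move=> n C mC.
rewrite [LHS](_ : _ = tau (cylinder n.+1 (fun i => if i is j.+1 then C j else A))).
  rewrite iid_cylinder; last by case.
  rewrite big_ord_recl [RHS](_ : _ = (fine (tau (seq_coord 0 @^-1` A)))%:E *
    tau (cylinder n C))// -tAE; congr (_ * _).
  by rewrite iid_cylinder.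
by rewrite cylinderS /= setIC.
Qed.

(** The first coordinate and the shifted sequence have a product law whose second factor is [tau];
    the first coordinate may thus be read off an independent copy [y]. *)
Lemma iid_decoupling (f : Theta * X -> \bar R) :
  measurable_fun [set: Theta * X] f -> (forall p, 0 <= f p) ->
  \int[tau]_x f (x 0%N, seq_shift x) = \int[tau]_x \int[tau]_y f (y 0%N, x).
Proof.
move=> mf f0.
pose split (x : X) : Theta * X := (x 0%N, seq_shift x).
have mc0 : measurable_fun [set: X] (fun x : X => x 0%N).
  exact: measurable_seq_coord 0%N.
have ms : measurable_fun [set: X] split.
  by apply: measurable_fun_pair => //; exact: measurable_seq_shift.
pose c0 : {mfun X >-> Theta} :=
  HB.pack (fun x : X => x 0%N) (isMeasurableFun.Build _ _ _ _ _ mc0).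
pose P0 : probability Theta R := distribution tau c0.
have Epush : \int[tau]_x f (x 0%N, seq_shift x) = \int[push_measure tau ms]_p f p.
  by rewrite (ge0_integral_pushforward ms)// preimage_setT.
rewrite Epush (@eq_measure_integral _ _ _ _ (P0 \x tau)); last first.
  move=> A mA _; apply/esym.
  apply: (product_measure_unique (m' := push_measure tau ms)) mA => B C mB mC.
  exact: iid_shift_indep.
rewrite fubini_tonelli2//; apply: eq_integral => x _.
rewrite /fubini_G [LHS](_ : _ = \int[push_measure tau mc0]_t f (t, x))//.
rewrite (ge0_integral_pushforward mc0)// ?preimage_setT//.
exact: measurable_fun_pair1.
Qed.

Lemma iid_shift_law (f : X -> \bar R) :
  measurable_fun [set: X] f -> (forall x, 0 <= f x) ->
  \int[tau]_x f (seq_shift x) = \int[tau]_x f x.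
Proof.
move=> mf f0; rewrite (@iid_decoupling (fun p => f p.2))//; last first.
  by apply: measurableT_comp => //; exact: measurable_snd.
apply: eq_integral => x _.
by rewrite [LHS](@integral_cst _ _ _ tau _ measurableT (f x))
    [X in _ * X](@probability_setT _ _ _ tau) mule1.
Qed.

(* By iteration, an event A contained in its preimage under the shift is
   independent of every cylinder, hence of itself. *)
Lemma iid_zero_one (A : set X) : measurable A ->
  {ae tau, forall x, A x -> A (seq_shift x)} -> tau A = 0 \/ tau A = 1.
Proof.
move=> mA AT.
have mTA : measurable (@seq_shift Theta @^-1` A).
  by rewrite -[X in measurable X]setTI; exact: measurable_seq_shift.
have tTA : tau (@seq_shift Theta @^-1` A) = tau A.
  have H : \int[tau]_x (\1_A (seq_shift x))%:E = \int[tau]_x (\1_A x)%:E.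
    by apply: (@iid_shift_law (fun x => (\1_A x)%:E)) => //; exact/measurable_EFinP.
  have E1 : \int[tau]_x (\1_A x)%:E = tau A by rewrite integral_indic// setIT.
  have E2 : \int[tau]_x (\1_(@seq_shift Theta @^-1` A) x)%:E =
      tau (@seq_shift Theta @^-1` A) by rewrite integral_indic// setIT.
  by rewrite -E1 -E2 -H.
(* [A] is contained in its preimage up to a null set and both have the same mass, so they differ by
   a null set. *)
have inv (B : set X) : measurable B -> tau (B `&` A) = tau (B `&` @seq_shift Theta @^-1` A).
  move=> mB; apply/eqP; rewrite eq_le; apply/andP; split.
    have [N [mN N0 NA]] := AT.
    apply: (@le_trans _ _ (tau ((B `&` @seq_shift Theta @^-1` A) `|` N))).
      apply: le_measure; rewrite ?inE.
      - exact: measurableI.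
      - by apply: measurableU => //; exact: measurableI.
      - move=> x [Bx Ax]; have [TAx|TAx] := pselect (A (seq_shift x)).
          by left.
        by right; apply: NA => /= /(_ Ax).
    apply: (le_trans (measureU2 _ _ _)) => //; first exact: measurableI.
    by rewrite [X in _ + X]N0 adde0.
  have AT0 : tau (@seq_shift Theta @^-1` A `\` A) = 0.
    have [N [mN N0 NA]] := AT.
    have e : tau (@seq_shift Theta @^-1` A `&` A) = tau A.
      apply/eqP; rewrite eq_le; apply/andP; split.
        by apply: le_measure; rewrite ?inE//; exact: measurableI.
      apply: (@le_trans _ _ (tau ((@seq_shift Theta @^-1` A `&` A) `|` N))).
        apply: le_measure; rewrite ?inE//.
          by apply: measurableU => //; exact: measurableI.
        move=> x Ax; have [TAx|TAx] := pselect (A (seq_shift x)); first by left.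
        by right; apply: NA => /= /(_ Ax).
      apply: (le_trans (measureU2 _ _ _)) => //; first exact: measurableI.
      by rewrite [X in _ + X]N0 adde0.
    rewrite measureD//; last first.
      by rewrite (le_lt_trans (probability_le1 _ _))// ltry.
    by rewrite [X in X - _]tTA [X in _ - X]e subee// fin_num_measure.
  apply: (@le_trans _ _ (tau ((B `&` A) `|` (@seq_shift Theta @^-1` A `\` A)))).
    apply: le_measure; rewrite ?inE.
    - exact: measurableI.
    - by apply: measurableU; [exact: measurableI|exact: measurableD].
    - move=> x [Bx TAx]; have [Ax|nAx] := pselect (A x); first by left.
      by right.
  apply: (le_trans (measureU2 _ _ _)); first exact: measurableI.
    exact: measurableD.
  by rewrite [X in _ + X]AT0 adde0.
have indep n (B : nat -> set Theta) : (forall i, measurable (B i)) ->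
    tau (cylinder n B `&` A) = tau (cylinder n B) * tau A.
  elim: n B => [|n IH] B mB.
    have -> : cylinder 0 B = setT by apply/seteqP; split.
    by rewrite setTI probability_setT mul1e.
  have mBn : measurable (cylinder n (fun i => B i.+1)) by exact: measurable_cylinder.
  rewrite inv; last exact: measurable_cylinder.
  rewrite cylinderS -setIA -preimage_setI iid_shift_indep//; last exact: measurableI.
  by rewrite IH// muleA iid_shift_indep.
pose m1 : {measure set X -> \bar R} := mrestr tau mA.
have tA0 : (0 <= fine (tau A))%R by apply: fine_ge0; exact: measure_ge0.
pose m2 : {measure set X -> \bar R} := mscale (NngNum tA0) tau.
have tAE : tau A = (fine (tau A))%:E by rewrite fineK//; exact: fin_num_measure.
have := @seq_measure_unique m1 m2 _ _ A mA.
rewrite [m1 A](_ : _ = tau (A `&` A))// [m2 A](_ : _ = (fine (tau A))%:E * tau A)//.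
rewrite setIid -tAE => H.
have {}H : tau A = tau A * tau A.
  apply: H.
    apply: (@le_lt_trans _ _ 1); last exact: ltry.
    by rewrite [leLHS](_ : _ = tau (setT `&` A))// setTI; exact: probability_le1.
  move=> n B mB; rewrite [LHS](_ : _ = tau (cylinder n B `&` A))//.
  by rewrite indep// muleC tAE.
move: H; rewrite tAE -EFinM => -[] /eqP; rewrite -subr_eq0.
rewrite -[X in (X - _)%R]mulr1 -mulrBr mulf_eq0 => /orP[/eqP->|]; first by left.
by rewrite subr_eq0 => /eqP <-; right.
Qed.

End iid_environment.

(** * Size-biased offspring *)

Section weights.
Context {R : realType} dV (V : measurableType dV) (w : nat -> V -> R).
Hypotheses (mw : forall i, measurable_fun [set: V] (w i))
  (w0 : forall i v, (0 <= w i v)%R)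
  (wfin : forall v, exists N, forall i, (N <= i)%N -> w i v = 0%R).
Implicit Types (f g : R -> R) (v : V).

(** Some bound chosen for each [v], not the number of positive weights. Nothing makes it measurable
    in [v]: it serves in pointwise computations, while measurability goes through infinite
    series. *)
Definition num_weights v : nat := projT1 (cid (wfin v)).

Lemma weight_eq0 v i : (num_weights v <= i)%N -> w i v = 0%R.
Proof. by rewrite /num_weights; case: cid => N /=; exact. Qed.

Definition mass v : R := (\sum_(i < num_weights v) w i v)%R.

(** The integral of [f] against the point measure [sum_i w_i delta_{w_i}], to which weights equal to
    0 contribute nothing, whatever [f 0]. *)
Definition wsum f v : \bar R := \sum_(0 <= i <oo) (w i v * f (w i v))%:E.

Lemma wsumE f v : wsum f v = (\sum_(i < num_weights v) w i v * f (w i v))%R%:E.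
Proof.
apply: lim_near_cst => //; exists (num_weights v) => // n /= Nn.
have tail0 : \sum_(num_weights v <= i < n) (w i v * f (w i v))%:E = 0.
  by rewrite big_nat big1// => i /andP[Ni _]; rewrite weight_eq0// mul0r.
by rewrite (big_cat_nat (n := num_weights v))//= tail0 adde0 big_mkord sumEFin.
Qed.

Lemma mass_ge0 v : (0 <= mass v)%R.
Proof. exact: sumr_ge0. Qed.

Lemma wsum_cst c v : wsum (cst c) v = (c * mass v)%:E.
Proof.
by rewrite wsumE mulrC /mass mulr_suml.
Qed.

Lemma wsum_ge0 f v : (forall t, 0 <= t -> 0 <= f t)%R -> 0 <= wsum f v.
Proof.
by move=> f0; rewrite wsumE lee_fin; apply: sumr_ge0 => i _; rewrite mulr_ge0// f0.
Qed.

Lemma measurable_wsum f : measurable_fun [set: R] f ->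
  (forall t, 0 <= t -> 0 <= f t)%R -> measurable_fun [set: V] (wsum f).
Proof.
move=> mf f0; apply: ge0_emeasurable_sum => //.
- by move=> i v _ _; rewrite lee_fin mulr_ge0// f0.
- move=> i _; apply/measurable_EFinP; apply: measurable_funM => //.
  exact: measurableT_comp.
Qed.

Lemma measurable_mass : measurable_fun [set: V] mass.
Proof.
apply/measurable_EFinP; have -> : EFin \o mass = wsum (cst 1%R).
  by apply/funext => v; rewrite wsum_cst mul1r.
exact: measurable_wsum.
Qed.

Variable nu : probability V R.
Hypothesis nu_mass : \int[nu]_v (mass v)%:E = 1.

Definition size_bias f : \bar R := \int[nu]_v wsum f v.

Lemma size_bias_cst (c : R) : (0 <= c)%R -> size_bias (cst c) = c%:E.
Proof.
move=> c0; rewrite /size_bias; under eq_integral do rewrite wsum_cst EFinM.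
rewrite ge0_integralZl//; first by rewrite nu_mass mule1.
- by apply/measurable_EFinP; exact: measurable_mass.
- by move=> v _; rewrite lee_fin mass_ge0.
Qed.

Lemma size_bias_ge0 f : (forall t, 0 <= t -> 0 <= f t)%R -> 0 <= size_bias f.
Proof. by move=> f0; apply: integral_ge0 => v _; exact: wsum_ge0. Qed.

Lemma size_bias_le f g : measurable_fun [set: R] f -> measurable_fun [set: R] g ->
  (forall t, 0 <= t -> 0 <= f t)%R -> (forall t, 0 <= t -> f t <= g t)%R ->
  size_bias f <= size_bias g.
Proof.
move=> mf mg f0 fg; apply: ge0_le_integral => //.
- by move=> v _; exact: wsum_ge0.
- exact: measurable_wsum.
- by apply: measurable_wsum => // t t0; rewrite (le_trans (f0 _ t0))// fg.
- move=> v _; rewrite !wsumE lee_fin; apply: ler_sum => i _.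
  by rewrite ler_wpM2l// fg.
Qed.

Lemma size_biasD f g : measurable_fun [set: R] f -> measurable_fun [set: R] g ->
  (forall t, 0 <= t -> 0 <= f t)%R -> (forall t, 0 <= t -> 0 <= g t)%R ->
  size_bias (fun t => f t + g t)%R = size_bias f + size_bias g.
Proof.
move=> mf mg f0 g0; rewrite /size_bias -ge0_integralD//.
- apply: eq_integral => v _; rewrite !wsumE -EFinD -big_split/=.
  by congr EFin; apply: eq_bigr => i _; rewrite mulrDr.
- by move=> v _; exact: wsum_ge0.
- exact: measurable_wsum.
- by move=> v _; exact: wsum_ge0.
- exact: measurable_wsum.
Qed.

Lemma size_biasZ (c : R) f : (0 <= c)%R -> measurable_fun [set: R] f ->
  (forall t, 0 <= t -> 0 <= f t)%R ->
  size_bias (fun t => c * f t)%R = c%:E * size_bias f.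
Proof.
move=> c0 mf f0; rewrite /size_bias -ge0_integralZl//.
- apply: eq_integral => v _; rewrite !wsumE -EFinM mulr_sumr.
  by congr EFin; apply: eq_bigr => i _; rewrite mulrCA.
- exact: measurable_wsum.
- by move=> v _; exact: wsum_ge0.
Qed.

Lemma size_bias_sum (n : nat) (F : nat -> R -> R) :
  (forall i, measurable_fun [set: R] (F i)) ->
  (forall i t, 0 <= t -> 0 <= F i t)%R ->
  size_bias (fun t => \sum_(i < n) F i t)%R = \sum_(i < n) size_bias (F i).
Proof.
move=> mF F0; elim: n => [|n IH].
  rewrite big_ord0; transitivity (size_bias (cst 0%R)); last by rewrite size_bias_cst.
  by congr size_bias; apply/funext => t; rewrite big_ord0.
rewrite big_ord_recr/= -IH -size_biasD//.
- by congr size_bias; apply/funext => t; rewrite big_ord_recr.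
- exact: measurable_sum.
- by move=> t t0; apply: sumr_ge0 => i _; exact: F0.
- by move=> t t0; exact: F0.
Qed.

End weights.

(** * The drift inequality on the integers *)

Section shifted_sums.
Context {R : realType}.
Variables (f : int -> R) (c : R).
Hypotheses (f_nd : forall i j : int, (i <= j)%R -> (f i <= f j)%R)
  (f0 : forall i, (0 <= f i)%R) (fc : forall i, (f i <= c)%R).
Local Open Scope ring_scope.

Definition posint (k : int) : R := (Num.max k 0)%:~R.

Lemma posint_ge0 k : 0 <= posint k.
Proof. by rewrite /posint ler0z le_max lexx orbT. Qed.

Let posint_nat (k : nat) : posint k = k%:R.
Proof. by rewrite /posint max_l. Qed.

Let posint_negnat (k : nat) : posint (- k%:Z) = 0.
Proof. by rewrite /posint max_r// oppr_le0. Qed.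

Let sum_up N (k : nat) :
  \sum_(j < N.+1) f (k%:Z - j%:Z) <= \sum_(j < N.+1) f (- j%:Z) + k%:R * c.
Proof.
elim: k => [|k IH].
  by rewrite mul0r addr0; apply: ler_sum => j _; rewrite sub0r.
rewrite big_ord_recl /= subr0.
have -> : \sum_(i < N) f (k.+1%:Z - (bump 0 i)%:Z) = \sum_(i < N) f (k%:Z - i%:Z).
  by apply: eq_bigr => i _; congr f; rewrite /bump /=; lia.
rewrite big_ord_recr /= in IH.
have := f0 (k%:Z - N%:Z); have := fc k.+1; rewrite -natr1.
by move: IH; nra.
Qed.

Let sum_down N L (k : nat) : (k <= L)%N ->
  \sum_(j < N.+1) f (- k%:Z - j%:Z) + k%:R * f (- L%:Z) <=
  \sum_(j < N.+1) f (- j%:Z) + k%:R * f (- N%:Z).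
Proof.
elim: k => [_|k IH kL].
  by rewrite !mul0r !addr0; apply: ler_sum => j _; rewrite oppr0 sub0r.
have {IH} := IH (ltnW kL).
have -> : \sum_(j < N.+1) f (- k%:Z - j%:Z) =
    f (- k%:Z) + \sum_(i < N) f (- k.+1%:Z - i%:Z).
  rewrite big_ord_recl /= subr0; congr (_ + _).
  by apply: eq_bigr => i _; congr f; rewrite /bump /=; lia.
rewrite [X in _ -> X + _ <= _]big_ord_recr /=.
have : f (- L%:Z) <= f (- k%:Z) by apply: f_nd; lia.
have : f (- k.+1%:Z - N%:Z) <= f (- N%:Z) by apply: f_nd; lia.
rewrite -natr1 !mulrDl !mul1r; set a := k%:R * _; set b := k%:R * _; lra.
Qed.

(** Shifting the window from [- N] to 0 by [m] exchanges [|m|] terms. Upwards, each new term is at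
    most [c]; downwards, each lost term is at least [f (- L)] and each new one at most [f (- N)]. *)
Lemma shifted_sum_le N L (m : int) : - L%:Z <= m ->
  \sum_(j < N.+1) f (m - j%:Z) + posint (- m) * f (- L%:Z) <=
  \sum_(j < N.+1) f (- j%:Z) + posint m * c + posint (- m) * f (- N%:Z).
Proof.
case: (intP m) => [|k|k] mL.
- by rewrite oppr0 !(posint_nat 0) !mul0r !addr0; apply: ler_sum => j _; rewrite sub0r.
- by rewrite posint_negnat posint_nat !mul0r !addr0; exact: sum_up.
- by rewrite opprK posint_negnat posint_nat mul0r addr0; apply: sum_down; move: mL; rewrite lerN2 lez_nat.
Qed.

End shifted_sums.

Section drift.
Context {R : realType} dV (V : measurableType dV) (w : nat -> V -> R).
Hypotheses (mw : forall i, measurable_fun [set: V] (w i))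
  (w0 : forall i v, (0 <= w i v)%R)
  (wfin : forall v, exists N, forall i, (N <= i)%N -> w i v = 0%R).
Variable nu : probability V R.
Hypothesis nu_mass : \int[nu]_v (mass wfin v)%:E = 1.
Local Notation size_bias := (size_bias w nu).

(* A bounded nondecreasing f with f(-j) <= E f(m - j) + e_j, where m is bounded
   below: summing over j <= N and telescoping compares E m^- with E m^+. *)
Lemma drift_inequality (m : R -> int) (L : nat) (f : int -> R) (c p q : R)
    (e : nat -> R) (N : nat) :
  (forall F : int -> R, (forall i j : int, (i <= j)%R -> (F i <= F j)%R) ->
    measurable_fun [set: R] (fun t => F (m t))) ->
  (forall t, (- L%:Z <= m t)%R) ->
  (forall i j : int, (i <= j)%R -> (f i <= f j)%R) ->
  (forall i, (0 <= f i)%R) -> (forall i, (f i <= c)%R) ->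
  size_bias (fun t => posint (m t)) = q%:E ->
  size_bias (fun t => posint (- m t)%R) = p%:E ->
  (forall j : nat, (f (- j%:Z)%R)%:E <=
    size_bias (fun t => f (m t - j%:Z)%R) + (e j)%:E) ->
  (p * f (- L%:Z) <= q * c + p * f (- N%:Z) + \sum_(j < N.+1) e j)%R.
Proof.
move=> mm mL f_nd f0 fc qE pE step.
have c0 : (0 <= c)%R by exact: le_trans (f0 0%R) (fc 0%R).
have mf j : measurable_fun [set: R] (fun t => f (m t - j%:Z)%R).
  by apply: (mm (fun i => f (i - j%:Z)%R)) => i k ik; apply: f_nd; rewrite lerD2r.
have mpos : measurable_fun [set: R] (fun t => posint (R := R) (m t)).
  by apply: mm => i j ij; rewrite /posint ler_int; lia.
have mneg : measurable_fun [set: R] (fun t => posint (R := R) (- m t)%R).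
  (* Only nondecreasing functions of [m] are known to be measurable, hence the double sign
     change. *)
  rewrite (_ : (fun t => _) = (fun t => - (- posint (- m t))))%R; last first.
    by apply/funext => t; rewrite opprK.
  apply: measurableT_comp => //; apply: (mm (fun i => - posint (- i)%R))%R.
  by move=> i j ij; rewrite lerN2 /posint ler_int; lia.
pose S : R := (\sum_(j < N.+1) f (- j%:Z))%R.
pose x : \bar R := \sum_(j < N.+1) size_bias (fun t => f (m t - j%:Z)%R).
have Sx : S%:E <= x + (\sum_(j < N.+1) e j)%R%:E.
  rewrite /S /x -!sumEFin -big_split/=; apply: lee_sum => j _; exact: step.
have mS : measurable_fun [set: R] (fun t => \sum_(j < N.+1) f (m t - j%:Z))%R.
  by apply: measurable_sum => j; exact: mf.
have S0 : (0 <= S)%R by exact: sumr_ge0.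
(* The size-biased mean of [shifted_sum_le] at [m t], arranged so that all terms are nonnegative. It
   also shows that [x] is finite. *)
have xle : x + (p * f (- L%:Z))%:E <= (S + q * c + p * f (- N%:Z))%:E.
  have -> : x = size_bias (fun t => \sum_(j < N.+1) f (m t - j%:Z))%R.
    by rewrite (@size_bias_sum _ _ _ _ mw w0 wfin nu nu_mass N.+1 (fun j t => f (m t - j%:Z)%R)).
  have Z1 (a : R) : (0 <= a)%R ->
      (p * a)%:E = size_bias (fun t => a * posint (- m t))%R.
    move=> a0; rewrite (size_biasZ mw w0 wfin)// ?pE -?EFinM 1?mulrC//.
    by move=> t _; exact: posint_ge0.
  have Z2 : (q * c)%:E = size_bias (fun t => c * posint (m t))%R.
    rewrite (size_biasZ mw w0 wfin)// ?qE -?EFinM 1?mulrC//.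
    by move=> t _; exact: posint_ge0.
  have mZ (a : R) : measurable_fun [set: R] (fun t => a * posint (- m t))%R.
    exact: measurable_funM.
  have pZ (a : R) t : (0 <= a -> 0 <= a * posint (- m t))%R.
    by move=> a0; rewrite mulr_ge0// posint_ge0.
  have mQ : measurable_fun [set: R] (fun t => c * posint (m t))%R.
    exact: measurable_funM.
  have pQ t : (0 <= c * posint (m t))%R by rewrite mulr_ge0// posint_ge0.
  have sum0 t : (0 <= \sum_(j < N.+1) f (m t - j%:Z))%R by exact: sumr_ge0.
  rewrite !EFinD (Z1 _ (f0 _)) (Z1 _ (f0 _)) Z2 -(size_bias_cst mw w0 nu_mass S0).
  rewrite -(size_biasD mw w0 wfin nu mS (mZ _))//; last by move=> t _; exact: pZ.
  rewrite -(size_biasD mw w0 wfin nu _ mQ)//.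
  rewrite -(size_biasD mw w0 wfin nu _ (mZ _))//; last 3 first.
  - exact: measurable_funD.
  - by move=> t _; rewrite addr_ge0.
  - by move=> t _; exact: pZ.
  apply: (size_bias_le mw w0 wfin).
  - exact: measurable_funD.
  - by apply: measurable_funD => //; exact: measurable_funD.
  - by move=> t _; rewrite addr_ge0// pZ.
  - move=> t _; have := shifted_sum_le f_nd f0 fc N (mL t).
    by rewrite [(c * _)%R]mulrC ![(f _ * posint _)%R]mulrC.
have xf : x \is a fin_num.
  rewrite ge0_fin_numE; last first.
    by apply: sume_ge0 => j _; apply: size_bias_ge0.
  have : x <= x + (p * f (- L%:Z))%:E.
    rewrite leeDl// lee_fin mulr_ge0// -lee_fin -pE.
    by apply: size_bias_ge0 => // t _; exact: posint_ge0.
  by move=> /le_trans/(_ xle) /le_lt_trans; apply; rewrite ltry.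
move: Sx xle; rewrite -(fineK xf) -!EFinD !lee_fin; lra.
Qed.

End drift.

Section drift_parameters.
Context {R : realType} dV (V : measurableType dV) (w : nat -> V -> R).
Hypotheses (mw : forall i, measurable_fun [set: V] (w i))
  (w0 : forall i v, (0 <= w i v)%R)
  (wfin : forall v, exists N, forall i, (N <= i)%N -> w i v = 0%R).
Variable nu : probability V R.
Hypothesis nu_mass : \int[nu]_v (mass wfin v)%:E = 1.
Local Notation size_bias := (size_bias w nu).

(** The negative part of the logarithm, truncated so that the steps of the walk are bounded below.
    The default [ln 0 = 0] is harmless, since size biasing does not see weights equal to 0. *)
Definition lneg (K t : R) : R := Num.min K (Num.max 0 (- ln t))%R.

Lemma measurable_lneg K : measurable_fun [set: R] (lneg K).
Proof.
apply: measurable_minr => //; apply: measurable_maxr => //.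
exact: measurableT_comp.
Qed.

Lemma measurable_logplus : measurable_fun [set: R] (@logplus R).
Proof. exact: measurable_maxr. Qed.

(* Exponents are rounded up to multiples of a step [delta] so small that the
   rounding does not spoil the negative drift. *)
Lemma drift_parameters (K lam kap : R) : (0 <= K)%R ->
  size_bias (@logplus R) = lam%:E -> size_bias (lneg K) = kap%:E ->
  (lam < kap)%R ->
  exists delta (m : R -> int) (L : nat) p q, [/\ (0 < delta)%R,
    (forall F : int -> R, (forall i j : int, (i <= j)%R -> (F i <= F j)%R) ->
      measurable_fun [set: R] (fun t => F (m t))),
    (forall t, - L%:Z <= m t)%R /\
    (forall t, 0 <= t -> t <= expR (delta * (m t)%:~R))%R,
    size_bias (fun t => posint (m t)) = q%:E /\
    size_bias (fun t => posint (- m t)%R) = p%:E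
  & (q < p)%R].
Proof.
move=> K0 lamE kapE lk.
(* Rounding up costs at most one step, so that [q - p <= (lam - kap) / delta + 1]; this choice makes
   the right-hand side equal to -1. *)
pose delta := ((kap - lam) / 2)%R.
have d0 : (0 < delta)%R by rewrite divr_gt0// subr_gt0.
(* [K <= L delta], so the cutoff of [m] at [- L] lies beyond the truncation of the logarithm at
   [- K]. *)
pose L := (Num.truncn (K / delta)).+1.
have Kd0 : (0 <= K / delta)%R by rewrite divr_ge0// ltW.
have KL : (K / delta <= L%:R)%R by have /andP[_ /ltW] := truncn_itv Kd0.
pose mx (x : R) : int := Num.max (Num.ceil x) (- L%:Z)%R.
pose m t := mx (ln t / delta)%R.
have mm (F : int -> R) : (forall i j : int, (i <= j)%R -> (F i <= F j)%R) ->
    measurable_fun [set: R] (fun t => F (m t)).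
  move=> F_nd; pose g x := F (mx x).
  have mg : measurable_fun [set: R] g.
    apply: nondecreasing_measurable => // x y xy.
    by apply: F_nd; rewrite /mx ge_max !le_max (le_ceil xy) lexx orbT.
  have ml : measurable_fun [set: R] (fun t : R => ln t / delta)%R.
    exact: measurable_funM.
  exact: (measurableT_comp mg ml).
have mL t : (- L%:Z <= m t)%R by rewrite /m /mx le_max lexx orbT.
have mE t : (0 <= t)%R -> (t <= expR (delta * (m t)%:~R))%R.
  rewrite le_eqVlt => /predU1P[<-|t0]; first exact: expR_ge0.
  rewrite -[leLHS]lnK ?posrE// ler_expR mulrC -ler_pdivrMr//.
  apply: le_trans (ceil_ge _) _.
  by rewrite ler_int /m /mx le_max lexx.
have mpos : measurable_fun [set: R] (fun t => posint (R := R) (m t)).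
  by apply: mm => i j ij; rewrite /posint ler_int; lia.
have mneg : measurable_fun [set: R] (fun t => posint (R := R) (- m t)%R).
  rewrite (_ : (fun t => _) = (fun t => - (- posint (- m t))))%R; last first.
    by apply/funext => t; rewrite opprK.
  apply: measurableT_comp => //; apply: (mm (fun i => - posint (- i)%R))%R.
  by move=> i j ij; rewrite lerN2 /posint ler_int; lia.
have di0 : (0 <= delta^-1)%R by rewrite invr_ge0 ltW.
have lp0 t : (0 <= logplus t :> R)%R by rewrite /logplus le_max lexx.
have ln0 t : (0 <= lneg K t)%R by rewrite /lneg le_min K0 le_max lexx.
(* As [m^+ = m^- + m], this is [m <= (log^+ t - lneg K t) / delta + 1], written with nonnegative
   terms so that it can be size-biased. *)
have key t : (posint (m t) + delta^-1 * lneg K t <=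
    posint (- m t) + (delta^-1 * logplus t + 1))%R.
  have -> : posint (m t) = (posint (- m t) + (m t)%:~R)%R :> R.
    by rewrite /posint -intrD; congr intmul; lia.
  rewrite -addrA lerD2l.
  have lK : (lneg K t <= K)%R by rewrite /lneg ge_min lexx.
  have ll : (ln t + lneg K t <= logplus t)%R.
    rewrite addrC -lerBrDr /lneg ge_min /logplus; apply/orP; right.
    have M0 : (0 <= Num.max 0 (ln t))%R by rewrite le_max lexx.
    have Ml : (ln t <= Num.max 0 (ln t))%R by rewrite le_max lexx orbT.
    by rewrite ge_max; apply/andP; split; lra.
  rewrite /m /mx; case: (leP (Num.ceil (ln t / delta)) (- L%:Z)%R) => _.
    have KL' : (delta^-1 * lneg K t <= L%:R)%R.
      by apply: le_trans _ KL; rewrite mulrC; exact: ler_wpM2r.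
    have h0 : (0 <= delta^-1 * logplus t)%R by rewrite mulr_ge0.
    by rewrite mulrNz -pmulrn; lra.
  have /andP[+ _] := ceil_itv (ln t / delta)%R.
  rewrite intrB ltrBlDr => /ltW c1.
  apply: le_trans (lerD c1 (lexx _)) _.
  by rewrite addrAC lerD2r mulrC -mulrDr ler_wpM2l.
have mneg1 : measurable_fun [set: R] (fun t => delta^-1 * lneg K t)%R.
  by apply: measurable_funM => //; exact: measurable_lneg.
have mlp1 : measurable_fun [set: R] (fun t : R => delta^-1 * logplus t)%R.
  by apply: measurable_funM => //; exact: measurable_logplus.
have pfin : size_bias (fun t => posint (- m t)%R) <= L%:R%:E.
  rewrite -(size_bias_cst mw w0 nu_mass (ler0n R L)).
  apply: (size_bias_le mw w0 wfin) => // t _; first exact: posint_ge0.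
  by rewrite /posint /= pmulrn ler_int ge_max lerNl mL.
have p0 : 0 <= size_bias (fun t => posint (- m t)%R).
  by apply: size_bias_ge0 => // t _; exact: posint_ge0.
have q0 : 0 <= size_bias (fun t => posint (m t)%R).
  by apply: size_bias_ge0 => // t _; exact: posint_ge0.
have pf : size_bias (fun t => posint (- m t)%R) \is a fin_num.
  by rewrite ge0_fin_numE// (le_lt_trans pfin)// ltry.
have ineq : size_bias (fun t => posint (m t)) + (delta^-1 * kap)%:E <=
    size_bias (fun t => posint (- m t)%R) + (delta^-1 * lam + 1)%:E.
  rewrite [in X in X <= _]EFinM -kapE -(size_biasZ mw w0 wfin nu di0 (measurable_lneg K))//.
  rewrite EFinD [in X in _ <= X]EFinM -lamE -(size_biasZ mw w0 wfin nu di0 measurable_logplus)//.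
  rewrite -(size_bias_cst mw w0 nu_mass ler01).
  have pl t : (0 <= delta^-1 * lneg K t)%R by rewrite mulr_ge0.
  have pp t : (0 <= delta^-1 * logplus t)%R by rewrite mulr_ge0.
  have ps k : (0 <= posint k :> R)%R by exact: posint_ge0.
  rewrite -!(size_biasD mw w0 wfin nu)//; last 2 first.
  - exact: measurable_funD.
  - by move=> t _; rewrite addr_ge0.
  apply: (size_bias_le mw w0 wfin) => //.
  - exact: measurable_funD.
  - by apply: measurable_funD => //; exact: measurable_funD.
  - by move=> t _; rewrite addr_ge0.
have qf : size_bias (fun t => posint (m t)) \is a fin_num.
  rewrite ge0_fin_numE//; apply: (@le_lt_trans _ _
      (size_bias (fun t => posint (m t)) + (delta^-1 * kap)%:E)).
    rewrite leeDl// lee_fin mulr_ge0// -lee_fin -kapE.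
    by apply: size_bias_ge0.
  by apply: le_lt_trans ineq _; rewrite -(fineK pf) -EFinD ltry.
exists delta, m, L, (fine (size_bias (fun t => posint (- m t)%R))).
exists (fine (size_bias (fun t => posint (m t)))).
split => //; first by rewrite !fineK.
move: ineq; rewrite -{1}(fineK pf) -{1}(fineK qf) -!EFinD lee_fin.
have : (delta^-1 * kap = delta^-1 * lam + 2)%R.
  have dn0 : (kap - lam != 0)%R by rewrite gt_eqF// subr_gt0.
  by rewrite /delta; field.
move: (fine _) (fine _) => p q ->; lra.
Qed.

End drift_parameters.

(** * Summability of the error terms *)

Section geometric_bound.
Context {R : realType}.
Local Open Scope ring_scope.

Lemma sum_min_geometric_le (T : nat -> R) (M rho : R) (n0 N : nat) :
  0 <= M -> 0 < rho < 1 -> (forall j, T j <= M) ->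
  (forall j, (n0 <= j)%N -> T j <= M * rho ^+ (j - n0)) ->
  \sum_(j < N) T j <= M * (n0%:R + (1 - rho)^-1).
Proof.
move=> M0 /andP[r0 r1] TM Tr.
have s0 : 0 < 1 - rho by rewrite subr_gt0.
suff H : \sum_(j < N) T j <=
    M * ((minn N n0)%:R + (1 - rho ^+ (N - n0)) * (1 - rho)^-1).
  apply: le_trans H _; apply: ler_wpM2l => //; apply: lerD.
    by rewrite ler_nat geq_minr.
  have si0 : 0 <= (1 - rho)^-1 by rewrite invr_ge0 ltW.
  by rewrite ler_piMl// gerBl exprn_ge0// ltW.
elim: N => [|N IH].
  by rewrite big_ord0 min0n sub0n expr0 subrr mul0r addr0 mulr0.
rewrite big_ord_recr; apply: (le_trans (lerD IH (lexx _))).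
case: (boolP (N < n0)%N) => [Nn|]; last rewrite -leqNgt => nN.
- have -> : minn N n0 = N by lia.
  have -> : minn N.+1 n0 = N.+1 by lia.
  have -> : (N - n0 = 0)%N by lia.
  have -> : (N.+1 - n0 = 0)%N by lia.
  by rewrite expr0 subrr mul0r !addr0 -natr1 mulrDr mulr1 lerD2l.
- have -> : minn N n0 = n0 by lia.
  have -> : minn N.+1 n0 = n0 by lia.
  have -> : (N.+1 - n0 = (N - n0).+1)%N by lia.
  apply: (le_trans (lerD (lexx _) (Tr _ nN))).
  rewrite -mulrDr; apply: ler_wpM2l => //; rewrite -addrA lerD2l exprS.
  by rewrite le_eqVlt; apply/orP; left; apply/eqP; field; rewrite gt_eqF.
Qed.

Lemma bounded_series_tail (T : nat -> R) (C e : R) : (forall j, 0 <= T j) ->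
  (forall N, \sum_(j < N) T j <= C) -> 0 < e ->
  exists J, forall N, \sum_(j < N) T (j + J)%N <= e.
Proof.
move=> T0 TC e0; pose S := range (fun N => \sum_(j < N) T j).
have supS : has_sup S.
  split; first by exists (\sum_(j < 0) T j); exists 0%N.
  by exists C => _ [N _ <-].
have [_ [J _ <-] HJ] : exists2 x, S x & sup S - e < x.
  by apply: sup_adherent.
exists J => N.
have : \sum_(j < J + N) T j <= sup S.
  by apply: sup_upper_bound => //; exists (J + N)%N.
have -> : \sum_(j < J + N) T j = \sum_(j < J) T j + \sum_(j < N) T (j + J)%N.
  by rewrite big_split_ord/=; congr (_ + _); apply: eq_bigr => j _; rewrite addnC.
by move: HJ => /=; lra.
Qed.

Lemma kappa_scaled_le (M r : R) : 0 <= M -> 0 < r ->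
  kappa (r * M) / r <= M /\ kappa (r * M) / r <= r * M ^+ 2.
Proof.
move=> M0 r0; have rM0 : 0 <= r * M by rewrite mulr_ge0// ltW.
have [k1 k2] := kappa_le rM0; rewrite !ler_pdivrMr//; split; first by rewrite [leRHS]mulrC.
by apply: le_trans k2 _; rewrite le_eqVlt; apply/orP; left; apply/eqP; ring.
Qed.

(** The bounds [M] and [r M^2] of [kappa (r M) / r] cross at [r = 1 / M], which the geometric
    sequence reaches after about [log^+ M / delta] terms. The earlier terms produce [M log^+ M], the
    later ones a geometric series. *)
Lemma kappa_geometric_sum_le (M delta : R) (N : nat) : 0 <= M -> 0 < delta ->
  \sum_(j < N) kappa (expR (- (j%:R * delta)) * M) / expR (- (j%:R * delta)) <=
  M * (delta^-1 * logplus M + (1 + (1 - expR (- delta))^-1)).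
Proof.
move=> M0 d0; pose rho := expR (- delta).
have r0 : 0 < rho by exact: expR_gt0.
have r1 : rho < 1 by rewrite /rho -expR0 ltr_expR oppr_lt0.
have l0 : 0 <= logplus M by rewrite /logplus le_max lexx.
pose x := delta^-1 * logplus M.
have x0 : 0 <= x by rewrite mulr_ge0// invr_ge0 ltW.
pose n0 := (Num.truncn x).+1.
have /andP[nx xn] := truncn_itv x0.
have rj j : expR (- (j%:R * delta)) = rho ^+ j.
  by rewrite -expRM_natl mulrN.
have MR : M * rho ^+ n0 <= 1.
  have [M00|Mp] := leP M 0.
    by apply: le_trans ler01; rewrite mulr_le0_ge0// exprn_ge0// ltW.
  rewrite -rj -[M]lnK ?posrE// -expRD -[leRHS]expR0 ler_expR subr_le0.
  apply: (@le_trans _ _ (logplus M)); first by rewrite /logplus le_max lexx orbT.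
  by rewrite -ler_pdivrMr// mulrC; exact: ltW xn.
have n0x : n0%:R <= x + 1 by rewrite /n0 -natr1 lerD2r.
apply: (@le_trans _ _ (M * (n0%:R + (1 - rho)^-1))); last first.
  by apply: ler_wpM2l => //; rewrite addrA lerD2r.
apply: (@sum_min_geometric_le
  (fun j => kappa (expR (- (j%:R * delta)) * M) / expR (- (j%:R * delta)))) => //.
- by rewrite r0.
- by move=> j; have [] := kappa_scaled_le M0 (expR_gt0 (- (j%:R * delta))).
move=> j nj; have [_ H] := kappa_scaled_le M0 (expR_gt0 (- (j%:R * delta))).
apply: (le_trans H); rewrite rj.
have -> : rho ^+ j * M ^+ 2 = M * rho ^+ (j - n0) * (M * rho ^+ n0).
  rewrite -{1}(subnK nj) exprD expr2.
  by move: (rho ^+ (j - n0)) (rho ^+ n0) => y z; ring.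
by rewrite ler_piMr// mulr_ge0// exprn_ge0// ltW.
Qed.

End geometric_bound.

Section cvg_ord_big.
Context {R : realType}.
Variables (f : nat -> nat -> R) (l : nat -> R).
Hypothesis fl : forall i, f i n @[n --> \oo] --> l i.

Lemma cvg_ord_sum N :
  (\sum_(i < N) f i n)%R @[n --> \oo] --> (\sum_(i < N) l i)%R.
Proof.
elim: N => [|N IH].
  by rewrite big_ord0; under eq_fun do rewrite big_ord0; exact: cvg_cst.
rewrite big_ord_recr/=; under eq_fun do rewrite big_ord_recr/=.
exact: cvgD.
Qed.

Lemma cvg_ord_prod N :
  (\prod_(i < N) f i n)%R @[n --> \oo] --> (\prod_(i < N) l i)%R.
Proof.
elim: N => [|N IH].
  by rewrite big_ord0; under eq_fun do rewrite big_ord0; exact: cvg_cst.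
rewrite big_ord_recr/=; under eq_fun do rewrite big_ord_recr/=.
exact: cvgM.
Qed.

End cvg_ord_big.

Section dominated_by_mass.
Context {R : realType} dV (V : measurableType dV) (w : nat -> V -> R).
Hypotheses (mw : forall i, measurable_fun [set: V] (w i))
  (w0 : forall i v, (0 <= w i v)%R)
  (wfin : forall v, exists N, forall i, (N <= i)%N -> w i v = 0%R).
Variable nu : probability V R.
Local Notation mass := (mass wfin).
Hypothesis nu_mass : \int[nu]_v (mass v)%:E = 1.

Let mm : measurable_fun [set: V] mass.
Proof. exact: measurable_mass. Qed.

Lemma mass_dominated_cvg0 (g : nat -> V -> R) :
  (forall n, measurable_fun [set: V] (g n)) ->
  (forall n v, 0 <= g n v <= mass v)%R ->
  (forall v, g n v @[n --> \oo] --> 0%R) ->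
  \int[nu]_v (g n v)%:E @[n --> \oo] --> 0.
Proof.
move=> mg g0 gcvg.
have [] := @dominated_convergence _ _ _ nu setT measurableT
  (fun n v => (g n v)%:E) (cst 0) (fun v => (mass v)%:E).
- by move=> n; exact/measurable_EFinP.
- by [].
- by apply: aeW => v _; apply: cvg_EFin; [exact: nearW|exact: gcvg].
- apply/integrableP; split; first exact/measurable_EFinP.
  under eq_integral do rewrite /= ger0_norm ?mass_ge0//.
  by rewrite nu_mass ltry.
- apply: aeW => v n _; rewrite /= lee_fin; have /andP[a b] := g0 n v.
  by rewrite ger0_norm.
- by move=> _ _; rewrite integral0.
Qed.

(** Dominated convergence with the total mass as bound; convergence is asked at [t > 0] only, as
    weights equal to 0 carry no mass. *)
Lemma size_bias_cvg0 (F : nat -> R -> R) :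
  (forall n, measurable_fun [set: R] (F n)) ->
  (forall n t, 0 <= F n t <= 1)%R ->
  (forall t, (0 < t)%R -> F n t @[n --> \oo] --> 0%R) ->
  size_bias w nu (F n) @[n --> \oo] --> 0.
Proof.
move=> mF F01 Fcvg.
pose g n v := (\sum_(i < num_weights wfin v) w i v * F n (w i v))%R.
have gE n v : wsum w (F n) v = (g n v)%:E by rewrite (wsumE wfin).
have -> : (fun n => size_bias w nu (F n)) = (fun n => \int[nu]_v (g n v)%:E).
  by apply/funext => n; apply: eq_integral => v _; rewrite gE.
apply: mass_dominated_cvg0.
- move=> n; apply/measurable_EFinP; have -> : EFin \o g n = wsum w (F n).
    by apply/funext => v; rewrite gE.
  by apply: measurable_wsum => // t _; have /andP[] := F01 n t.
- move=> n v; apply/andP; split.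
    by apply: sumr_ge0 => i _; rewrite mulr_ge0//; have /andP[] := F01 n (w i v).
  apply: ler_sum => i _; rewrite ler_piMr//; by have /andP[] := F01 n (w i v).
- move=> v; have H : g n v @[n --> \oo] -->
      (\sum_(i < num_weights wfin v) w i v * 0)%R.
    apply: (@cvg_ord_sum _ (fun i n => w i v * F n (w i v))%R
      (fun i => w i v * 0)%R) => i; have := w0 i v; rewrite le_eqVlt => /predU1P[<-|wi].
      by rewrite mul0r; under eq_fun do rewrite mul0r; exact: cvg_cst.
    by apply: cvgMl_tmp; exact: Fcvg.
  by move: H; rewrite big1// => i _; rewrite mulr0.
Qed.

Definition kappa_mean u : \bar R := \int[nu]_v (kappa (u * mass v) / u)%:E.

Lemma measurable_kappa_mass u : measurable_fun [set: V] (fun v => kappa (u * mass v) / u)%R.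
Proof.
have m1 : measurable_fun [set: V] (fun v => u * mass v)%R.
  exact: measurable_funM.
apply: measurable_funM => //; apply: measurable_funD => //.
apply: measurable_funB => //; apply: measurableT_comp => //.
exact: measurableT_comp.
Qed.

Lemma kappa_mass_ge0 u v : (0 < u)%R -> (0 <= kappa (u * mass v) / u)%R.
Proof. by move=> u0; rewrite divr_ge0 ?kappa_ge0// ltW. Qed.

Lemma kappa_mean_le1 u : (0 < u)%R -> 0 <= kappa_mean u <= 1.
Proof.
move=> u0; apply/andP; split.
  by apply: integral_ge0 => v _; rewrite lee_fin kappa_mass_ge0.
rewrite -nu_mass; apply: ge0_le_integral => //.
- by move=> v _; rewrite lee_fin kappa_mass_ge0.
- by apply/measurable_EFinP; exact: measurable_kappa_mass.
- exact/measurable_EFinP.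
- by move=> v _; rewrite lee_fin; have [] := kappa_scaled_le (mass_ge0 w0 wfin v) u0.
Qed.

Lemma kappa_mean_fin u : (0 < u)%R -> kappa_mean u \is a fin_num.
Proof.
move=> u0; have /andP[a b] := kappa_mean_le1 u0.
by rewrite ge0_fin_numE// (le_lt_trans b)// ltry.
Qed.

Lemma kappa_mean_cvg0 (u : nat -> R) : (forall n, 0 < u n)%R ->
  u n @[n --> \oo] --> 0%R -> kappa_mean (u n) @[n --> \oo] --> 0.
Proof.
move=> u0 ucvg; apply: (mass_dominated_cvg0 (g := fun n v => kappa (u n * mass v) / u n)%R).
- by move=> n; exact: measurable_kappa_mass.
- move=> n v; rewrite kappa_mass_ge0//=.
  by have [] := kappa_scaled_le (mass_ge0 w0 wfin v) (u0 n).
move=> v; apply: (@squeeze_cvgr _ _ _ _ (cst 0%R) (fun n => u n * mass v ^+ 2)%R).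
- apply: nearW => n; rewrite kappa_mass_ge0//=.
  by have [] := kappa_scaled_le (mass_ge0 w0 wfin v) (u0 n).
- exact: cvg_cst.
- by rewrite -[X in _ --> X](mul0r (mass v ^+ 2)%R); exact: cvgMr_tmp.
Qed.

Hypothesis mass_log : \int[nu]_v (mass v * logplus (mass v))%:E < +oo.

(** The whole series is at most the mean of [M (log^+ M / delta + c)], hence finite. The index [J]
    is a starting point of the geometric sequence, close enough to 0 for the remaining errors to sum
    to at most [e]. *)
Lemma kappa_mean_tail (delta e : R) : (0 < delta)%R -> (0 < e)%R ->
  exists J, forall N,
    (\sum_(j < N) fine (kappa_mean (expR (- ((j + J)%:R * delta)))) <= e)%R.
Proof.
move=> d0 e0.
pose c := (1 + (1 - expR (- delta))^-1)%R.
have c0 : (0 <= c)%R.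
  rewrite addr_ge0// invr_ge0 subr_ge0 -expR0 ler_expR oppr_le0; exact: ltW.
have lp0 v : (0 <= logplus (mass v))%R by rewrite /logplus le_max lexx.
have ml0 v : (0 <= mass v * logplus (mass v))%R by rewrite mulr_ge0// mass_ge0.
have mml : measurable_fun [set: V] (fun v => mass v * logplus (mass v))%R.
  apply: measurable_funM => //.
  exact: (measurableT_comp (@measurable_logplus R)).
pose B : \bar R := delta^-1%:E * \int[nu]_v (mass v * logplus (mass v))%:E + c%:E.
have Bf : B \is a fin_num.
  rewrite fin_numD; apply/andP; split => //; rewrite fin_numM//.
  by rewrite ge0_fin_numE// integral_ge0// => v _; rewrite lee_fin.
have di0 : (0 <= delta^-1)%R by rewrite invr_ge0 ltW.
pose T j := fine (kappa_mean (expR (- (j%:R * delta)))).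
have TE j : (T j)%:E = kappa_mean (expR (- (j%:R * delta))).
  by rewrite fineK// kappa_mean_fin// expR_gt0.
apply: (@bounded_series_tail _ T (fine B)) => //.
  move=> j; rewrite /T fine_ge0//.
  by have /andP[] := kappa_mean_le1 (expR_gt0 (- (j%:R * delta))).
move=> N; rewrite -lee_fin fineK// -sumEFin.
under eq_bigr do rewrite TE.
rewrite /kappa_mean -ge0_integral_sum//; first last.
- by move=> j v _; rewrite lee_fin kappa_mass_ge0// expR_gt0.
- by move=> j; apply/measurable_EFinP; exact: measurable_kappa_mass.
have -> : B = \int[nu]_v (mass v * (delta^-1 * logplus (mass v) + c))%:E.
  rewrite /B; have -> : c%:E = \int[nu]_v (c * mass v)%:E.
    under eq_integral do rewrite EFinM.
    rewrite ge0_integralZl//; first by rewrite nu_mass mule1.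
    + exact/measurable_EFinP.
    + by move=> v _; rewrite lee_fin mass_ge0.
  rewrite -ge0_integralZl//; last 2 first.
  - exact/measurable_EFinP.
  - by move=> v _; rewrite lee_fin.
  rewrite -ge0_integralD//.
  - by apply: eq_integral => v _; rewrite -EFinM -EFinD; congr EFin; ring.
  - by move=> v _; rewrite -EFinM lee_fin mulr_ge0.
  - by apply: measurable_funeM; exact/measurable_EFinP.
  - by move=> v _; rewrite lee_fin mulr_ge0// mass_ge0.
  - by apply/measurable_EFinP; exact: measurable_funM.
apply: ge0_le_integral => //.
- by move=> v _; apply: sume_ge0 => j _; rewrite lee_fin kappa_mass_ge0// expR_gt0.
- apply: emeasurable_sum => j; apply/measurable_EFinP; exact: measurable_kappa_mass.
- apply/measurable_EFinP; apply: measurable_funM => //; apply: measurable_funD => //.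
  apply: measurable_funM => //; exact: (measurableT_comp (@measurable_logplus R)).
- move=> v _; rewrite sumEFin lee_fin.
  exact: kappa_geometric_sum_le (mass_ge0 w0 wfin v) d0.
Qed.

End dominated_by_mass.

(** * The smoothing map *)

Section branching.
Context {R : realType} d (Theta : measurableType d)
  dV (V : measurableType dV) (k : R.-pker Theta ~> V) (w : nat -> V -> R).
Hypotheses (mw : forall i, measurable_fun [set: V] (w i))
  (w0 : forall i v, (0 <= w i v)%R)
  (wfin : forall v, exists N, forall i, (N <= i)%N -> w i v = 0%R)
  (mass1 : forall theta, \int[k theta]_v (mass wfin v)%:E = 1).
Local Notation X := (seq_space Theta).
Local Notation mass := (mass wfin).
Local Notation num_weights := (num_weights wfin).
Implicit Types (phi psi : X -> R -> R) (xi : X) (v : V) (u : R).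

Definition offspring_kernel := kpre k (@measurable_seq_coord _ Theta 0%N).

(** Written as a limit to match the functional equation; when [g 0 = 1] the partial products are
    eventually constant. *)
Definition branch_prod (g : R -> R) v : R :=
  limn (fun n => \prod_(i < n) g (w i v))%R.

Lemma prod_weights_stable (g : R -> R) v n : g 0%R = 1%R ->
  (num_weights v <= n)%N ->
  (\prod_(i < n) g (w i v) = \prod_(i < num_weights v) g (w i v))%R.
Proof.
move=> g0 Nn.
rewrite -!(big_mkord xpredT (fun i => g (w i v))) (big_cat_nat (n := num_weights v))//=.
rewrite [X in (_ * X)%R]big_nat [X in (_ * X)%R]big1 ?mulr1// => i /andP[Ni _].
by rewrite (weight_eq0 Ni) g0.
Qed.

Lemma branch_prodE (g : R -> R) v : g 0%R = 1%R ->
  branch_prod g v = (\prod_(i < num_weights v) g (w i v))%R.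
Proof.
move=> g0; apply: lim_near_cst => //; exists (num_weights v) => // n /= Nn.
exact: prod_weights_stable.
Qed.

Definition smooth phi xi u : R :=
  fine (\int[k (xi 0%N)]_v (branch_prod (fun t => phi (seq_shift xi) (u * t)%R) v)%:E).

Let prod_n phi n (p : X * V) u : R :=
  (\prod_(i < n) phi (seq_shift p.1) (u * w i p.2))%R.

Let laplace_rep_prod_n phi n : laplace_rep phi -> laplace_rep (prod_n phi n).
Proof.
move=> phi_rep; elim: n => [|n IH].
  exists (fun=> 0%R); split => // p u u0.
  under eq_integral do rewrite mulr0 oppr0 expR0.
  rewrite integral_cst// [X in _ * X](@probability_setT _ _ _ unif) mule1.
  by rewrite /prod_n big_ord0.
have -> : prod_n phi n.+1 =
    (fun p u => prod_n phi n p u * phi (seq_shift p.1) (u * w n p.2))%R.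
  by apply/funext => p; apply/funext => u; rewrite /prod_n big_ord_recr.
apply: laplace_rep_mul => //.
apply: (laplace_rep_scale (g := fun p : X * V => seq_shift p.1)
  (c := fun p : X * V => w n p.2)) => //.
  exact: measurableT_comp (@measurable_seq_shift _ Theta) measurable_fst.
exact: measurableT_comp (mw n) measurable_snd.
Qed.

(** The number of relevant factors varies with [p] and is not known to be measurable. The continuity
    theorem is therefore applied to the partial products, which stabilize at each [p]. *)
Lemma laplace_rep_branch_prod phi : laplace_rep phi ->
  laplace_rep (fun (p : X * V) u =>
    branch_prod (fun t => phi (seq_shift p.1) (u * t)%R) p.2).
Proof.
move=> phi_rep.
have phi0 xi : phi xi 0%R = 1%R by exact: laplace_rep0.
have stable (p : X * V) u n : (num_weights p.2 <= n)%N ->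
    branch_prod (fun t => phi (seq_shift p.1) (u * t)%R) p.2 = prod_n phi n p u.
  move=> Nn; rewrite branch_prodE ?mulr0//.
  apply/esym; apply: (prod_weights_stable (g := fun t => phi (seq_shift p.1) (u * t)%R)) => //.
  by rewrite mulr0.
apply: (@laplace_rep_cvg _ _ _ (prod_n phi)).
- by move=> n; exact: laplace_rep_prod_n.
- move=> p u u0; apply: cvg_near_cst; exists (num_weights p.2) => // n /= Nn.
  by rewrite (stable p u n Nn).
- move=> p e e0; have H := laplace_rep_prod_n (num_weights p.2) phi_rep.
  have cv : prod_n phi (num_weights p.2) p (n.+1%:R^-1)%R @[n --> \oo] -->
      prod_n phi (num_weights p.2) p 0%R.
    by apply: (laplace_rep_cvg_arg H) => //; exact: cvg_harmonic.
  move/cvgrPdist_le : cv => /(_ _ e0) [n _ /(_ n (leqnn n))] /=.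
  rewrite (laplace_rep0 H) => /ler_normlW; rewrite lerBlDr -lerBlDl => He.
  by exists n.+1%:R^-1%R; rewrite ?invr_gt0//; rewrite (stable p _ _ (leqnn _)).
Qed.

Lemma branch_prod01 phi xi u v : laplace_rep phi -> (0 <= u)%R ->
  (0 <= branch_prod (fun t => phi (seq_shift xi) (u * t)%R) v <= 1)%R.
Proof.
by move=> /laplace_rep_branch_prod H u0; exact: (laplace_rep01 (xi, v) H u0).
Qed.

Lemma measurable_branch_prod phi u : laplace_rep phi -> (0 <= u)%R ->
  measurable_fun [set: X * V] (fun p : X * V =>
    branch_prod (fun t => phi (seq_shift p.1) (u * t)%R) p.2).
Proof. by move=> /laplace_rep_branch_prod H u0; exact: (measurable_laplace H u0). Qed.

Let measurable_branch_prodr phi u xi : laplace_rep phi -> (0 <= u)%R ->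
  measurable_fun [set: V] (fun v : V =>
    branch_prod (fun t => phi (seq_shift xi) (u * t)%R) v).
Proof.
by move=> H u0; exact: (measurable_fun_pair2 xi (measurable_branch_prod H u0)).
Qed.

Lemma smoothE phi xi u : laplace_rep phi -> (0 <= u)%R ->
  (smooth phi xi u)%:E =
  \int[k (xi 0%N)]_v (branch_prod (fun t => phi (seq_shift xi) (u * t)%R) v)%:E.
Proof.
move=> phi_rep u0; rewrite fineK// ge0_fin_numE; last first.
  by apply: integral_ge0 => v _; rewrite lee_fin; have /andP[] := branch_prod01 xi v phi_rep u0.
apply: (@le_lt_trans _ _ (\int[k (xi 0%N)]_v (cst 1 v))).
  apply: ge0_le_integral => //.
  - by move=> v _; rewrite lee_fin; have /andP[] := branch_prod01 xi v phi_rep u0.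
  - by apply/measurable_EFinP; exact: measurable_branch_prodr.
  - by move=> v _; rewrite lee_fin; have /andP[] := branch_prod01 xi v phi_rep u0.
by rewrite integral_cst// prob_kernel mule1 ltry.
Qed.

Lemma laplace_rep_smooth phi : laplace_rep phi -> laplace_rep (smooth phi).
Proof.
move=> phi_rep; apply: (laplace_rep_mixture (k := offspring_kernel)
  (laplace_rep_branch_prod phi_rep)) => xi u u0.
by rewrite smoothE.
Qed.

End branching.

(** * Estimates for one application of the smoothing map *)

Section product_estimates.
Context {R : realType}.
Implicit Types (n : nat) (a b : nat -> R).
Local Open Scope ring_scope.

Lemma prod_sub_le n a b : (forall i, 0 <= a i <= 1) -> (forall i, 0 <= b i <= 1) ->
  `|\prod_(i < n) a i - \prod_(i < n) b i| <= \sum_(i < n) `|a i - b i|.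
Proof.
move=> a01 b01; elim: n => [|n IH]; first by rewrite !big_ord0 subrr normr0.
rewrite !big_ord_recr/=.
set A := \prod_(i < n) a i in IH *; set B := \prod_(i < n) b i in IH *.
have -> : A * a n - B * b n = (A - B) * a n + B * (a n - b n) by ring.
apply: le_trans (ler_normD _ _) _; rewrite !normrM; apply: lerD.
  apply: le_trans IH; rewrite ler_piMr//.
  by have /andP[a0 a1] := a01 n; rewrite ger0_norm.
have B0 : 0 <= B by apply: prodr_ge0 => i _; have /andP[] := b01 i.
rewrite ler_piMl// ger0_norm//; apply: prodr_ile1 => i _; exact: b01.
Qed.

(** Each factor satisfies [a <= exp (- (1 - a))]. *)
Lemma prod_remainder_le n a : (forall i, 0 <= a i <= 1) ->
  \prod_(i < n) a i - 1 + \sum_(i < n) (1 - a i) <= kappa (\sum_(i < n) (1 - a i)).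
Proof.
move=> a01; rewrite /kappa lerD2r lerD2r -sumrN expR_sum.
apply: ler_prod => i _; have /andP[-> _] /= := a01 i.
by apply: le_trans (expR_ge1Dx _); lra.
Qed.

End product_estimates.

Section smoothing_estimates.
Context {R : realType} d (Theta : measurableType d)
  dV (V : measurableType dV) (k : R.-pker Theta ~> V) (w : nat -> V -> R).
Hypotheses (mw : forall i, measurable_fun [set: V] (w i))
  (w0 : forall i v, (0 <= w i v)%R)
  (wfin : forall v, exists N, forall i, (N <= i)%N -> w i v = 0%R)
  (mass1 : forall theta, \int[k theta]_v (mass wfin v)%:E = 1).
Local Notation X := (seq_space Theta).
Local Notation mass := (mass wfin).
Local Notation num_weights := (num_weights wfin).
Local Notation smooth := (smooth k w).
Variable tau : probability X R.
Hypothesis tau_iid : iid_law tau.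
Implicit Types (phi psi : X -> R -> R) (xi : X) (v : V) (u : R).

Definition offspring_law : probability V R := mixture tau (offspring_kernel k).
Local Notation nu := offspring_law.

Lemma integral_offspring_law (h : V -> \bar R) : measurable_fun [set: V] h ->
  (forall v, 0 <= h v) -> \int[nu]_v h v = \int[tau]_xi \int[k (xi 0%N)]_v h v.
Proof. exact: integral_mixture. Qed.

Lemma measurable_emass : measurable_fun [set: V] (fun v => (mass v)%:E).
Proof. by apply/measurable_EFinP; exact: measurable_mass. Qed.

Lemma offspring_law_mass : \int[nu]_v (mass v)%:E = 1.
Proof.
rewrite integral_offspring_law; first last.
- by move=> v; rewrite lee_fin mass_ge0.
- exact: measurable_emass.
under eq_integral do rewrite mass1.
by rewrite integral_cst// [X in _ * X](@probability_setT _ _ _ tau) mule1.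
Qed.

Lemma decoupling (g : X * V -> \bar R) : measurable_fun [set: X * V] g ->
  (forall p, 0 <= g p) ->
  \int[tau]_xi \int[k (xi 0%N)]_v g (seq_shift xi, v) =
  \int[nu]_v \int[tau]_xi g (xi, v).
Proof.
move=> mg g0.
have mG : measurable_fun [set: Theta * X] (fun p => \int[k p.1]_v g (p.2, v)).
  apply: (@measurable_fun_integral_finite_kernel _ _ _ _ _
    (fun q : (Theta * X) * V => g (q.1.2, q.2)) (kpre k (@measurable_fst _ _ Theta X))) => //.
  apply: (measurableT_comp mg); apply: measurable_fun_pair => //.
  by apply: measurableT_comp.
rewrite (iid_decoupling tau_iid mG); last by move=> p; exact: integral_ge0.
transitivity (\int[tau]_x \int[nu]_v g (x, v)).
  apply: eq_integral => x _; rewrite integral_offspring_law//.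
  exact: measurable_fun_pair2.
exact: fubini_tonelli.
Qed.

Variable phi : X -> R -> R.
Hypothesis phi_rep : laplace_rep phi.

Let bp u xi v : R := branch_prod w (fun t => phi (seq_shift xi) (u * t)%R) v.

Let bp01 u xi v : (0 <= u)%R -> (0 <= bp u xi v <= 1)%R.
Proof. exact: branch_prod01. Qed.

Let bpE u xi v : bp u xi v =
  (\prod_(i < num_weights v) phi (seq_shift xi) (u * w i v))%R.
Proof. by rewrite /bp (branch_prodE wfin)// mulr0 laplace_rep0. Qed.

Let mbp u xi : (0 <= u)%R -> measurable_fun [set: V] (bp u xi).
Proof.
move=> u0; exact: (measurable_fun_pair2 xi (measurable_branch_prod mw w0 wfin phi_rep u0)).
Qed.

Let phi01 xi u : (0 <= u)%R -> (0 <= phi xi u <= 1)%R.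
Proof. exact: laplace_rep01. Qed.

Lemma slope_smoothE xi u : (0 < u)%R ->
  (slope (smooth phi) xi u)%:E = \int[k (xi 0%N)]_v ((1 - bp u xi v) / u)%:E.
Proof.
move=> u0; have b01 v := bp01 xi v (ltW u0).
have I1 : \int[k (xi 0%N)]_v (1 - bp u xi v)%:E = (1 - smooth phi xi u)%:E.
  have : \int[k (xi 0%N)]_v (1 - bp u xi v)%:E + (smooth phi xi u)%:E = 1.
    rewrite smoothE ?ltW// -ge0_integralD//.
    - under eq_integral do rewrite -EFinD subrK.
      by rewrite integral_cst// prob_kernel mule1.
    - by move=> v _; rewrite lee_fin subr_ge0; have /andP[] := b01 v.
    - by apply/measurable_EFinP/measurable_funB => //; exact: mbp (ltW u0).
    - by move=> v _; rewrite lee_fin; have /andP[] := b01 v.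
    - by apply/measurable_EFinP; exact: mbp (ltW u0).
  by rewrite EFinB => <-; rewrite addeK.
under eq_integral do rewrite EFinM.
rewrite ge0_integralZr//.
- by rewrite I1 EFinM.
- by apply/measurable_EFinP/measurable_funB => //; exact: mbp (ltW u0).
- by move=> v _; rewrite lee_fin subr_ge0; have /andP[] := b01 v.
- by rewrite lee_fin invr_ge0 ltW.
Qed.

(* The compensated form of [w_i (1 - slope phi xi (u w_i))], meaningful when
   [w_i = 0]. *)
Definition gap u i (p : X * V) : R := (w i p.2 - (1 - phi p.1 (u * w i p.2)) / u)%R.

Lemma gapE u i xi v : (0 < u)%R -> (0 < w i v)%R ->
  gap u i (xi, v) = (w i v * (1 - slope phi xi (u * w i v)))%R.
Proof.
move=> u0 wi0; rewrite /gap /slope /=.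
by field; rewrite !gt_eqF.
Qed.

Lemma gap_w0 u i xi v : w i v = 0%R -> gap u i (xi, v) = 0%R.
Proof. by move=> wi; rewrite /gap/= wi mulr0 laplace_rep0// subrr mul0r subr0. Qed.

Lemma measurable_gap u i : (0 < u)%R -> measurable_fun [set: X * V] (gap u i).
Proof.
move=> u0.
have mwi : measurable_fun [set: X * V] (fun p => w i p.2).
  exact: measurableT_comp (mw i) measurable_snd.
apply: measurable_funB => //; apply: measurable_funM => //.
apply: measurable_funB => //; apply: measurable_laplace_comp => //.
  exact: measurable_funM.
by move=> p; rewrite mulr_ge0// ltW.
Qed.

Hypothesis slope_le1 : forall xi u, (0 < u)%R -> (slope phi xi u <= 1)%R.

Lemma phi_ge xi u : (0 <= u)%R -> (1 - phi xi u <= u)%R.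
Proof.
rewrite le_eqVlt => /predU1P[<-|u0]; first by rewrite laplace_rep0// subrr.
by have := slope_le1 xi u0; rewrite /slope ler_pdivrMr// mul1r.
Qed.

Lemma gap_ge0 u i p : (0 < u)%R -> (0 <= gap u i p)%R.
Proof.
move=> u0; rewrite /gap subr_ge0 ler_pdivrMr// mulrC phi_ge// mulr_ge0//.
exact: ltW.
Qed.

(** The mass splits into the slope of the product, the gaps of the factors and a second order error.
    With [s = sum_i (1 - phi (u w_i))] that error is [kappa s / u], and [s <= u M] because slopes
    are at most 1. *)
Let mass_le u xi v : (0 < u)%R ->
  (mass v <= (1 - bp u xi v) / u +
    (\sum_(i < num_weights v) gap u i (seq_shift xi, v) + kappa (u * mass v) / u))%R.
Proof.
move=> u0.
pose a i := phi (seq_shift xi) (u * w i v)%R.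
have a01 i : (0 <= a i <= 1)%R by apply: phi01; rewrite mulr_ge0// ltW.
have := prod_remainder_le (num_weights v) a01; rewrite -bpE.
set s := (\sum_(i < _) (1 - a i))%R => H.
have s0 : (0 <= s)%R by apply: sumr_ge0 => i _; rewrite subr_ge0; have /andP[] := a01 i.
have sm : (s <= u * mass v)%R.
  rewrite /mass mulr_sumr; apply: ler_sum => i _; rewrite phi_ge// mulr_ge0//.
  exact: ltW.
have gE : (\sum_(i < num_weights v) gap u i (seq_shift xi, v) = mass v - s / u)%R.
  by rewrite /gap big_split/= -/(mass v) sumrN -mulr_suml.
rewrite gE; have := le_trans H (kappa_nd s0 sm) => {}H.
have {}H : ((bp u xi v - 1 + s) / u <= kappa (u * mass v) / u)%R.
  by rewrite ler_wpM2r// invr_ge0 ltW.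
move: H; rewrite mulrDl mulrBl [((1 - _) / u)%R]mulrBl; lra.
Qed.

Definition mean_deficit u : \bar R := \int[tau]_xi (1 - slope phi xi u)%:E.

Let gsum u (p : X * V) : \bar R := (\sum_(i < num_weights p.2) gap u i p)%R%:E.

Let gsumE u p : (0 < u)%R -> gsum u p = \sum_(0 <= i <oo) (gap u i p)%:E.
Proof.
move=> u0; apply/esym/lim_near_cst => //; exists (num_weights p.2) => // n /= Nn.
have tail0 : \sum_(num_weights p.2 <= i < n) (gap u i p)%:E = 0.
  rewrite big_nat big1// => i /andP[Ni _]; case: p Ni {Nn} => xi v /= Ni.
  by rewrite gap_w0// (weight_eq0 Ni).
by rewrite (big_cat_nat (n := num_weights p.2))//= tail0 adde0 big_mkord sumEFin.
Qed.

Let mgsum u : (0 < u)%R -> measurable_fun [set: X * V] (gsum u).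
Proof.
move=> u0; have -> : gsum u = (fun p => \sum_(0 <= i <oo) (gap u i p)%:E).
  by apply/funext => p; rewrite gsumE.
apply: ge0_emeasurable_sum.
- by move=> i p _ _; rewrite lee_fin gap_ge0.
- by move=> i _; apply/measurable_EFinP; exact: measurable_gap.
Qed.

Lemma slope_smooth_le1 xi u : (0 < u)%R -> (slope (smooth phi) xi u <= 1)%R.
Proof.
move=> u0; rewrite -lee_fin slope_smoothE// -(mass1 (xi 0%N)).
apply: ge0_le_integral => //.
- move=> v _; rewrite lee_fin divr_ge0 ?subr_ge0 ?(ltW u0)//.
  by have /andP[] := bp01 xi v (ltW u0).
- apply/measurable_EFinP; apply: measurable_funM => //.
  by apply: measurable_funB => //; exact: mbp (ltW u0).
- exact: measurable_emass.
move=> v _; rewrite lee_fin ler_pdivrMr// mulrC /mass mulr_sumr bpE.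
have a01 i : (0 <= phi (seq_shift xi) (u * w i v) <= 1)%R.
  by apply: phi01; rewrite mulr_ge0// ltW.
have c01 (i : nat) : (0 <= (1 : R) <= 1)%R by rewrite ler01 lexx.
have := prod_sub_le (a := fun=> 1%R) (num_weights v) c01 a01.
rewrite big1// => /(le_trans (ler_norm _)) /le_trans; apply.
apply: ler_sum => i _; have /andP[_ a1] := a01 i.
by rewrite ger0_norm ?subr_ge0// phi_ge// mulr_ge0// ltW.
Qed.

Let gap_mean_le u (F : R -> R) i v : (0 < u)%R ->
  (forall t, (0 < t)%R -> mean_deficit (u * t)%R <= (F t)%:E) ->
  \int[tau]_xi (gap u i (xi, v))%:E <= (w i v * F (w i v))%:E.
Proof.
move=> u0 FD; have := w0 i v; rewrite le_eqVlt => /predU1P[wi|wi].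
  rewrite -wi mul0r integral0_eq// => xi _; by rewrite gap_w0.
under eq_integral do rewrite gapE// EFinM.
rewrite ge0_integralZl//.
- by rewrite EFinM lee_pmul2l// FD.
- apply/measurable_EFinP; apply: measurable_funB => //.
  by apply: measurable_slope => //; exact: mulr_gt0.
- by move=> xi _; rewrite lee_fin subr_ge0 slope_le1// mulr_gt0.
- by rewrite lee_fin ltW.
Qed.

Lemma mean_deficit_smooth u (F : R -> R) : (0 < u)%R ->
  measurable_fun [set: R] F -> (forall t, 0 <= t -> 0 <= F t)%R ->
  (forall t, (0 < t)%R -> mean_deficit (u * t)%R <= (F t)%:E) ->
  \int[tau]_xi (1 - slope (smooth phi) xi u)%:E <= size_bias w nu F + kappa_mean wfin nu u.
Proof.
move=> u0 mF F0 FD.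
have gsum0 p : 0 <= gsum u p.
  by rewrite lee_fin; apply: sumr_ge0 => i _; exact: gap_ge0.
pose kap v : \bar R := (kappa (u * mass v) / u)%:E.
have kap0 v : 0 <= kap v by rewrite lee_fin divr_ge0 ?kappa_ge0// ltW.
have mkap : measurable_fun [set: V] kap.
  by apply/measurable_EFinP; exact: (measurable_kappa_mass mw w0 wfin).
have mgs : measurable_fun [set: X * V] (fun p => gsum u (seq_shift p.1, p.2)).
  apply: (measurableT_comp (mgsum u0)); apply: measurable_fun_pair => //.
  exact: measurableT_comp (@measurable_seq_shift _ Theta) measurable_fst.
have mgsr xi : measurable_fun [set: V] (fun v => gsum u (seq_shift xi, v)).
  exact: (measurable_fun_pair2 xi mgs).
pose E1 xi := \int[k (xi 0%N)]_v gsum u (seq_shift xi, v).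
pose E2 xi := \int[k (xi 0%N)]_v kap v.
have mE1 : measurable_fun [set: X] E1.
  exact: (measurable_fun_integral_finite_kernel
    (fun p => gsum u (seq_shift p.1, p.2)) (offspring_kernel k)).
have mE2 : measurable_fun [set: X] E2.
  apply: (measurable_fun_integral_finite_kernel (fun p : X * V => kap p.2)
    (offspring_kernel k)) => //.
  by apply: measurableT_comp => //; exact: measurable_snd.
have E10 xi : 0 <= E1 xi by exact: integral_ge0.
have E20 xi : 0 <= E2 xi by exact: integral_ge0.
have slope1 xi : (0 <= 1 - slope (smooth phi) xi u)%R.
  by rewrite subr_ge0 slope_smooth_le1.
apply: (@le_trans _ _ (\int[tau]_xi (E1 xi + E2 xi))).
  apply: ge0_le_integral => //.
  - by move=> xi _; rewrite lee_fin.
  - apply/measurable_EFinP; apply: measurable_funB => //.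
    by apply: measurable_slope => //; exact: laplace_rep_smooth.
  - exact: emeasurable_funD.
  move=> xi _; rewrite EFinB leeBlDl// -ge0_integralD// slope_smoothE//.
  have mb : measurable_fun [set: V] (fun v => ((1 - bp u xi v) / u)%:E).
    apply/measurable_EFinP; apply: measurable_funM => //.
    by apply: measurable_funB => //; exact: mbp (ltW u0).
  have b0 v : 0 <= ((1 - bp u xi v) / u)%:E.
    rewrite lee_fin divr_ge0 ?subr_ge0 ?(ltW u0)//.
    by have /andP[] := bp01 xi v (ltW u0).
  rewrite -ge0_integralD//; last 2 first.
  - by move=> v _; rewrite adde_ge0.
  - exact: emeasurable_funD.
  rewrite -{1}(mass1 (xi 0%N)); apply: ge0_le_integral => //.
  - by move=> v _; rewrite lee_fin mass_ge0.
  - exact: measurable_emass.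
  - by apply: emeasurable_funD => //; exact: emeasurable_funD.
  by move=> v _; rewrite -!EFinD lee_fin; exact: mass_le.
(* The independence of the offspring from the shifted environment enters here: the gaps are averaged
   over the environment with the weights held fixed. *)
rewrite ge0_integralD// {1}/E1 (decoupling (mgsum u0))//.
rewrite /E2 -integral_offspring_law//; apply: leeD => //.
apply: ge0_le_integral => //.
- by move=> v _; exact: integral_ge0.
- by apply: (@measurable_fun_fubini_tonelli_G _ _ _ _ _ tau (gsum u)) => //; exact: mgsum.
- exact: measurable_wsum.
move=> v _; rewrite (wsumE wfin) -sumEFin.
have -> : \int[tau]_xi gsum u (xi, v) =
    \int[tau]_xi \sum_(i < num_weights v) (gap u i (xi, v))%:E.
  by apply: eq_integral => xi _; rewrite sumEFin.
rewrite ge0_integral_sum//.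
- by apply: lee_sum => i _; exact: gap_mean_le.
- move=> i; apply/measurable_EFinP.
  exact: (measurable_fun_pair1 v (measurable_gap i u0)).
- by move=> i xi _; rewrite lee_fin gap_ge0.
Qed.

End smoothing_estimates.

Section smoothing_iteration.
Context {R : realType} d (Theta : measurableType d)
  dV (V : measurableType dV) (k : R.-pker Theta ~> V) (w : nat -> V -> R).
Hypotheses (mw : forall i, measurable_fun [set: V] (w i))
  (w0 : forall i v, (0 <= w i v)%R)
  (wfin : forall v, exists N, forall i, (N <= i)%N -> w i v = 0%R)
  (mass1 : forall theta, \int[k theta]_v (mass wfin v)%:E = 1).
Local Notation X := (seq_space Theta).
Local Notation mass := (mass wfin).
Local Notation smooth := (smooth k w).
Variable tau : probability X R.
Hypothesis tau_iid : iid_law tau.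
Implicit Types (phi psi : X -> R -> R) (xi : X) (v : V) (u : R).
Local Notation nu := (offspring_law k tau).

Lemma smooth_mono phi psi xi u : laplace_rep phi -> laplace_rep psi ->
  (forall xi u, (0 <= u)%R -> (phi xi u <= psi xi u)%R) -> (0 <= u)%R ->
  (smooth phi xi u <= smooth psi xi u)%R.
Proof.
move=> phi_rep psi_rep pp u0; rewrite -lee_fin !(smoothE k mw w0 wfin)//.
have m01 (f : X -> R -> R) v : laplace_rep f ->
    (0 <= branch_prod w (fun t => f (seq_shift xi) (u * t)%R) v)%R.
  by move=> fr; have /andP[] := branch_prod01 mw w0 wfin xi v fr u0.
have mb (f : X -> R -> R) : laplace_rep f -> measurable_fun [set: V]
    (fun v => (branch_prod w (fun t => f (seq_shift xi) (u * t)%R) v)%:E).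
  move=> fr; apply/measurable_EFinP.
  exact: (measurable_fun_pair2 xi (measurable_branch_prod mw w0 wfin fr u0)).
apply: ge0_le_integral => //; [|exact: mb|exact: mb|].
  by move=> v _; rewrite lee_fin m01.
move=> v _; rewrite lee_fin !(branch_prodE wfin) ?mulr0 ?laplace_rep0//.
apply: ler_prod => i _; have uw : (0 <= u * w i v)%R by rewrite mulr_ge0.
by have /andP[-> _] := laplace_rep01 (seq_shift xi) phi_rep uw; exact: pp.
Qed.

Definition iterate n : X -> R -> R := iter n smooth (fun _ u => expR (- u)).

Lemma laplace_rep_iterate n : laplace_rep (iterate n).
Proof.
elim: n => [|n IH]; last exact: laplace_rep_smooth.
exists (cst 1%R); split => // xi u u0 /=.
under eq_integral do rewrite mulr1.
by rewrite integral_cst// [X in _ * X](@probability_setT _ _ _ unif) mule1.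
Qed.

(* By Jensen's inequality, in the form of the tangent line of the exponential. *)
Lemma iterate0_le1 xi u : (0 <= u)%R -> (iterate 0 xi u <= iterate 1 xi u)%R.
Proof.
move=> u0; rewrite -lee_fin (smoothE k mw w0 wfin xi (laplace_rep_iterate 0))//=.
have bE v : branch_prod w (fun t => expR (- (u * t))) v = expR (- (u * mass v)).
  rewrite (branch_prodE wfin) ?mulr0 ?oppr0 ?expR0//.
  by rewrite /mass mulr_sumr -sumrN expR_sum.
under eq_integral do rewrite bE.
have e0 : (0 <= expR (- u) * u)%R by rewrite mulr_ge0 ?expR_ge0.
have me : measurable_fun [set: V] (fun v => expR (- (u * mass v))).
  apply: measurableT_comp => //; apply: measurableT_comp => //.
  by apply: measurable_funM => //; exact: measurable_mass.
have mM : measurable_fun [set: V] (fun v => (mass v)%:E).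
  by apply/measurable_EFinP; exact: measurable_mass.
have H : (expR (- u) * (1 + u))%:E <=
    \int[k (xi 0%N)]_v (expR (- (u * mass v)))%:E + (expR (- u) * u)%:E.
  have -> : (expR (- u) * u)%:E =
      \int[k (xi 0%N)]_v ((expR (- u) * u)%:E * (mass v)%:E).
    rewrite ge0_integralZl//; first by rewrite mass1 mule1.
    by move=> v _; rewrite lee_fin mass_ge0.
  rewrite -ge0_integralD//; first last.
  - exact: measurable_funeM.
  - by move=> v _; rewrite -EFinM lee_fin mulr_ge0// mass_ge0.
  - exact/measurable_EFinP.
  have -> : (expR (- u) * (1 + u))%:E =
      \int[k (xi 0%N)]_v (cst (expR (- u) * (1 + u))%:E v).
    by rewrite integral_cst// prob_kernel mule1.
  apply: ge0_le_integral => //.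
  - by move=> v _; rewrite lee_fin mulr_ge0 ?expR_ge0// addr_ge0.
  - by apply: emeasurable_funD; [exact/measurable_EFinP|exact: measurable_funeM].
  move=> v _ /=; rewrite -EFinM -EFinD lee_fin.
  have := expR_ge1Dx (u - u * mass v).
  have -> : expR (- (u * mass v)) = (expR (- u) * expR (u - u * mass v))%R.
    by rewrite -expRD; congr expR; ring.
  have := expR_gt0 (- u); move: (expR (- u)) (expR (u - _)) => x y x0 h.
  have : (x * (1 + (u - u * mass v)) <= x * y)%R by rewrite ler_pM2l.
  by rewrite !mulrDr mulrN; lra.
move: H; set I := \int[_]_v _ => H.
have If : I \is a fin_num.
  rewrite ge0_fin_numE; last by apply: integral_ge0 => v _; rewrite lee_fin expR_ge0.
  apply: (@le_lt_trans _ _ (\int[k (xi 0%N)]_v (cst 1 v))).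
    apply: ge0_le_integral => //; first exact/measurable_EFinP.
    move=> v _; rewrite lee_fin -expR0 ler_expR oppr_le0 mulr_ge0//.
    exact: mass_ge0.
  by rewrite integral_cst// prob_kernel mule1 ltry.
by move: H; rewrite -(fineK If) -EFinD !lee_fin mulrDr mulr1; lra.
Qed.

Lemma iterateS_ge n xi u : (0 <= u)%R -> (iterate n xi u <= iterate n.+1 xi u)%R.
Proof.
elim: n xi u => [|n IH] xi u u0; first exact: iterate0_le1.
exact: (smooth_mono xi (laplace_rep_iterate n) (laplace_rep_iterate n.+1) IH u0).
Qed.

Lemma iterate_nd xi u : (0 <= u)%R ->
  {homo (fun n => iterate n xi u) : n m / (n <= m)%N >-> (n <= m)%R}.
Proof. by move=> u0; apply/nondecreasing_seqP => n; exact: iterateS_ge. Qed.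

Lemma slope_iterate_le1 n xi u : (0 < u)%R -> (slope (iterate n) xi u <= 1)%R.
Proof.
move=> u0; rewrite /slope ler_pdivrMr// mul1r.
have H := iterate_nd xi (ltW u0) (leq0n n).
have := expR_ge1Dx (- u); rewrite {1}/iterate /= in H; lra.
Qed.

Section mean_deficit_facts.
Variable phi : X -> R -> R.
Hypotheses (phi_rep : laplace_rep phi)
  (phi_slope : forall xi u, (0 < u)%R -> (slope phi xi u <= 1)%R).

Lemma mean_deficit_bounds u : (0 < u)%R -> 0 <= mean_deficit tau phi u <= 1.
Proof.
move=> u0; apply/andP; split.
  by apply: integral_ge0 => xi _; rewrite lee_fin subr_ge0 phi_slope.
apply: (@le_trans _ _ (\int[tau]_xi (cst 1 xi))).
  apply: ge0_le_integral => //.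
  - by move=> xi _; rewrite lee_fin subr_ge0 phi_slope.
  - by apply/measurable_EFinP; apply: measurable_funB => //; exact: measurable_slope.
  - by move=> xi _; rewrite lee_fin gerBl slope_ge0.
by rewrite integral_cst// [X in _ * X](@probability_setT _ _ _ tau) mule1.
Qed.

Lemma mean_deficit_nd u t : (0 < u)%R -> (u <= t)%R ->
  mean_deficit tau phi u <= mean_deficit tau phi t.
Proof.
move=> u0 uv; have t0 : (0 < t)%R by exact: lt_le_trans uv.
apply: ge0_le_integral => //.
- by move=> xi _; rewrite lee_fin subr_ge0 phi_slope.
- by apply/measurable_EFinP; apply: measurable_funB => //; exact: measurable_slope.
- by apply/measurable_EFinP; apply: measurable_funB => //; exact: measurable_slope.
- by move=> xi _; rewrite lee_fin lerD2l lerN2 slope_nincr.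
Qed.

(* Set to 0 on the nonpositive axis, hence nondecreasing on the whole line. *)
Definition rdeficit u : R := if (0 < u)%R then fine (mean_deficit tau phi u) else 0%R.

Lemma rdeficitE u : (0 < u)%R -> (rdeficit u)%:E = mean_deficit tau phi u.
Proof.
move=> u0; rewrite /rdeficit u0 fineK//.
have /andP[a b] := mean_deficit_bounds u0.
by rewrite ge0_fin_numE// (le_lt_trans b)// ltry.
Qed.

Lemma rdeficit01 u : (0 <= rdeficit u <= 1)%R.
Proof.
case: (ltP 0%R u) => u0; last by rewrite /rdeficit ltNge u0 /= lexx ler01.
by rewrite -!lee_fin rdeficitE// mean_deficit_bounds.
Qed.

Lemma rdeficit_nd : {homo rdeficit : u t / (u <= t)%R}.
Proof.
move=> u t uv; case: (ltP 0%R u) => u0.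
  have t0 : (0 < t)%R by exact: lt_le_trans uv.
  by rewrite -lee_fin !rdeficitE// mean_deficit_nd.
have -> : rdeficit u = 0%R by rewrite /rdeficit ltNge u0.
by have /andP[] := rdeficit01 t.
Qed.

Lemma measurable_rdeficit : measurable_fun [set: R] rdeficit.
Proof. exact: nondecreasing_measurable rdeficit_nd. Qed.

End mean_deficit_facts.

(** The iterates increase, so their slopes decrease and their deficits increase. This turns the
    recursion from [n] to [n + 1] into an inequality that the deficit of a single iterate satisfies
    with itself. *)
Lemma rdeficit_iterate_nd n u : (rdeficit (iterate n) u <= rdeficit (iterate n.+1) u)%R.
Proof.
case: (ltP 0%R u) => u0; last by rewrite /rdeficit ltNge u0.
rewrite -lee_fin !rdeficitE//; try exact: laplace_rep_iterate;
  try exact: slope_iterate_le1.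
have m n' : measurable_fun [set: X] (fun xi => (1 - slope (iterate n') xi u)%:E).
  apply/measurable_EFinP; apply: measurable_funB => //; apply: measurable_slope => //.
  exact: laplace_rep_iterate.
apply: ge0_le_integral => //.
  by move=> xi _; rewrite lee_fin subr_ge0 slope_iterate_le1.
move=> xi _; rewrite lee_fin lerD2l lerN2 /slope ler_wpM2r ?invr_ge0 ?(ltW u0)//.
by rewrite lerD2l lerN2 iterateS_ge// ltW.
Qed.

Let nu_mass : \int[nu]_v (mass v)%:E = 1.
Proof. exact: offspring_law_mass. Qed.

Lemma deficit_step n u (F : R -> R) : (0 < u)%R ->
  measurable_fun [set: R] F -> (forall t, 0 <= t -> 0 <= F t)%R ->
  (forall t, (0 < t)%R -> (rdeficit (iterate n) (u * t) <= F t)%R) ->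
  (rdeficit (iterate n.+1) u)%:E <= size_bias w nu F + kappa_mean wfin nu u.
Proof.
move=> u0 mF F0 FD; rewrite rdeficitE//; [|exact: laplace_rep_iterate|exact: slope_iterate_le1].
apply: (mean_deficit_smooth mw w0 mass1 tau_iid (laplace_rep_iterate n)) => //.
  exact: slope_iterate_le1.
move=> t t0; rewrite -rdeficitE ?lee_fin ?FD ?mulr_gt0//.
  exact: laplace_rep_iterate.
exact: slope_iterate_le1.
Qed.

(** Convergence for each fixed [n], without uniformity: it is the boundary condition at the far end
    of the lattice, where the drift argument asks for no rate. Dominated convergence carries it
    through each smoothing step. *)
Lemma rdeficit_iterate_cvg0 n (u : nat -> R) : (forall j, 0 < u j)%R ->
  u j @[j --> \oo] --> 0%R -> rdeficit (iterate n) (u j) @[j --> \oo] --> 0%R.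
Proof.
elim: n u => [|n IH] u u0 ucvg.
  apply: (@squeeze_cvgr _ _ _ _ (cst 0%R) u) => //; last exact: cvg_cst.
  apply: nearW => j.
  have /andP[-> _] /= := rdeficit01 (laplace_rep_iterate 0) (@slope_iterate_le1 0) (u j).
  rewrite -lee_fin (rdeficitE (laplace_rep_iterate 0) (@slope_iterate_le1 0))//.
  have -> : (u j)%:E = \int[tau]_xi (cst (u j)%:E xi).
    by rewrite integral_cst// [X in _ * X](@probability_setT _ _ _ tau) mule1.
  apply: ge0_le_integral => //.
  - by move=> xi _; rewrite lee_fin subr_ge0 slope_iterate_le1.
  - apply/measurable_EFinP; apply: measurable_funB => //; apply: measurable_slope => //.
    exact: laplace_rep_iterate.
  move=> xi _; rewrite lee_fin /slope /iterate /= lerBlDr -lerBlDl.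
  have /andP[+ _] := expR_slope_bounds (u0 j) (@ler01 R).
  by rewrite mulr1 expr1n mulr1.
pose F j t := rdeficit (iterate n) (u j * t)%R.
have F01 j t : (0 <= F j t <= 1)%R.
  by apply: rdeficit01; [exact: laplace_rep_iterate|exact: slope_iterate_le1].
have mF j : measurable_fun [set: R] (F j).
  apply: (measurableT_comp (measurable_rdeficit (laplace_rep_iterate n) (@slope_iterate_le1 n))).
  exact: measurable_funM.
have SB0 : size_bias w nu (F j) @[j --> \oo] --> 0.
  apply: (size_bias_cvg0 mw w0 nu_mass) => // t t0.
  apply: IH => [j|]; first exact: mulr_gt0.
  by rewrite -[X in _ --> X](mul0r t); exact: cvgMr_tmp.
have K0 : kappa_mean wfin nu (u j) @[j --> \oo] --> 0.
  exact: kappa_mean_cvg0.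
have : (rdeficit (iterate n.+1) (u j))%:E @[j --> \oo] --> 0.
  apply: (@squeeze_cvge _ _ _ _ (cst 0) _
    (fun j => size_bias w nu (F j) + kappa_mean wfin nu (u j))).
  - apply: nearW => j; apply/andP; split.
      rewrite lee_fin.
      by have /andP[] := rdeficit01 (laplace_rep_iterate n.+1) (@slope_iterate_le1 n.+1) (u j).
    by apply: deficit_step => // t t0; have /andP[] := F01 j t.
  - exact: cvg_cst.
  - by rewrite -[X in _ --> X]adde0; exact: cvgeD.
by move/fine_cvg.
Qed.

End smoothing_iteration.

Lemma cvg_expR_neg {R : realType} (s delta : R) : (0 < delta)%R ->
  expR (s - n%:R * delta)%R @[n --> \oo] --> 0%R.
Proof.
move=> d0; have -> : (fun n => expR (s - n%:R * delta)%R) =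
    (fun n => expR s * expR (- delta) ^+ n)%R.
  by apply/funext => n; rewrite -expRM_natl -expRD mulrN.
rewrite -[X in _ --> X](mulr0 (expR s)); apply: cvgMl_tmp.
by apply: cvg_expr; rewrite ger0_norm ?expR_ge0// expR_lt1 oppr_lt0.
Qed.

(** * The drift inequality for monotone functions near 0 *)

Section drift_bound.
Context {R : realType} dV (V : measurableType dV) (w : nat -> V -> R).
Hypotheses (mw : forall i, measurable_fun [set: V] (w i))
  (w0 : forall i v, (0 <= w i v)%R)
  (wfin : forall v, exists N, forall i, (N <= i)%N -> w i v = 0%R).
Variables (nu : probability V R).
Hypothesis nu_mass : \int[nu]_v (mass wfin v)%:E = 1.
Variables (delta : R) (m : R -> int) (L : nat) (p q : R).
Hypotheses (delta0 : (0 < delta)%R)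
  (measurable_m : forall F : int -> R,
    (forall i j : int, (i <= j)%R -> (F i <= F j)%R) ->
    measurable_fun [set: R] (fun t => F (m t)))
  (m_ge : forall t, (- L%:Z <= m t)%R)
  (le_m : forall t, (0 <= t)%R -> (t <= expR (delta * (m t)%:~R))%R)
  (SBq : size_bias w nu (fun t => posint (m t)) = q%:E)
  (SBp : size_bias w nu (fun t => posint (- m t)%R) = p%:E).

(** The drift inequality for [g] read on the lattice [s + delta i] in the exponent. Rounding [log t]
    up only increases the monotone [g], and the term at the far end of the lattice disappears
    because [g] tends to 0 there. When [q < p], the bound improves on [g <= c] as soon as [E] is
    small. *)
Lemma drift_bound (g : R -> R) (c s E : R) (e : nat -> R) :
  {homo g : u v / (u <= v)%R} -> (forall u, 0 <= g u <= c)%R ->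
  (fun n : nat => g (expR (s - n%:R * delta)))%R @ \oo --> 0%R ->
  (forall j, let u := expR (s - j%:R * delta)%R in
    (g u)%:E <= size_bias w nu (fun t => g (u * t)%R) + (e j)%:E) ->
  (forall N, (\sum_(j < N) e j <= E)%R) ->
  (p * g (expR (s - L%:R * delta)) <= q * c + E)%R.
Proof.
move=> gnd g0c gcvg step sumE.
pose f (i : int) := g (expR (s + delta * i%:~R)%R).
have fN n : f (- n%:Z)%R = g (expR (s - n%:R * delta))%R.
  by rewrite /f rmorphN/= mulrN mulrC.
have fnd (i j : int) : (i <= j)%R -> (f i <= f j)%R.
  by move=> ij; apply: gnd; rewrite ler_expR lerD2l ler_pM2l// ler_int.
have mg : measurable_fun [set: R] g by apply: nondecreasing_measurable.
have main N : (p * f (- L%:Z) <= q * c + p * f (- N%:Z) + \sum_(j < N.+1) e j)%R.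
  apply: (drift_inequality mw w0 nu_mass (m := m)) => //.
  - by move=> i; have /andP[] := g0c (expR (s + delta * i%:~R)%R).
  - by move=> i; have /andP[] := g0c (expR (s + delta * i%:~R)%R).
  move=> j; rewrite fN; apply: le_trans (step j) _.
  rewrite leeD2r//; apply: (size_bias_le mw w0 wfin).
  - by apply: measurableT_comp mg _; exact: measurable_funM.
  - apply: (measurable_m (F := fun i => f (i - j%:Z)%R)) => i i' ii'.
    by apply: fnd; rewrite lerD2r.
  - by move=> t _; have /andP[] := g0c (expR (s - j%:R * delta) * t)%R.
  move=> t t0; apply: gnd; apply: (le_trans (ler_wpM2l (expR_ge0 _) (le_m t0))).
  rewrite -expRD ler_expR rmorphB/= mulrBr.
  by rewrite le_eqVlt; apply/orP; left; apply/eqP; ring.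
have lim : (fun N => q * c + p * f (- N%:Z) + E)%R @ \oo --> (q * c + p * 0 + E)%R.
  apply: cvgD; last exact: cvg_cst.
  apply: cvgD; first exact: cvg_cst.
  by apply: cvgMl_tmp; under eq_fun do rewrite fN.
rewrite -fN -(addr0 (q * c)%R) -[X in (_ + X + _)%R](mulr0 p).
apply: (cvgr_to_ge lim); apply: nearW => N.
by apply: le_trans (main N) _; rewrite lerD2l.
Qed.

End drift_bound.

(** * Existence *)

Section existence.
Context {R : realType} d (Theta : measurableType d)
  dV (V : measurableType dV) (k : R.-pker Theta ~> V) (w : nat -> V -> R).
Hypotheses (mw : forall i, measurable_fun [set: V] (w i))
  (w0 : forall i v, (0 <= w i v)%R)
  (wfin : forall v, exists N, forall i, (N <= i)%N -> w i v = 0%R)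
  (mass1 : forall theta, \int[k theta]_v (mass wfin v)%:E = 1).
Local Notation X := (seq_space Theta).
Local Notation mass := (mass wfin).
Local Notation smooth := (smooth k w).
Local Notation iterate := (iterate k w).
Variable tau : probability X R.
Hypothesis tau_iid : iid_law tau.
Implicit Types (phi psi : X -> R -> R) (xi : X) (v : V) (u : R).
Local Notation nu := (offspring_law k tau).

Let rep n : laplace_rep (iterate n) := laplace_rep_iterate k mw w0 wfin n.

Let slope1 n xi u : (0 < u)%R -> (slope (iterate n) xi u <= 1)%R.
Proof. exact: (slope_iterate_le1 mw w0 mass1). Qed.

Lemma smooth_cvg (phi_ : nat -> X -> R -> R) phi :
  (forall n, laplace_rep (phi_ n)) -> laplace_rep phi ->
  (forall xi u, (0 <= u)%R -> phi_ n xi u @[n --> \oo] --> phi xi u) ->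
  forall xi u, (0 <= u)%R -> smooth (phi_ n) xi u @[n --> \oo] --> smooth phi xi u.
Proof.
move=> rep_ reph cvg_ xi u u0.
pose b f v := (branch_prod w (fun t => f (seq_shift xi) (u * t)%R) v)%:E.
have bE f v : laplace_rep f -> b f v =
    (\prod_(i < num_weights wfin v) f (seq_shift xi) (u * w i v))%R%:E.
  by move=> rf; rewrite /b (branch_prodE wfin)// mulr0 laplace_rep0.
suff : (fun n => \int[k (xi 0%N)]_v b (phi_ n) v) @ \oo --> \int[k (xi 0%N)]_v b phi v.
  under eq_fun do rewrite /b -(smoothE k mw w0 wfin xi (rep_ _) u0).
  by rewrite /b -(smoothE k mw w0 wfin xi reph u0); exact: fine_cvg.
apply: (@dominated_cvg _ _ _ _ _ measurableT _ _ (cst 1)) => //.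
- move=> n; apply/measurable_EFinP.
  exact: (measurable_fun_pair2 xi (measurable_branch_prod mw w0 wfin (rep_ n) u0)).
- move=> v _; rewrite bE//; under eq_fun do rewrite bE//.
  apply: cvg_EFin; first exact: nearW.
  apply: (@cvg_ord_prod _ (fun i n => phi_ n (seq_shift xi) (u * w i v)%R)
    (fun i => phi (seq_shift xi) (u * w i v)%R)) => i.
  by apply: cvg_; rewrite mulr_ge0.
- apply/integrableP; split => //; under eq_integral do rewrite /= normr1.
  by rewrite integral_cst// mul1e prob_kernel ltry.
move=> n v _; rewrite gee0_abs lee_fin;
  by have /andP[] := branch_prod01 mw w0 wfin xi v (rep_ n) u0.
Qed.

Lemma lmean_scale psi c : laplace_rep psi -> (0 <= c)%R -> forall xi,
  lmean (fun xi u => psi xi (u * c)%R) xi = c%:E * lmean psi xi.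
Proof.
move=> [Z [mZ Z0 psiZ]] c0 xi.
have E1 := lmean_kernel (k := kcst unif) mZ Z0 psiZ xi.
have mcZ : measurable_fun [set: X * R] (fun p => c * Z p)%R by exact: measurable_funM.
have cZ0 p : (0 <= c * Z p)%R by rewrite mulr_ge0.
have psicZ (xi' : X) u : (0 <= u)%R -> (psi xi' (u * c))%:E =
    \int[kcst unif xi']_s (expR (- (u * (c * Z (xi', s)))))%:E.
  move=> u0; rewrite (psiZ _ _ (mulr_ge0 u0 c0)).
    by apply: eq_integral => s _; rewrite mulrA.
rewrite E1 (lmean_kernel mcZ cZ0 psicZ); under eq_integral do rewrite EFinM.
rewrite ge0_integralZl//; last by move=> s _; rewrite lee_fin.
by apply/measurable_EFinP; exact: (measurable_fun_pair2 xi mZ).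
Qed.

Section nondegeneracy.
Variables K lam kap : R.
Hypotheses (K0 : (0 <= K)%R)
  (mass_log : \int[nu]_v (mass v * logplus (mass v))%:E < +oo)
  (SBlogplus : size_bias w nu logplus = lam%:E)
  (SBlneg : size_bias w nu (lneg K) = kap%:E) (drift : (lam < kap)%R).

Let nu_mass : \int[nu]_v (mass v)%:E = 1.
Proof. exact: offspring_law_mass. Qed.

(** Starting the lattice at [exp (- J delta)] makes the errors sum to at most [(p - q) / 2], whence
    [p D_n <= q + (p - q) / 2 = p (1 - eps)]. No constant depends on [n]. *)
Lemma rdeficit_iterate_bounded : exists u0 eps, [/\ (0 < u0)%R, (0 < eps)%R
  & forall n, (rdeficit tau (iterate n) u0 <= 1 - eps)%R].
Proof.
have [delta [m [L [p [q [d0 mm [mL lem] [SBq SBp] qp]]]]]] :=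
  drift_parameters mw w0 nu_mass K0 SBlogplus SBlneg drift.
have q0 : (0 <= q)%R.
  rewrite -lee_fin -SBq; apply: (size_bias_ge0 w0 wfin) => t _.
  exact: posint_ge0.
have p0 : (0 < p)%R by exact: le_lt_trans qp.
have e0 : (0 < (p - q) / 2)%R by rewrite divr_gt0// subr_gt0.
have [J KJ] := kappa_mean_tail mw w0 nu_mass mass_log d0 e0.
exists (expR (- (J%:R * delta) - L%:R * delta)%R), ((p - q) / 2 / p)%R.
split; [exact: expR_gt0|exact: divr_gt0|move=> n].
have main := @drift_bound _ _ _ _ mw w0 wfin nu nu_mass _ _ _ _ _ d0 mm mL lem SBq SBp
  (rdeficit tau (iterate n)) 1%R (- (J%:R * delta))%R ((p - q) / 2)%R
  (fun j => fine (kappa_mean wfin nu (expR (- ((j + J)%:R * delta))))).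
rewrite -(ler_pM2l p0); apply: le_trans (main _ _ _ _ KJ) _.
- by move=> a b ab; exact: (rdeficit_nd tau (rep n) (@slope1 n)).
- exact: (rdeficit01 tau (rep n) (@slope1 n)).
- apply: (rdeficit_iterate_cvg0 mw w0 mass1 tau_iid) => [j|]; first exact: expR_gt0.
  exact: cvg_expR_neg.
- move=> j; set u := expR (- (J%:R * delta) - j%:R * delta)%R.
  rewrite -/u; have u0 : (0 < u)%R by exact: expR_gt0.
  have -> : expR (- ((j + J)%:R * delta)) = u :> R.
    by rewrite /u natrD mulrDl opprD addrC.
  rewrite fineK; last exact: (kappa_mean_fin mw w0 nu_mass).
  apply: (@le_trans _ _ (rdeficit tau (iterate n.+1) u)%:E).
    by rewrite lee_fin; exact: (rdeficit_iterate_nd mw w0 mass1).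
  apply: (deficit_step mw w0 mass1 tau_iid u0) => //.
    apply: (measurableT_comp (measurable_rdeficit tau (rep n) (@slope1 n))).
    exact: measurable_funM.
  by move=> t _; have /andP[] := rdeficit01 tau (rep n) (@slope1 n) (u * t)%R.
by rewrite mulr1 mulrBr mulr1 mulrCA divff ?gt_eqF//; lra.
Qed.

Definition limit_iterate xi u : R := limn (fun n => iterate n xi u).
Local Notation phi := limit_iterate.

Let cvg_phi xi u : (0 <= u)%R -> iterate n xi u @[n --> \oo] --> phi xi u.
Proof.
move=> u0; apply: nondecreasing_is_cvgn; first exact: (iterate_nd mw w0 mass1).
by exists 1%R => _ [n _ <-]; have /andP[] := laplace_rep01 xi (rep n) u0.
Qed.

Let le_phi n xi u : (0 <= u)%R -> (iterate n xi u <= phi xi u)%R.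
Proof.
move=> u0; have cv : cvgn (fun n => iterate n xi u) by exact: cvg_phi u0.
by have := nondecreasing_cvgn_le (iterate_nd mw w0 mass1 xi u0) cv; apply.
Qed.

Let phi_rep : laplace_rep phi.
Proof.
(* No mass escapes to infinity: [phi xi e >= exp (- e) >= 1 - e]. *)
apply: (laplace_rep_cvg rep cvg_phi) => xi e e0; exists e => //.
by apply: le_trans (le_phi 0 xi (ltW e0)); have := expR_ge1Dx (- e).
Qed.

Let phi_fixed xi u : (0 <= u)%R -> smooth phi xi u = phi xi u.
Proof.
move=> u0; have h := @smooth_cvg _ _ rep phi_rep cvg_phi xi u u0.
apply: (cvg_unique (@Rhausdorff R) h).
by have := @cvg_phi xi u u0; rewrite -(cvg_shiftS (fun n => iterate n xi u)).
Qed.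

Let phi_slope xi u : (0 < u)%R -> (slope phi xi u <= 1)%R.
Proof.
move=> u0; apply: le_trans (slope1 0 xi u0); rewrite /slope.
by rewrite ler_wpM2r ?invr_ge0 ?(ltW u0)// lerD2l lerN2 le_phi// ltW.
Qed.

Let mean := \int[tau]_xi lmean phi xi.

Let mean_le1 : mean <= 1.
Proof.
have -> : 1 = \int[tau]_xi (cst 1 xi).
  by rewrite integral_cst// [X in _ * X](@probability_setT _ _ _ tau) mule1.
apply: ge0_le_integral => //.
- by move=> xi _; exact: lmean_ge0.
- exact: measurable_lmean.
move=> xi _; apply: (cvge_to_le (@lmean_cvg _ _ _ _ phi_rep xi)).
by apply: nearW => n; rewrite lee_fin phi_slope.
Qed.

(** The uniform bound on the deficits passes to the limit by dominated convergence. The average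
    slope at [u0] is then at least [eps], and slopes bound the mean from below. *)
Let mean_gt0 : 0 < mean.
Proof.
have [u0 [eps [u00 eps0 bnd]]] := rdeficit_iterate_bounded.
have md : (rdeficit tau phi u0 <= 1 - eps)%R.
  rewrite -lee_fin rdeficitE//.
  pose g n xi : \bar R := (1 - slope (iterate n) xi u0)%:E.
  have mg n : measurable_fun [set: X] (g n).
    apply/measurable_EFinP; apply: measurable_funB => //.
    exact: measurable_slope.
  have gcvg xi : g n xi @[n --> \oo] --> (1 - slope phi xi u0)%:E.
    apply: cvg_EFin; first exact: nearW.
    apply: cvgB; first exact: cvg_cst.
    apply: cvgMr_tmp; apply: cvgB; first exact: cvg_cst.
    exact: (@cvg_phi xi u0 (ltW u00)).
  have lim : (fun n => \int[tau]_xi g n xi) @ \oo --> mean_deficit tau phi u0.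
    apply: (@dominated_cvg _ _ _ _ _ measurableT _ _ (cst 1)) => //.
    - by apply: integrable01 => // xi; rewrite ler01 lexx.
    move=> n xi _; rewrite gee0_abs lee_fin ?subr_ge0 ?slope1//.
    by rewrite gerBl slope_ge0.
  apply: (cvge_to_le lim); apply: nearW => n.
  have := bnd n; rewrite -lee_fin (rdeficitE tau (rep n) (@slope1 n))//.
have : (eps <= 1 - rdeficit tau phi u0)%R by lra.
rewrite -lee_fin => h; apply: (@lt_le_trans _ _ eps%:E); first by rewrite lte_fin.
apply: le_trans h _.
rewrite EFinB leeBlDr// rdeficitE// /mean /mean_deficit -ge0_integralD//.
- have -> : 1 = \int[tau]_xi (cst 1 xi).
    by rewrite integral_cst// [X in _ * X](@probability_setT _ _ _ tau) mule1.
  apply: ge0_le_integral => //.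
  + apply: emeasurable_funD; first exact: measurable_lmean.
    apply/measurable_EFinP; apply: measurable_funB => //; exact: measurable_slope.
  move=> xi _; have -> : cst 1 xi = (slope phi xi u0)%:E + (1 - slope phi xi u0)%:E.
    by rewrite -EFinD addrC subrK.
  by apply: leeD => //; exact: slope_le_lmean.
- by move=> xi _; exact: lmean_ge0.
- exact: measurable_lmean.
- by move=> xi _; rewrite lee_fin subr_ge0 phi_slope.
apply/measurable_EFinP; apply: measurable_funB => //; exact: measurable_slope.
Qed.

(* The limit of the iterates has a mean in ]0, 1], hence is rescaled. *)
Lemma exists_fixed_point : exists psi, [/\ laplace_rep psi,
  \int[tau]_xi lmean psi xi = 1
  & forall xi u, (0 <= u)%R -> smooth psi xi u = psi xi u].
Proof.
have mf : mean \is a fin_num.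
  by rewrite ge0_fin_numE ?(ltW mean_gt0)// (le_lt_trans mean_le1)// ltry.
pose c := (fine mean)^-1%R.
have c0 : (0 < c)%R by rewrite invr_gt0 -lte_fin fineK.
exists (fun xi u => phi xi (u * c)%R); split.
- by apply: (laplace_rep_scale (g := id) (c := cst c)) => //= _; exact: ltW.
- under eq_integral do rewrite lmean_scale ?(ltW c0)//.
  rewrite ge0_integralZl ?lee_fin ?(ltW c0)//; last by move=> xi _; exact: lmean_ge0.
    by rewrite -/mean -(fineK mf) -EFinM mulVf// gt_eqF// -lte_fin fineK.
  exact: measurable_lmean.
move=> xi u u0; have uc0 : (0 <= u * c)%R by rewrite mulr_ge0// ltW.
rewrite -(phi_fixed xi uc0) /smooth.
have -> : (fun t => phi (seq_shift xi) (u * c * t)%R) =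
    (fun t => phi (seq_shift xi) (u * t * c)%R).
  by apply/funext => t; rewrite mulrAC.
by [].
Qed.

End nondegeneracy.
End existence.

(** * Uniqueness *)

Section uniqueness.
Context {R : realType} d (Theta : measurableType d)
  dV (V : measurableType dV) (k : R.-pker Theta ~> V) (w : nat -> V -> R).
Hypotheses (mw : forall i, measurable_fun [set: V] (w i))
  (w0 : forall i v, (0 <= w i v)%R)
  (wfin : forall v, exists N, forall i, (N <= i)%N -> w i v = 0%R)
  (mass1 : forall theta, \int[k theta]_v (mass wfin v)%:E = 1).
Local Notation X := (seq_space Theta).
Local Notation mass := (mass wfin).
Local Notation num_weights := (num_weights wfin).
Local Notation smooth := (smooth k w).
Variable tau : probability X R.
Hypothesis tau_iid : iid_law tau.
Implicit Types (phi psi : X -> R -> R) (xi : X) (v : V) (u : R).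
Local Notation nu := (offspring_law k tau).

(** Since [1 - prod_i a_i <= sum_i (1 - a_i)] and the weights have mean mass 1, a linear bound at
    the shifted environment passes to [xi]. *)
Lemma smooth_slope_le psi xi u (l : R) : laplace_rep psi -> (0 < u)%R ->
  (forall t, (0 <= t)%R -> (1 - psi (seq_shift xi) t <= t * l)%R) ->
  (slope (smooth psi) xi u <= l)%R.
Proof.
move=> psi_rep u0 psil.
have l0 : (0 <= l)%R.
  have := psil 1%R ler01; rewrite mul1r; apply: le_trans.
  by have /andP[_] := laplace_rep01 (seq_shift xi) psi_rep (@ler01 R); rewrite subr_ge0.
rewrite -lee_fin (slope_smoothE k mw w0 wfin psi_rep xi u0).
have mM : measurable_fun [set: V] (fun v => (mass v)%:E).
  by apply/measurable_EFinP; exact: measurable_mass.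
have -> : l%:E = \int[k (xi 0%N)]_v (l%:E * (mass v)%:E).
  rewrite ge0_integralZl//; first by rewrite mass1 mule1.
  by move=> v _; rewrite lee_fin mass_ge0.
have b01 v := branch_prod01 mw w0 wfin xi v psi_rep (ltW u0).
apply: ge0_le_integral => //.
- by move=> v _; rewrite lee_fin divr_ge0 ?(ltW u0)// subr_ge0; have /andP[] := b01 v.
- apply/measurable_EFinP; apply: measurable_funM => //; apply: measurable_funB => //.
  exact: (measurable_fun_pair2 xi (measurable_branch_prod mw w0 wfin psi_rep (ltW u0))).
- exact: measurable_funeM.
move=> v _; rewrite -EFinM lee_fin ler_pdivrMr//.
rewrite (branch_prodE wfin); last by rewrite mulr0 laplace_rep0.
have a01 i : (0 <= psi (seq_shift xi) (u * w i v) <= 1)%R.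
  by apply: laplace_rep01 => //; rewrite mulr_ge0// ltW.
have c01 (i : nat) : (0 <= (1 : R) <= 1)%R by rewrite ler01 lexx.
have := prod_sub_le (a := fun=> 1%R) (num_weights v) c01 a01.
rewrite big1// => /(le_trans (ler_norm _)) /le_trans; apply.
have -> : (l * mass v * u = \sum_(i < num_weights v) u * w i v * l)%R.
  by rewrite /mass mulr_sumr mulr_suml; apply: eq_bigr => i _; ring.
apply: ler_sum => i _; have /andP[_ a1] := a01 i.
rewrite ger0_norm ?subr_ge0//; apply: le_trans (psil _ _) _.
  by rewrite mulr_ge0// ltW.
by [].
Qed.

Section solution.
Variable psi : X -> R -> R.
Hypotheses (psi_rep : laplace_rep psi) (psi_mean : \int[tau]_xi lmean psi xi = 1)
  (psi_sol : {ae tau, forall xi, forall u, (0 <= u)%R -> psi xi u = smooth psi xi u}).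

Lemma solution_lmean_shift : {ae tau, forall xi, lmean psi xi <= lmean psi (seq_shift xi)}.
Proof.
apply: filterS psi_sol => xi sol.
have [->|] := eqVneq (lmean psi (seq_shift xi)) +oo; first by rewrite leey.
rewrite -ltey => lt_oo.
have fin_l : lmean psi (seq_shift xi) \is a fin_num by rewrite ge0_fin_numE ?lmean_ge0.
rewrite -(fineK fin_l); apply: (cvge_to_le (@lmean_cvg _ _ _ _ psi_rep xi)).
apply: nearW => n; rewrite lee_fin.
have u0 : (0 < (n.+1%:R^-1 : R))%R by rewrite invr_gt0.
have -> : slope psi xi n.+1%:R^-1 = slope (smooth psi) xi n.+1%:R^-1.
  by rewrite /slope sol// ltW.
apply: smooth_slope_le => // t; rewrite le_eqVlt => /predU1P[<-|t0].
  by rewrite laplace_rep0// mul0r subrr.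
have := slope_le_lmean psi_rep (seq_shift xi) t0.
by rewrite -(fineK fin_l) lee_fin /slope ler_pdivrMr// mulrC.
Qed.

(* The superlevel sets of the mean are invariant, hence trivial. *)
Lemma solution_lmean_le1 : {ae tau, forall xi, lmean psi xi <= 1}.
Proof.
have mL := measurable_lmean psi_rep.
pose A n := [set xi | (1 + n.+1%:R^-1)%:E <= lmean psi xi].
have mA n : measurable (A n).
  by rewrite -[A n]setTI; exact: emeasurable_fun_c_infty.
have A0 n : tau (A n) = 0.
  have [|//|tA] := iid_zero_one tau_iid (mA n).
    by apply: filterS solution_lmean_shift => xi h /le_trans; apply.
  have : (1 + n.+1%:R^-1)%:E <= (1 : \bar R).
    rewrite -psi_mean -[leLHS]mule1 -tA -integral_cst//.
    apply: (@le_trans _ _ (\int[tau]_(xi in A n) lmean psi xi)).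
      apply: ge0_le_integral => //.
      - by move=> xi _; rewrite lee_fin addr_ge0// invr_ge0.
      - exact: measurable_funTS.
    apply: ge0_subset_integral => // xi _; exact: lmean_ge0.
  by rewrite lee_fin gerDl leNgt invr_gt0 ltr0n.
have aeA : {ae tau, forall xi, forall n, ~ A n xi}.
  apply: ae_foralln => n; exists (A n); split => //; first exact: A0.
  by move=> xi /= /contrapT.
apply: filterS aeA => xi nA; rewrite leNgt; apply/negP => l1.
have [n hn] : exists n, (1 + n.+1%:R^-1)%:E <= lmean psi xi.
  case: (lmean psi xi) l1 => [r| |]//; last by exists 0%N; rewrite leey.
  rewrite lte_fin -subr_gt0 => r1; have [n _ hn] := near_infty_natSinv_lt (PosNum r1).
  exists n; rewrite lee_fin -lerBrDl; apply: ltW; exact: (hn n (leqnn n)).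
exact: nA hn.
Qed.

End solution.
End uniqueness.

(** * The distance between two solutions *)

Section slope_distance.
Context {R : realType} d (Theta : measurableType d)
  dV (V : measurableType dV) (k : R.-pker Theta ~> V) (w : nat -> V -> R).
Hypotheses (mw : forall i, measurable_fun [set: V] (w i))
  (w0 : forall i v, (0 <= w i v)%R)
  (wfin : forall v, exists N, forall i, (N <= i)%N -> w i v = 0%R).
Local Notation X := (seq_space Theta).
Local Notation mass := (mass wfin).
Local Notation num_weights := (num_weights wfin).
Local Notation smooth := (smooth k w).
Variable tau : probability X R.
Hypothesis tau_iid : iid_law tau.
Implicit Types (phi psi : X -> R -> R) (xi : X) (v : V) (u : R).
Local Notation nu := (offspring_law k tau).

Definition slope_dist phi psi u : \bar R :=
  \int[tau]_xi `|slope phi xi u - slope psi xi u|%R%:E.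

(** Divided by [u] and not by [u w_i]: this is [w_i] times the distance of the slopes at [u w_i], in
    a form that is meaningful for [w_i = 0]. *)
Definition branch_dist phi psi u i (p : X * V) : R :=
  (`|phi p.1 (u * w i p.2) - psi p.1 (u * w i p.2)| / u)%R.

Definition total_branch_dist phi psi u (p : X * V) : \bar R :=
  (\sum_(i < num_weights p.2) branch_dist phi psi u i p)%R%:E.

Let dist_ge0 phi psi u i p : (0 < u)%R -> (0 <= branch_dist phi psi u i p)%R.
Proof. by move=> u0; rewrite divr_ge0// ltW. Qed.

Let dist_sym phi psi u i p : branch_dist phi psi u i p = branch_dist psi phi u i p.
Proof. by rewrite /branch_dist distrC. Qed.

Let dsum_ge0 phi psi u p : (0 < u)%R -> 0 <= total_branch_dist phi psi u p.
Proof. by move=> u0; rewrite lee_fin; apply: sumr_ge0 => i _; exact: dist_ge0. Qed.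


Section two_functions.
Variables phi psi : X -> R -> R.
Hypotheses (phi_rep : laplace_rep phi) (psi_rep : laplace_rep psi).

Let dist_w0 u i xi v : w i v = 0%R -> branch_dist phi psi u i (xi, v) = 0%R.
Proof. by move=> wi; rewrite /branch_dist/= wi mulr0 !laplace_rep0// subrr normr0 mul0r. Qed.

Let mdist u i : (0 < u)%R -> measurable_fun [set: X * V] (branch_dist phi psi u i).
Proof.
move=> u0.
have mwi : measurable_fun [set: X * V] (fun p => w i p.2).
  exact: measurableT_comp (mw i) measurable_snd.
have uw0 (p : X * V) : (0 <= u * w i p.2)%R by rewrite mulr_ge0// ltW.
apply: measurable_funM => //; apply: measurableT_comp => //.
by apply: measurable_funB; apply: measurable_laplace_comp => //;
  exact: measurable_funM.
Qed.

Let dsumE u p : (0 < u)%R ->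
  total_branch_dist phi psi u p = \sum_(0 <= i <oo) (branch_dist phi psi u i p)%:E.
Proof.
move=> u0; apply/esym/lim_near_cst => //; exists (num_weights p.2) => // n /= Nn.
have tail0 : \sum_(num_weights p.2 <= i < n) (branch_dist phi psi u i p)%:E = 0.
  rewrite big_nat big1// => i /andP[Ni _]; case: p Ni {Nn} => xi v /= Ni.
  by rewrite dist_w0// (weight_eq0 Ni).
by rewrite (big_cat_nat (n := num_weights p.2))//= tail0 adde0 big_mkord sumEFin.
Qed.

Lemma measurable_total_branch_dist u : (0 < u)%R ->
  measurable_fun [set: X * V] (total_branch_dist phi psi u).
Proof.
move=> u0; have -> : total_branch_dist phi psi u =
    (fun p => \sum_(0 <= i <oo) (branch_dist phi psi u i p)%:E).
  by apply/funext => p; rewrite dsumE.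
apply: ge0_emeasurable_sum.
- by move=> i p _ _; rewrite lee_fin dist_ge0.
- by move=> i _; apply/measurable_EFinP; exact: mdist.
Qed.

(** A product of numbers in [0, 1] moves by at most the sum of the moves of its factors. The
    one-sided form avoids subtracting integrals; exchanging [phi] and [psi] gives the other side. *)
Lemma slope_smooth_le xi u : (0 < u)%R ->
  (slope (smooth phi) xi u)%:E <= (slope (smooth psi) xi u)%:E +
    \int[k (xi 0%N)]_v total_branch_dist phi psi u (seq_shift xi, v).
Proof.
move=> u0; have uge0 := ltW u0.
rewrite (slope_smoothE k mw w0 wfin phi_rep xi u0) (slope_smoothE k mw w0 wfin psi_rep xi u0).
pose bp f v := branch_prod w (fun t => f (seq_shift xi) (u * t)%R) v.
have bE f v : laplace_rep f -> bp f v = (\prod_(i < num_weights v) f (seq_shift xi) (u * w i v))%R.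
  by move=> fr; rewrite /bp (branch_prodE wfin)// mulr0 laplace_rep0.
have b01 f v : laplace_rep f -> (0 <= bp f v <= 1)%R.
  by move=> fr; exact: (branch_prod01 mw w0 wfin xi v fr uge0).
have mb f : laplace_rep f -> measurable_fun [set: V] (fun v => ((1 - bp f v) / u)%:E).
  move=> fr; apply/measurable_EFinP; apply: measurable_funM => //; apply: measurable_funB => //.
  exact: (measurable_fun_pair2 xi (measurable_branch_prod mw w0 wfin fr uge0)).
have b0 f v : laplace_rep f -> 0 <= ((1 - bp f v) / u)%:E.
  by move=> fr; rewrite lee_fin divr_ge0// subr_ge0; have /andP[] := b01 f v fr.
have mds : measurable_fun [set: V] (fun v => total_branch_dist phi psi u (seq_shift xi, v)).
  exact: (measurable_fun_pair2 (seq_shift xi) (measurable_total_branch_dist u0)).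
rewrite -ge0_integralD//; first last.
- by move=> v _; exact: dsum_ge0.
- exact: mb.
- by move=> v _; exact: b0.
apply: ge0_le_integral => //.
- by move=> v _; exact: b0.
- exact: mb.
- by apply: emeasurable_funD => //; exact: mb.
move=> v _; rewrite /total_branch_dist -EFinD lee_fin /= /branch_dist/= -mulr_suml -mulrDl.
rewrite ler_wpM2r ?invr_ge0// -/(bp phi v) -/(bp psi v) !bE//.
have a01 f i : laplace_rep f -> (0 <= f (seq_shift xi) (u * w i v) <= 1)%R.
  by move=> fr; apply: laplace_rep01 => //; rewrite mulr_ge0.
have := prod_sub_le (num_weights v) (fun i => a01 psi i psi_rep) (fun i => a01 phi i phi_rep).
move=> /(le_trans (ler_norm _)); set S1 := (\sum_(i < _) _)%R.
have -> : S1 = (\sum_(i < num_weights v) `|phi (seq_shift xi) (u * w i v) -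
    psi (seq_shift xi) (u * w i v)|)%R by apply: eq_bigr => i _; rewrite distrC.
lra.
Qed.

Let branch_dist_mean u (F : R -> R) i v : (0 < u)%R ->
  (forall t, (0 < t)%R -> slope_dist phi psi (u * t)%R <= (F t)%:E) ->
  \int[tau]_xi (branch_dist phi psi u i (xi, v))%:E <= (w i v * F (w i v))%:E.
Proof.
move=> u0 FD; have := w0 i v; rewrite le_eqVlt => /predU1P[wi|wi].
  rewrite -wi mul0r integral0_eq// => xi _; by rewrite dist_w0.
have uw : (0 < u * w i v)%R by exact: mulr_gt0.
have E xi : branch_dist phi psi u i (xi, v) =
    (w i v * `|slope phi xi (u * w i v) - slope psi xi (u * w i v)|)%R.
  rewrite /branch_dist /slope/=; move: (phi xi _) (psi xi _) => a b.
  have -> : ((1 - a) / (u * w i v) - (1 - b) / (u * w i v) = (b - a) / (u * w i v))%R.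
    by ring.
  rewrite normrM normfV (gtr0_norm uw) distrC; move: `|_|%R => N.
  by field; rewrite !gt_eqF.
under eq_integral do rewrite E EFinM.
rewrite ge0_integralZl//.
- by rewrite EFinM lee_pmul2l// FD.
- apply/measurable_EFinP; apply: measurableT_comp => //.
  by apply: measurable_funB; exact: measurable_slope.
- by rewrite lee_fin ltW.
Qed.

Lemma slope_dist_branch u (F : R -> R) : (0 < u)%R ->
  measurable_fun [set: R] F -> (forall t, 0 <= t -> 0 <= F t)%R ->
  (forall t, (0 < t)%R -> slope_dist phi psi (u * t)%R <= (F t)%:E) ->
  \int[tau]_xi \int[k (xi 0%N)]_v total_branch_dist phi psi u (seq_shift xi, v) <= size_bias w nu F.
Proof.
move=> u0 mF F0 FD.
have d0 p : 0 <= total_branch_dist phi psi u p by exact: dsum_ge0.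
rewrite (decoupling k tau_iid (measurable_total_branch_dist u0))//.
apply: ge0_le_integral => //.
- by move=> v _; exact: integral_ge0.
- apply: (@measurable_fun_fubini_tonelli_G _ _ _ _ _ tau (total_branch_dist phi psi u)) => //.
  exact: measurable_total_branch_dist.
- exact: measurable_wsum.
move=> v _; rewrite (wsumE wfin) -sumEFin.
have -> : \int[tau]_xi total_branch_dist phi psi u (xi, v) =
    \int[tau]_xi \sum_(i < num_weights v) (branch_dist phi psi u i (xi, v))%:E.
  by apply: eq_integral => xi _; rewrite sumEFin.
rewrite ge0_integral_sum//.
- by apply: lee_sum => i _; exact: branch_dist_mean.
- move=> i; apply/measurable_EFinP.
  exact: (measurable_fun_pair1 v (mdist i u0)).
- by move=> i xi _; rewrite lee_fin dist_ge0.
Qed.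

End two_functions.

Variables phi psi : X -> R -> R.
Hypotheses (phi_rep : laplace_rep phi) (psi_rep : laplace_rep psi)
  (phi_sol : {ae tau, forall xi, forall u, (0 <= u)%R -> phi xi u = smooth phi xi u})
  (psi_sol : {ae tau, forall xi, forall u, (0 <= u)%R -> psi xi u = smooth psi xi u}).

Lemma slope_dist_step u (F : R -> R) : (0 < u)%R ->
  measurable_fun [set: R] F -> (forall t, 0 <= t -> 0 <= F t)%R ->
  (forall t, (0 < t)%R -> slope_dist phi psi (u * t)%R <= (F t)%:E) ->
  slope_dist phi psi u <= size_bias w nu F.
Proof.
move=> u0 mF F0 FD; apply: le_trans (slope_dist_branch phi_rep psi_rep u0 mF F0 FD).
have mds : measurable_fun [set: X * V] (fun p => total_branch_dist phi psi u (seq_shift p.1, p.2)).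
  apply: (measurableT_comp (measurable_total_branch_dist phi_rep psi_rep u0)).
  apply: measurable_fun_pair => //.
  exact: measurableT_comp (@measurable_seq_shift _ Theta) measurable_fst.
apply: ae_ge0_le_integral => //.
- apply/measurable_EFinP; apply: measurableT_comp => //.
  by apply: measurable_funB; exact: measurable_slope.
- by move=> xi _; apply: integral_ge0 => v _; exact: dsum_ge0.
- apply: (measurable_fun_integral_finite_kernel
    (fun p => total_branch_dist phi psi u (seq_shift p.1, p.2)) (offspring_kernel k)) => //.
  by move=> p; exact: dsum_ge0.
apply: filterS2 phi_sol psi_sol => xi Sphi Spsi _.
have -> : slope phi xi u = slope (smooth phi) xi u by rewrite /slope Sphi// ltW.
have -> : slope psi xi u = slope (smooth psi) xi u by rewrite /slope Spsi// ltW.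
have h1 := slope_smooth_le phi_rep psi_rep xi u0.
have h2 := slope_smooth_le psi_rep phi_rep xi u0.
case: (leP (slope (smooth psi) xi u) (slope (smooth phi) xi u)) => h.
  by rewrite ger0_norm ?subr_ge0// EFinB leeBlDl.
rewrite ltr0_norm ?subr_lt0// opprB EFinB leeBlDl//.
apply: le_trans h2 _; apply: leeD => //; rewrite le_eqVlt; apply/orP; left; apply/eqP.
apply: eq_integral => v _; congr EFin; apply: eq_bigr => i _; exact: dist_sym.
Qed.

End slope_distance.

Section uniqueness_of_solutions.
Context {R : realType} d (Theta : measurableType d)
  dV (V : measurableType dV) (k : R.-pker Theta ~> V) (w : nat -> V -> R).
Hypotheses (mw : forall i, measurable_fun [set: V] (w i))
  (w0 : forall i v, (0 <= w i v)%R)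
  (wfin : forall v, exists N, forall i, (N <= i)%N -> w i v = 0%R)
  (mass1 : forall theta, \int[k theta]_v (mass wfin v)%:E = 1).
Local Notation X := (seq_space Theta).
Local Notation mass := (mass wfin).
Local Notation smooth := (smooth k w).
Variable tau : probability X R.
Hypothesis tau_iid : iid_law tau.
Implicit Types (f phi psi : X -> R -> R) (xi : X) (v : V) (u : R).
Local Notation nu := (offspring_law k tau).

Let mean_slope f u : \bar R := \int[tau]_xi (slope f xi u)%:E.

Section one_solution.
Variable f : X -> R -> R.
Hypotheses (f_rep : laplace_rep f) (f_mean : \int[tau]_xi lmean f xi = 1).

Let mean_slope_ge0 u : (0 < u)%R -> 0 <= mean_slope f u.
Proof. by move=> u0; apply: integral_ge0 => xi _; rewrite lee_fin slope_ge0. Qed.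

Let measurable_eslope u : (0 < u)%R -> measurable_fun [set: X] (fun xi => (slope f xi u)%:E).
Proof. by move=> u0; apply/measurable_EFinP; exact: measurable_slope. Qed.

Let mean_slope_le1 u : (0 < u)%R -> mean_slope f u <= 1.
Proof.
move=> u0; rewrite -f_mean; apply: ge0_le_integral => //.
- by move=> xi _; rewrite lee_fin slope_ge0.
- exact: measurable_eslope.
- exact: measurable_lmean.
- by move=> xi _; exact: slope_le_lmean.
Qed.

Lemma mean_slope_fin u : (0 < u)%R -> mean_slope f u \is a fin_num.
Proof.
move=> u0; rewrite ge0_fin_numE ?mean_slope_ge0//.
by apply: le_lt_trans (mean_slope_le1 u0) _; rewrite ltry.
Qed.

Lemma mean_slope_nincr u t : (0 < u)%R -> (u <= t)%R -> mean_slope f t <= mean_slope f u.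
Proof.
move=> u0 ut; have t0 : (0 < t)%R by exact: lt_le_trans ut.
apply: ge0_le_integral => //; try exact: measurable_eslope.
- by move=> xi _; rewrite lee_fin slope_ge0.
- by move=> xi _; rewrite lee_fin slope_nincr.
Qed.

Lemma mean_slope_cvg1 : mean_slope f n.+1%:R^-1 @[n --> \oo] --> 1.
Proof.
have u0 n : (0 < (n.+1%:R^-1 : R))%R by rewrite invr_gt0.
rewrite -f_mean; apply: (@cvg_monotone_convergence _ _ _ tau setT measurableT
  (fun n xi => (slope f xi n.+1%:R^-1)%:E)).
- by move=> n; exact: measurable_eslope.
- by move=> n xi _; rewrite lee_fin slope_ge0.
- move=> xi _ n m nm; rewrite lee_fin; apply: slope_nincr => //.
  by rewrite lef_pV2 ?posrE// ler_nat.
Qed.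

End one_solution.

Section two_solutions.
Variables phi psi : X -> R -> R.
Hypotheses (phi_rep : laplace_rep phi) (phi_mean : \int[tau]_xi lmean phi xi = 1)
  (phi_sol : {ae tau, forall xi, forall u, (0 <= u)%R -> phi xi u = smooth phi xi u})
  (psi_rep : laplace_rep psi) (psi_mean : \int[tau]_xi lmean psi xi = 1)
  (psi_sol : {ae tau, forall xi, forall u, (0 <= u)%R -> psi xi u = smooth psi xi u}).
Local Notation dist := (slope_dist tau phi psi).

(* For a, b in [0, 1], |a - b| + a + b <= 2. *)
Let dist_le u : (0 < u)%R -> dist u + (mean_slope phi u + mean_slope psi u) <= 2%:E.
Proof.
move=> u0.
have m f : laplace_rep f -> measurable_fun [set: X] (fun xi => (slope f xi u)%:E).
  by move=> fr; apply/measurable_EFinP; exact: measurable_slope.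
have n0 f xi : laplace_rep f -> 0 <= (slope f xi u)%:E.
  by move=> fr; rewrite lee_fin slope_ge0.
have md : measurable_fun [set: X] (fun xi => `|slope phi xi u - slope psi xi u|%R%:E).
  apply/measurable_EFinP; apply: measurableT_comp => //.
  by apply: measurable_funB; exact: measurable_slope.
rewrite /mean_slope -ge0_integralD//; [|by move=> xi _; exact: n0|exact: m|
  by move=> xi _; exact: n0|exact: m].
rewrite -ge0_integralD//; first last.
- by apply: emeasurable_funD; exact: m.
- by move=> xi _; rewrite adde_ge0// n0.
have -> : 2%:E = \int[tau]_xi (cst 2%:E xi).
  by rewrite integral_cst// [X in _ * X](@probability_setT _ _ _ tau) mule1.
apply: ae_ge0_le_integral => //.
- by move=> xi _; rewrite !adde_ge0// n0.
- by apply: emeasurable_funD => //; apply: emeasurable_funD; exact: m.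
- by move=> xi _; rewrite lee_fin.
have le1 f := @solution_lmean_le1 _ _ _ _ _ k w mw w0 wfin mass1 tau tau_iid f.
apply: filterS2 (le1 _ phi_rep phi_mean phi_sol) (le1 _ psi_rep psi_mean psi_sol).
move=> xi lphi lpsi _; rewrite -!EFinD lee_fin.
have := le_trans (slope_le_lmean phi_rep xi u0) lphi; rewrite lee_fin => a1.
have := le_trans (slope_le_lmean psi_rep xi u0) lpsi; rewrite lee_fin => b1.
move: (slope phi xi u) (slope psi xi u) a1 b1 => a b a1 b1.
by case: (leP b a) => h; [rewrite ger0_norm ?subr_ge0//|rewrite ltr0_norm ?subr_lt0//]; lra.
Qed.

Let dist_ge0 u : 0 <= dist u.
Proof. by apply: integral_ge0 => xi _; rewrite lee_fin. Qed.

Let dist_fin u : (0 < u)%R -> dist u \is a fin_num.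
Proof.
move=> u0; rewrite ge0_fin_numE//; apply: (@le_lt_trans _ _ 2%:E); last by rewrite ltry.
apply: le_trans (dist_le u0); rewrite leeDl// adde_ge0//; apply: integral_ge0 => xi _;
  by rewrite lee_fin slope_ge0.
Qed.

Let rdist u : R := fine (dist u).
(** A monotone majorant of the distance. It tends to 0 at 0 because both mean slopes tend to 1,
    which is how the normalization of the two solutions enters. *)
Let excess u : R := (2 - (fine (mean_slope phi u) + fine (mean_slope psi u)))%R.

Let rdist_le u : (0 < u)%R -> (rdist u <= excess u)%R.
Proof.
move=> u0; have := dist_le u0.
rewrite -(fineK (dist_fin u0)) -(fineK (mean_slope_fin phi_rep phi_mean u0)).
by rewrite -(fineK (mean_slope_fin psi_rep psi_mean u0)) -!EFinD lee_fin -lerBrDr.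
Qed.

Let excess_nd u t : (0 < u)%R -> (u <= t)%R -> (excess u <= excess t)%R.
Proof.
move=> u0 ut; have t0 : (0 < t)%R by exact: lt_le_trans ut.
rewrite /excess lerD2l lerN2; apply: lerD; apply: fine_le;
  by [exact: mean_slope_fin|exact: mean_slope_nincr].
Qed.

Let excess_le2 u : (0 < u)%R -> (excess u <= 2)%R.
Proof.
move=> u0; rewrite /excess gerBl; apply: addr_ge0; apply: fine_ge0;
  by apply: integral_ge0 => xi _; rewrite lee_fin slope_ge0.
Qed.

Let excess_small e : (0 < e)%R -> exists2 u, (0 < u)%R & (excess u < e)%R.
Proof.
move=> e0; have : excess n.+1%:R^-1 @[n --> \oo] --> 0%R.
  have -> : (0 = 2 - (1 + 1) :> R)%R by rewrite subrr.
  apply: cvgB; first exact: cvg_cst.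
  by apply: cvgD; apply: fine_cvg; exact: mean_slope_cvg1.
move=> /cvgr_lt /(_ _ e0) [n _ hn]; exists n.+1%:R^-1%R; first by rewrite invr_gt0.
exact: hn (leqnn n).
Qed.

(* The supremum over ]0, u] makes the distance monotone, as the comparison with
   the random walk requires. *)
Let sdist u : R :=
  if (0 < u)%R then sup [set rdist t | t in [set t | (0 < t <= u)%R]] else 0%R.

Let rdist_sdist t u : (0 < t)%R -> (t <= u)%R -> (rdist t <= sdist u)%R.
Proof.
move=> t0 tu; have u0 : (0 < u)%R by exact: lt_le_trans tu.
rewrite /sdist u0; apply: ub_le_sup; last by exists t => //=; rewrite t0.
exists 2%R => _ [s /= /andP[s0 _] <-].
exact: le_trans (rdist_le s0) (excess_le2 s0).
Qed.

Let sdist_le u c : (0 <= c)%R ->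
  (forall t, (0 < t)%R -> (t <= u)%R -> (rdist t <= c)%R) -> (sdist u <= c)%R.
Proof.
move=> c0 h; rewrite /sdist; case: ifPn => // u0; apply: ge_sup.
  by exists (rdist u), u => //=; rewrite u0 lexx.
by move=> _ [t /= /andP[t0 tu] <-]; exact: h.
Qed.

Let sdist_ge0 u : (0 <= sdist u)%R.
Proof.
case: (ltP 0%R u) => u0; last by rewrite /sdist ltNge u0.
by apply: le_trans (rdist_sdist u0 (lexx _)); exact: fine_ge0.
Qed.

Let sdist_nd : {homo sdist : u t / (u <= t)%R}.
Proof.
move=> u t ut; apply: sdist_le => // s s0 su.
by apply: rdist_sdist => //; exact: le_trans ut.
Qed.

Let sdist_cvg0 (u : nat -> R) : (forall n, 0 < u n)%R -> u n @[n --> \oo] --> 0%R ->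
  sdist (u n) @[n --> \oo] --> 0%R.
Proof.
move=> u0 ucvg; apply/cvgrPdist_lt => e e0.
have [t t0 te] := excess_small e0.
move/cvgr_lt : ucvg => /(_ _ t0) [N _ hN]; exists N => // n Nn.
rewrite sub0r normrN ger0_norm//; apply: le_lt_trans te.
have ht : (0 <= excess t)%R by apply: le_trans (rdist_le t0); exact: fine_ge0.
apply: sdist_le => // s s0 su; apply: le_trans (rdist_le s0) _.
by apply: excess_nd => //; apply: le_trans su _; apply: ltW; exact: hN.
Qed.

Let nu_mass : \int[nu]_v (mass v)%:E = 1.
Proof. exact: offspring_law_mass. Qed.

(** The supremum inherits the inequality: for [t <= u] the distance at [t s] is at most
    [sdist (u s)]. *)
Let sdist_step u : (0 < u)%R -> (sdist u)%:E <= size_bias w nu (fun t => sdist (u * t)%R).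
Proof.
move=> u0.
have mF : measurable_fun [set: R] (fun t => sdist (u * t)%R).
  apply: (measurableT_comp (nondecreasing_measurable measurableT sdist_nd)).
  exact: measurable_funM.
set S := size_bias _ _ _.
have S0 : 0 <= S by apply: (size_bias_ge0 w0 wfin) => t _.
have [->|] := eqVneq S +oo; first by rewrite leey.
rewrite -ltey => Slt; have Sf : S \is a fin_num by rewrite ge0_fin_numE.
rewrite -(fineK Sf) lee_fin; apply: sdist_le; first exact: fine_ge0.
move=> t t0 tu; rewrite -lee_fin (fineK Sf) (fineK (dist_fin t0)).
apply: (slope_dist_step mw w0 wfin tau_iid phi_rep psi_rep phi_sol psi_sol t0 mF) => //.
move=> s s0; have ts : (0 < t * s)%R by exact: mulr_gt0.
by rewrite -(fineK (dist_fin ts)) lee_fin; apply: rdist_sdist => //; rewrite ler_wpM2r// ltW.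
Qed.

Variables K lam kap : R.
Hypotheses (K0 : (0 <= K)%R) (SBlogplus : size_bias w nu logplus = lam%:E)
  (SBlneg : size_bias w nu (lneg K) = kap%:E) (drift : (lam < kap)%R).

(** Without error terms, the drift bound multiplies any uniform bound on [sdist] by [q / p < 1]; it
    is iterated from the bound 2. *)
Let sdist_eq0 u : (0 < u)%R -> sdist u = 0%R.
Proof.
have [delta [m [L [p [q [d0 mm [mL lem] [SBq SBp] qp]]]]]] :=
  drift_parameters mw w0 nu_mass K0 SBlogplus SBlneg drift.
have q0 : (0 <= q)%R.
  rewrite -lee_fin -SBq; apply: (size_bias_ge0 w0 wfin) => t _.
  exact: posint_ge0.
have p0 : (0 < p)%R by exact: le_lt_trans qp.
have contract c : (forall t, sdist t <= c)%R -> forall t, (0 < t)%R -> (sdist t <= q / p * c)%R.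
  (* The drift bound concerns the point [exp (s - L delta)], which this [s] makes equal to [t]. *)
  move=> sc t t0; pose s := (ln t + L%:R * delta)%R.
  have main := @drift_bound _ _ _ _ mw w0 wfin nu nu_mass _ _ _ _ _ d0 mm mL lem SBq SBp
    sdist c s 0%R (fun=> 0%R) sdist_nd.
  have st : expR (s - L%:R * delta) = t by rewrite /s addrK lnK.
  rewrite mulrAC ler_pdivlMr// mulrC -st -[leRHS]addr0; apply: main.
  - by move=> r; rewrite sdist_ge0 sc.
  - by apply: sdist_cvg0; [move=> n; exact: expR_gt0|exact: cvg_expR_neg].
  - by move=> j /=; rewrite adde0; apply: sdist_step; exact: expR_gt0.
  - by move=> N; rewrite big1.
have bound n : forall t, (sdist t <= (q / p) ^+ n * 2)%R.
  elim: n => [|n IH] t.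
    rewrite expr0 mul1r; apply: sdist_le => // s s0 _.
    exact: le_trans (rdist_le s0) (excess_le2 s0).
  case: (ltP 0%R t) => t0; first by rewrite exprS -mulrA contract.
  rewrite /sdist ltNge t0 /= mulr_ge0// exprn_ge0// divr_ge0// ltW//.
move=> u0; apply/eqP; rewrite eq_le sdist_ge0 andbT.
have qp1 : (`|q / p| < 1)%R by rewrite ger0_norm ?divr_ge0 ?(ltW p0)// ltr_pdivrMr// mul1r.
have lim : ((q / p) ^+ n * 2)%R @[n --> \oo] --> (0 * 2 : R)%R.
  by apply: cvgMr_tmp; exact: cvg_expr.
rewrite -[leRHS](mul0r 2%R); apply: (cvgr_to_ge lim); apply: nearW => n; exact: bound.
Qed.

Let ae_eq_at u : (0 < u)%R -> {ae tau, forall xi, phi xi u = psi xi u}.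
Proof.
move=> u0; have D0 : dist u = 0.
  apply/eqP; rewrite eq_le dist_ge0 andbT -(fineK (dist_fin u0)) lee_fin.
  by rewrite -(sdist_eq0 u0); exact: rdist_sdist.
have md : measurable_fun [set: X] (fun xi => `|slope phi xi u - slope psi xi u|%R%:E).
  apply/measurable_EFinP; apply: measurableT_comp => //.
  by apply: measurable_funB; exact: measurable_slope.
have mf : measurable_fun [set: X] (fun xi => (slope phi xi u - slope psi xi u)%:E).
  by apply/measurable_EFinP; apply: measurable_funB; exact: measurable_slope.
have /(ae_eq_integral_abs tau measurableT mf) : \int[tau]_xi
    `|(slope phi xi u - slope psi xi u)%:E| = 0 by exact: D0.
apply: filterS => xi /(_ I) [] /eqP; rewrite subr_eq0 /slope => /eqP.
by move=> /(mulIf (invr_neq0 (lt0r_neq0 u0))) /addrI /oppr_inj.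
Qed.

(** The null set of [ae_eq_at] depends on [u]. The positive rationals give a common one, off which
    continuity in [u] extends the equality. *)
Lemma solution_unique :
  {ae tau, forall xi, forall u, (0 <= u)%R -> phi xi u = psi xi u}.
Proof.
have aeq : {ae tau, forall xi, forall a b : nat,
    phi xi (a.+1%:R / b.+1%:R)%R = psi xi (a.+1%:R / b.+1%:R)%R}.
  by apply: ae_foralln => a; apply: ae_foralln => b; apply: ae_eq_at; rewrite divr_gt0.
apply: filterS aeq => xi eq_rat u; rewrite le_eqVlt => /predU1P[<-|u0].
  by rewrite !laplace_rep0.
(* Approximation from above, which keeps the numerator positive as in [eq_rat]. *)
pose r n : R := ((Num.truncn (u * n.+1%:R)).+1%:R / n.+1%:R)%R.
have r0 n : (0 <= r n)%R by rewrite divr_ge0.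
have rcvg : r n @[n --> \oo] --> u.
  apply: (@squeeze_cvgr _ _ _ _ (cst u) (fun n => u + n.+1%:R^-1)%R); first last.
  - rewrite -[X in _ --> X]addr0; apply: cvgD; [exact: cvg_cst|exact: cvg_harmonic].
  - exact: cvg_cst.
  apply: nearW => n; have n0 : (0 < (n.+1%:R : R))%R by rewrite ltr0n.
  have /andP[t1 t2] := truncn_itv (mulr_ge0 (ltW u0) (ltW n0)).
  rewrite /r ler_pdivlMr// (ltW t2) ler_pdivrMr// mulrDl mulVf ?gt_eqF//.
  by rewrite -natr1 lerD2r.
apply: (cvg_unique (@Rhausdorff R) (laplace_rep_cvg_arg phi_rep r0 (ltW u0) rcvg)).
have -> : (fun n => phi xi (r n)) = (fun n => psi xi (r n)).
  by apply/funext => n; exact: eq_rat.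
exact: (laplace_rep_cvg_arg psi_rep r0 (ltW u0) rcvg).
Qed.

End two_solutions.
End uniqueness_of_solutions.

(** * Back to offspring sequences *)

Section integral_off_null.
Import HBNNSimple.
Context d (T : measurableType d) (R : realType) (mu : {measure set T -> \bar R}).
Variable N : set T.
Hypotheses (mN : measurable N) (N0 : mu N = 0).
Implicit Types f g : T -> \bar R.

(* No measurability of [f] is available: the integrals of the statement have
   uncontrolled integrands outside the sequences that are offspring sequences. *)
Let ge0_integral_off_null f g : measurable_fun [set: T] g ->
  (forall x, 0 <= f x) -> (forall x, 0 <= g x) -> (forall x, ~ N x -> f x = g x) ->
  \int[mu]_x f x = \int[mu]_x g x.
Proof.
move=> mg f0 g0 fg.
have restr (h : T -> \bar R) : measurable_fun [set: T] h -> (forall x, 0 <= h x) ->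
    \int[mu]_x h x = \int[mu]_x (h \_ (~` N)) x.
  move=> mh h0; rewrite -integral_mkcond (ge0_negligible_integral mN)//.
  by congr (integral mu _ _); rewrite setTD.
apply/eqP; rewrite eq_le; apply/andP; split.
  (* The integral of [f] is handled as a supremum over simple functions [h <= f]; off the null set
     [N] these are at most [g]. *)
  rewrite ge0_integralTE//; apply: ge_ereal_sup => _ [h /= hf <-].
  have mh : measurable_fun [set: T] (fun x => (h x)%:E) by exact/measurable_EFinP.
  have h0 x : 0 <= (h x)%:E by rewrite lee_fin.
  rewrite -integralT_nnsfun restr//.
  apply: ge0_le_integral => //.
  - by move=> x _; rewrite patchE; case: ifP.
  - by apply/(measurable_restrictT _ _).1 => //; [exact: measurableC|exact: measurable_funTS].
  move=> x _; rewrite patchE; case: ifPn => // /set_mem nN.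
  by rewrite -fg// hf.
rewrite restr// !ge0_integralTE//; last by move=> x; rewrite patchE; case: ifP.
apply: ereal_sup_le => _ [h /= hg <-]; exists h => //= x.
apply: le_trans (hg x) _; rewrite patchE; case: ifPn => [/set_mem nN|_//].
by rewrite fg.
Qed.

(** [f] may take any value on [N], even negative ones, hence the passage through its positive and
    negative parts. *)
Lemma integral_off_null f g : measurable_fun [set: T] g -> (forall x, 0 <= g x) ->
  (forall x, ~ N x -> f x = g x) -> \int[mu]_x f x = \int[mu]_x g x.
Proof.
move=> mg g0 fg; rewrite integralE.
have -> : \int[mu]_x f^\+ x = \int[mu]_x g x.
  apply: ge0_integral_off_null => // x nN.
  by rewrite funeposE fg//; apply/max_idPl.
have -> : \int[mu]_x f^\- x = \int[mu]_x (cst 0 x).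
  apply: ge0_integral_off_null => // x nN.
  by rewrite funenegE fg//; apply/max_idPr; rewrite oppe_le0.
by rewrite integral0 sube0.
Qed.

End integral_off_null.

Section offspring_sequences.
Context {R : realType}.

Lemma measurable_offspring_seq : measurable (@offspring_seq R).
Proof.
have mc i (B : set R) : measurable B -> measurable [set y : seq_space R | B (y i)].
  move=> mB; have := @measurable_seq_coord _ R i measurableT B mB.
  by rewrite setTI.
have -> : @offspring_seq R =
    (\bigcap_i [set y : seq_space R | `[0%R, +oo[%classic (y i)]) `&`
    \bigcup_N \bigcap_(i in [set i | (N <= i)%N]) [set y : seq_space R | [set 0%R] (y i)].
  apply/seteqP; split => y /=.
    move=> [y0 [N _ yN]]; split; first by move=> i _ /=; rewrite in_itv/= y0.
    by exists N => // i /= Ni; exact: yN.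
  move=> [y0 [N _ yN]]; split.
    by move=> i; have := y0 i I; rewrite /= in_itv/= andbT.
  by exists N => // i Ni; exact: yN.
apply: measurableI; first by apply: bigcap_measurable => // i _; exact: mc.
apply: bigcup_measurable => N _; apply: bigcap_measurable => [|i _].
  by exists N => /=.
exact: mc.
Qed.

End offspring_sequences.

Section drift_truncation.
Context {R : realType} dV (V : measurableType dV) (w : nat -> V -> R).
Hypotheses (mw : forall i, measurable_fun [set: V] (w i))
  (w0 : forall i v, (0 <= w i v)%R)
  (wfin : forall v, exists N, forall i, (N <= i)%N -> w i v = 0%R).
Variables (nu : probability V R).
Hypothesis nu_mass : \int[nu]_v (mass wfin v)%:E = 1.
Local Notation num_weights := (num_weights wfin).

Definition logminus (t : R) : R := (Num.max 0 (- ln t))%R.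

Lemma logminus_ge0 t : (0 <= logminus t)%R.
Proof. by rewrite le_max lexx. Qed.

Lemma logplus_ge0 (t : R) : (0 <= logplus t)%R.
Proof. by rewrite le_max lexx. Qed.

Lemma measurable_logminus : measurable_fun [set: R] logminus.
Proof. by apply: measurable_maxr => //; exact: measurableT_comp. Qed.

Lemma lnE_logplus (t : R) : (ln t = logplus t - logminus t)%R.
Proof.
rewrite /logplus /logminus; case: (lerP 0 (ln t))%R => h.
  by rewrite max_l ?oppr_le0// subr0.
by rewrite max_r ?sub0r ?opprK// oppr_ge0 ltW.
Qed.

Definition wlog v : R := (\sum_(i < num_weights v) w i v * ln (w i v))%R.

Lemma measurable_wlog : measurable_fun [set: V] wlog.
Proof.
have fin f v : wsum w f v \is a fin_num by rewrite (wsumE wfin).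
have -> : wlog = (fun v => fine (wsum w logplus v) - fine (wsum w logminus v))%R.
  apply/funext => v; rewrite !(wsumE wfin)/= -sumrB; apply: eq_bigr => i _.
  by rewrite lnE_logplus mulrBr.
apply: measurable_funB; apply: measurableT_comp => //.
- by apply: measurable_wsum => // [|t _]; [exact: measurable_logplus|exact: logplus_ge0].
- by apply: measurable_wsum => // [|t _]; [exact: measurable_logminus|exact: logminus_ge0].
Qed.

Lemma lneg_cvg t : lneg n%:R t @[n --> \oo] --> logminus t.
Proof.
apply: cvg_near_cst.
exists (Num.truncn (logminus t)).+1 => // m /= hm; rewrite /lneg -/(logminus t) min_r//.
have /andP[_ h] := truncn_itv (logminus_ge0 t).
by apply: le_trans (ltW h) _; rewrite ler_nat.
Qed.

Lemma size_bias_lneg_cvg :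
  size_bias w nu (lneg n%:R) @[n --> \oo] --> size_bias w nu logminus.
Proof.
have l0 n t : (0 <= lneg (n%:R : R) t)%R.
  by rewrite le_min ler0n logminus_ge0.
have lim v : wsum w (lneg n%:R) v @[n --> \oo] --> wsum w logminus v.
  rewrite (wsumE wfin); under eq_fun do rewrite (wsumE wfin).
  apply: cvg_EFin; first exact: nearW.
  apply: (@cvg_ord_sum _ (fun i n => w i v * lneg n%:R (w i v))%R
    (fun i => w i v * logminus (w i v))%R) => i.
  by apply: cvgMl_tmp; exact: lneg_cvg.
have -> : size_bias w nu logminus = \int[nu]_v limn (fun n => wsum w (lneg n%:R) v).
  by apply: eq_integral => v _; apply/esym/cvg_lim => //; exact: lim.
apply: (@cvg_monotone_convergence _ _ _ nu setT measurableT
  (fun n v => wsum w (lneg n%:R) v)).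
- by move=> n; apply: measurable_wsum => //; exact: measurable_lneg.
- by move=> n v _; apply: (wsum_ge0 w0 wfin) => t _.
move=> v _ n m nm; rewrite !(wsumE wfin) lee_fin; apply: ler_sum => i _.
rewrite ler_wpM2l// /lneg le_min !ge_min lexx orbT andbT.
by rewrite ler_nat nm.
Qed.

(* With S = wlog, [S^+ + logminus = S^- + logplus] after size biasing. *)
Lemma drift_truncation (lam : R) : size_bias w nu logplus = lam%:E ->
  \int[nu]_v (Num.max (wlog v) 0)%R%:E - \int[nu]_v (Num.max (- wlog v) 0)%R%:E < 0 ->
  exists K kap, [/\ (0 <= K)%R, size_bias w nu (lneg K) = kap%:E & (lam < kap)%R].
Proof.
move=> SBp drift.
have mlog := measurable_wlog.
set I1 := \int[nu]_v _ in drift; set I2 := \int[nu]_v _ in drift.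
have m1 : measurable_fun [set: V] (fun v => (Num.max (wlog v) 0)%R%:E).
  by apply/measurable_EFinP; apply: measurable_maxr.
have m2 : measurable_fun [set: V] (fun v => (Num.max (- wlog v) 0)%R%:E).
  by apply/measurable_EFinP; apply: measurable_maxr => //; exact: measurableT_comp.
have mp : measurable_fun [set: V] (wsum w logplus).
  by apply: measurable_wsum => // [|t _]; [exact: measurable_logplus|exact: logplus_ge0].
have mm : measurable_fun [set: V] (wsum w logminus).
  by apply: measurable_wsum => // [|t _]; [exact: measurable_logminus|exact: logminus_ge0].
have p0 v : 0 <= wsum w logplus v by apply: (wsum_ge0 w0 wfin) => t _; exact: logplus_ge0.
have n0 v : 0 <= wsum w logminus v by apply: (wsum_ge0 w0 wfin) => t _; exact: logminus_ge0.
have c0 (a : R) : 0 <= (Num.max a 0)%R%:E by rewrite lee_fin le_max lexx orbT.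
have balance : I1 + size_bias w nu logminus = I2 + lam%:E.
  rewrite -SBp /I1 /I2 /size_bias.
  rewrite -(ge0_integralD nu measurableT (fun v _ => c0 _) m1 (fun v _ => n0 v) mm).
  rewrite -(ge0_integralD nu measurableT (fun v _ => c0 _) m2 (fun v _ => p0 v) mp).
  apply: eq_integral => v _; rewrite !(wsumE wfin) -!EFinD; congr EFin.
  have : wlog v = (\sum_(i < num_weights v) w i v * logplus (w i v) -
      \sum_(i < num_weights v) w i v * logminus (w i v))%R.
    by rewrite -sumrB; apply: eq_bigr => i _; rewrite lnE_logplus mulrBr.
  move: (wlog v) (\sum_(i < _) _)%R (\sum_(i < _) _)%R => s b a ->.
  have /orP[h|h] := le_total (a - b)%R 0%R.
    by rewrite (max_r h) max_l ?oppr_ge0//; ring.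
  by rewrite (max_l h) max_r ?oppr_le0//; ring.
(* [S^+] is at most the sum of the [w_i log^+ w_i], whose mean is [lam]. The negative difference is
   therefore not an artefact of [+oo - +oo = -oo]; [I2] may still be infinite. *)
have I1fin : I1 \is a fin_num.
  rewrite ge0_fin_numE; last by apply: integral_ge0 => v _; exact: c0.
  apply: (@le_lt_trans _ _ lam%:E); last by rewrite ltry.
  rewrite -SBp; apply: ge0_le_integral => //.
  move=> v _; rewrite (wsumE wfin) lee_fin ge_max; apply/andP; split; last first.
    by apply: sumr_ge0 => i _; rewrite mulr_ge0// logplus_ge0.
  by apply: ler_sum => i _; rewrite ler_wpM2l// le_max lexx orbT.
have lamlt : lam%:E < size_bias w nu logminus.
  have I2ge0 : 0 <= I2 by apply: integral_ge0 => v _; exact: c0.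
  have SBm0 : 0 <= size_bias w nu logminus.
    by apply: (size_bias_ge0 w0 wfin) => t _; exact: logminus_ge0.
  move: drift balance I2ge0 SBm0; rewrite -(fineK I1fin).
  move: (size_bias w nu logminus) I2 (fine I1) => [s| |] [i| |] j //=; rewrite ?ltry//.
  by rewrite -EFinB -!EFinD !lte_fin => h [] h2 _ _; lra.
have [n lamn] : exists n, lam%:E < size_bias w nu (lneg n%:R).
  apply/not_existsP => H; move: lamlt; rewrite ltNge => /negP; apply.
  apply: (cvge_to_le size_bias_lneg_cvg); apply: nearW => n.
  by rewrite leNgt; apply/negP; exact: H.
have l0 t : (0 <= lneg (n%:R : R) t)%R by rewrite le_min ler0n logminus_ge0.
have f : size_bias w nu (lneg n%:R) \is a fin_num.
  rewrite ge0_fin_numE; last by apply: (size_bias_ge0 w0 wfin) => t _.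
  apply: (@le_lt_trans _ _ (size_bias w nu (cst n%:R))).
    apply: (size_bias_le mw w0 wfin) => //; first exact: measurable_lneg.
    by move=> t _; rewrite ge_min lexx.
  by rewrite (size_bias_cst mw w0 nu_mass)// ltry.
exists n%:R, (fine (size_bias w nu (lneg n%:R))); split => //; first by rewrite fineK.
by rewrite -lte_fin fineK.
Qed.

End drift_truncation.

Lemma ker_setC d d' (T : measurableType d) (T' : measurableType d') (R : realType)
    (k : R.-pker T ~> T') x (A : set T') : measurable A -> k x A = 1 -> k x (~` A) = 0.
Proof.
move=> mA kA; have h : k x A + k x (~` A) = 1.
  rewrite -[RHS](@prob_kernel _ _ _ _ _ k x) -(setUv A) measureU//.
  - exact: measurableC.
  - exact: setICr.
move: h; rewrite kA; case: (k x _) => [r| |]//.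
by rewrite -EFinD => -[] /eqP; rewrite -subr_eq0 addrAC subrr add0r => /eqP ->.
Qed.

(** * Weights of mean one in every environment *)

Section offspring_weights.
Context {R : realType} d (Theta : measurableType d).
Variable eta : R.-pker Theta ~> seq_space R.
Hypothesis eta_offspring : forall theta, eta theta (@offspring_seq R) = 1.
Local Notation V := (Theta * seq_space R)%type.

(** Equal to [total_mass] on offspring sequences, nonnegative and measurable on all sequences. *)
Let pos_mass (y : seq_space R) : \bar R := \sum_(0 <= i <oo) (Num.max 0%R (y i))%:E.

Let pos_mass_ge0 y : 0 <= pos_mass y.
Proof. by apply: nneseries_ge0 => i _ _; rewrite lee_fin le_max lexx. Qed.

Let measurable_pos_mass : measurable_fun [set: seq_space R] pos_mass.
Proof.
apply: ge0_emeasurable_sum => [i y _ _|i _]; first by rewrite lee_fin le_max lexx.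
apply/measurable_EFinP; apply: measurable_maxr => //.
exact: measurable_seq_coord.
Qed.

Definition normalized : set Theta := [set theta | \int[eta theta]_y pos_mass y = 1].

Lemma measurable_normalized : measurable normalized.
Proof.
have m : measurable_fun [set: Theta] (fun theta => \int[eta theta]_y pos_mass y).
  exact: (measurable_fun_integral_kernel (measurable_kernel eta) pos_mass_ge0
    measurable_pos_mass).
rewrite -[normalized]setTI; exact: (m measurableT _ (emeasurable_set1 1)).
Qed.

Definition regular : set V := [set p | normalized p.1 /\ offspring_seq p.2].

Lemma measurable_regular : measurable regular.
Proof.
have -> : regular = normalized `*` @offspring_seq R by [].
by apply: measurableX; [exact: measurable_normalized|exact: measurable_offspring_seq].
Qed.

(* Off the regular set the offspring is replaced by one child of weight 1, so
   that the mean one condition holds for every environment. *)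
Definition pweight i (p : V) : R := if p \in regular then p.2 i else (i == 0%N)%:R.

Lemma measurable_pweight i : measurable_fun [set: V] (pweight i).
Proof.
apply: measurable_fun_ifT => //.
- apply: (measurable_fun_bool true); rewrite setTI.
  rewrite (_ : _ @^-1` _ = regular); first exact: measurable_regular.
  by apply/seteqP; split => p /=; [move/set_mem|move/mem_set].
- exact: (measurableT_comp (@measurable_seq_coord _ R i) measurable_snd).
Qed.

Lemma pweight_ge0 i p : (0 <= pweight i p)%R.
Proof.
rewrite /pweight; case: ifPn => [/set_mem [_ [y0 _]]|_]; first exact: y0.
by case: (i == 0%N).
Qed.

Lemma pweightE i p : regular p -> pweight i p = p.2 i.
Proof. by move=> rp; rewrite /pweight mem_set. Qed.

Lemma pweight_irregular i p : ~ regular p -> pweight i p = (i == 0%N)%:R.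
Proof. by move=> rp; rewrite /pweight ifN//; apply/negP => /set_mem. Qed.

Lemma pweight_fin p : exists N, forall i, (N <= i)%N -> pweight i p = 0%R.
Proof.
have [rp|nrp] := pselect (regular p).
  have [_ [_ [N _ yN]]] := rp.
  by exists N => i Ni; rewrite pweightE//; exact: yN.
by exists 1%N => -[|i]// _; rewrite pweight_irregular.
Qed.

(** The environment is kept next to the offspring because [pweight] has to see whether it is
    exceptional. *)
Definition offspring_pair : R.-pker Theta ~> V :=
  mkimage eta (@measurable_id _ Theta setT) (@measurable_id _ V setT).

Lemma pweight_series p (f : R -> R) : regular p ->
  \sum_(0 <= i <oo) (p.2 i * f (p.2 i))%:E = wsum pweight f p.
Proof. by move=> rp; apply: eq_eseriesr => i _; rewrite pweightE. Qed.

Lemma pweight_mass p : regular p -> total_mass p.2 = (mass pweight_fin p)%:E.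
Proof.
move=> rp; rewrite -[mass _ p]mul1r -(wsum_cst _ 1%R) -pweight_series//.
by apply: eq_eseriesr => i _; rewrite mulr1.
Qed.

Section annealed_integrals.
Context d' (Omega : measurableType d') (tau : probability (seq_space Theta) R).
Variables (P : R.-pker (seq_space Theta) ~> Omega) (Y0 : {mfun Omega >-> seq_space R}).
Local Notation X := (seq_space Theta).
Hypotheses (Y0_law : forall (xi : X) (A : set (seq_space R)), measurable A ->
    P xi (Y0 @^-1` A) = eta (xi 0%N) A)
  (mean_one : {ae tau, forall xi, \int[P xi]_w total_mass (Y0 w) = 1}).

Let not_offspring theta : eta theta (~` @offspring_seq R) = 0.
Proof. by apply: ker_setC => //; exact: measurable_offspring_seq. Qed.

Let integral_Y0 xi (F G : seq_space R -> \bar R) : measurable_fun [set: seq_space R] G ->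
  (forall y, 0 <= G y) -> (forall y, offspring_seq y -> F y = G y) ->
  \int[P xi]_w F (Y0 w) = \int[eta (xi 0%N)]_y G y.
Proof.
move=> mG G0 FG; have mO := @measurable_offspring_seq R.
rewrite (@integral_off_null _ _ _ (P xi) (Y0 @^-1` (~` @offspring_seq R)) _ _
  (fun w => F (Y0 w)) (fun w => G (Y0 w))).
- have := ge0_integral_pushforward (@measurable_funPT _ _ _ _ Y0) (P xi) measurableT mG
    (fun y _ => G0 y).
  rewrite preimage_setT => <-; apply: eq_measure_integral => A mA _.
  exact: Y0_law.
- rewrite -[X in measurable X]setTI; apply: (@measurable_funPT _ _ _ _ Y0) => //.
  exact: measurableC.
- by rewrite Y0_law; [exact: not_offspring|exact: measurableC].
- exact: measurableT_comp.
- by move=> w; exact: G0.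
- by move=> w /contrapT h; exact: FG.
Qed.

Lemma ae_normalized : {ae tau, forall xi, normalized (xi 0%N)}.
Proof.
apply: filterS mean_one => xi m1; rewrite /normalized/= -m1; apply/esym.
apply: integral_Y0 => // y [y0 _].
by apply: eq_eseriesr => i _; rewrite max_r.
Qed.

Lemma integral_offspring_pair theta (G : V -> \bar R) : measurable_fun [set: V] G ->
  (forall p, 0 <= G p) -> \int[offspring_pair theta]_p G p = \int[eta theta]_y G (theta, y).
Proof. exact: integral_kimage. Qed.

Lemma integral_Y0_pair xi (F : seq_space R -> \bar R) (G : V -> \bar R) :
  normalized (xi 0%N) -> measurable_fun [set: V] G -> (forall p, 0 <= G p) ->
  (forall p, regular p -> F p.2 = G p) ->
  \int[P xi]_w F (Y0 w) = \int[offspring_pair (xi 0%N)]_p G p.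
Proof.
move=> nxi mG G0 FG; rewrite integral_offspring_pair//.
apply: integral_Y0 => // [|y oy]; first exact: (measurable_fun_pair2 (xi 0%N) mG).
exact: FG (xi 0%N, y) _.
Qed.

Lemma mass_pweight theta :
  \int[offspring_pair theta]_p (mass pweight_fin p)%:E = 1.
Proof.
have mM : measurable_fun [set: V] (fun p => (mass pweight_fin p)%:E).
  by apply/measurable_EFinP; exact: (measurable_mass measurable_pweight pweight_ge0).
have M0 p : 0 <= (mass pweight_fin p)%:E by rewrite lee_fin mass_ge0//; exact: pweight_ge0.
rewrite integral_offspring_pair//.
have [n|n] := pselect (normalized theta).
  rewrite -[RHS]n; apply/esym.
  apply: (@integral_off_null _ _ _ (eta theta) (~` @offspring_seq R)).
  - by apply: measurableC; exact: measurable_offspring_seq.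
  - exact: not_offspring.
  - exact: (measurable_fun_pair2 theta mM).
  - by move=> y; exact: M0.
  move=> y /contrapT oy; have rp : regular (theta, y) by [].
  rewrite -(pweight_mass rp); apply: eq_eseriesr => i _ /=; rewrite max_r//.
  by case: oy.
have M1 y : (mass pweight_fin (theta, y))%:E = cst 1 y.
  have w1 i : pweight i (theta, y) = (i == 0%N)%:R.
    by rewrite pweight_irregular// => -[].
  rewrite /mass; have := weight_eq0 (wfin := pweight_fin) (v := (theta, y)) (i := 0%N).
  case: (num_weights _ _) => [/(_ isT)/eqP|N _]; first by rewrite w1 oner_eq0.
  by rewrite big_ord_recl/= w1 big1 ?addr0// => i _; rewrite w1.
under eq_integral do rewrite M1.
by rewrite integral_cst// prob_kernel mule1.
Qed.

Local Notation nu := (offspring_law offspring_pair tau).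

Lemma annealed_Y0 (F : seq_space R -> \bar R) (G : V -> \bar R) :
  measurable_fun [set: V] G -> (forall p, 0 <= G p) ->
  (forall p, regular p -> F p.2 = G p) ->
  \int[tau]_xi \int[P xi]_w F (Y0 w) = \int[nu]_p G p.
Proof.
move=> mG G0 FG; rewrite integral_offspring_law//.
have mN : measurable (~` [set xi : X | normalized (xi 0%N)]).
  apply: measurableC; rewrite -[X in measurable X]setTI.
  by apply: (@measurable_seq_coord _ Theta 0%N) => //; exact: measurable_normalized.
apply: (@integral_off_null _ _ _ tau (~` [set xi : X | normalized (xi 0%N)])) => //.
- by apply: measure_negligible => //; exact: ae_normalized.
- exact: (measurable_fun_integral_kernel (measurable_kernel (offspring_kernel offspring_pair))).
- by move=> xi; exact: integral_ge0.
by move=> xi /contrapT nxi; exact: integral_Y0_pair.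
Qed.

(** The two iterated integrals in [annealed] are transferred separately, and [F] has to be
    identified on the regular set only. *)
Lemma annealed_weights (F : seq_space R -> \bar R) (Gp Gn : V -> \bar R) :
  measurable_fun [set: V] Gp -> (forall p, 0 <= Gp p) ->
  measurable_fun [set: V] Gn -> (forall p, 0 <= Gn p) ->
  (forall p, regular p -> maxe (F p.2) 0 = Gp p) ->
  (forall p, regular p -> maxe (- F p.2) 0 = Gn p) ->
  annealed tau P (fun _ w => F (Y0 w)) = \int[nu]_p Gp p - \int[nu]_p Gn p.
Proof.
move=> mp p0 mn n0 Fp Fn; rewrite /annealed.
rewrite -(annealed_Y0 (F := fun y => maxe (F y) 0) mp p0 Fp).
rewrite -(annealed_Y0 (F := fun y => maxe (- F y) 0) mn n0 Fn).
have integral2_eq (f g : X -> Omega -> \bar R) : (forall xi w, f xi w = g xi w) ->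
    \int[tau]_xi \int[P xi]_w f xi w = \int[tau]_xi \int[P xi]_w g xi w.
  by move=> fg; apply: eq_integral => xi _; apply: eq_integral => w _.
apply: (congr2 (fun a b : \bar R => a - b)); apply: integral2_eq => xi w.
- exact: funeposE.
- exact: funenegE.
Qed.

End annealed_integrals.

End offspring_weights.

(** * The class, the moments and the equation in terms of representations *)

Section laplace_class_representation.
Context {R : realType} d d' (Theta : measurableType d) (Omega : measurableType d').
Variables (tau : probability (seq_space Theta) R) (P : R.-pker (seq_space Theta) ~> Omega).
Local Notation X := (seq_space Theta).
Implicit Types phi : X -> R -> R.

Let annealed_cst (m : X -> \bar R) : (forall xi, 0 <= m xi) ->
  annealed tau P (fun xi _ => m xi) = \int[tau]_xi m xi.
Proof.
move=> m0; have E xi (c : \bar R) : \int[P xi]_w (cst c w) = c.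
  by rewrite integral_cst// prob_kernel mule1.
have Ep : \int[tau]_xi \int[P xi]_w (cst (m xi))^\+ w = \int[tau]_xi m xi.
  apply: eq_integral => xi _; rewrite -[RHS](E xi); apply: eq_integral => w _.
  by rewrite funeposE /= max_l.
have En : \int[tau]_xi \int[P xi]_w (cst (m xi))^\- w = 0.
  apply: integral0_eq => xi _; apply: integral0_eq => w _.
  by rewrite funenegE /= max_r// oppe_le0.
by rewrite /annealed Ep En sube0.
Qed.

Lemma laplace_class_rep (c : R) phi : laplace_class tau P c phi ->
  laplace_rep phi /\ \int[tau]_xi lmean phi xi = c%:E.
Proof.
move=> [mu [mu0 mu_mean phiE]].
(* The laws live on the half-line but the kernel on the whole line: [max x 0] is nonnegative
   everywhere and equals [x] almost surely. *)
have mpos : measurable_fun [set: X * R] (fun p => Num.max p.2 0%R).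
  by apply: measurable_maxr.
have pos0 (p : X * R) : (0 <= Num.max p.2 0)%R by rewrite le_max lexx orbT.
have half xi (g : R -> R) : measurable_fun [set: R] g ->
    (forall x, (0 <= g x)%R) ->
    \int[mu xi]_(x in `[0%R, +oo[%classic) (g x)%:E =
    \int[mu xi]_x (g (Num.max x 0%R))%:E.
  move=> mg g0; rewrite integral_mkcond.
  apply: (@integral_off_null _ _ _ (mu xi) (~` `[0%R, +oo[%classic)).
  - by apply: measurableC.
  - by apply: ker_setC; [exact: measurable_itv|exact: mu0].
  - apply/measurable_EFinP; apply: (measurableT_comp mg); by apply: measurable_maxr.
  - by move=> x; rewrite lee_fin.
  move=> x /contrapT x0; rewrite patchE mem_set//.
  by move: x0; rewrite /= in_itv/= andbT => /max_l ->.
have phiE' xi u : (0 <= u)%R -> (phi xi u)%:E =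
    \int[mu xi]_x (expR (- (u * Num.max (xi, x).2 0)))%:E.
  move=> u0; rewrite (phiE _ _ u0) (half xi (fun x => expR (- (u * x))))//.
  by apply: measurableT_comp => //; apply: measurableT_comp => //; exact: measurable_funM.
split; first exact: (laplace_rep_kernel mpos pos0 phiE').
have mean xi : lmean phi xi = \int[mu xi]_(x in `[0%R, +oo[%classic) x%:E.
  rewrite (lmean_kernel mpos pos0 phiE') /=.
  transitivity (\int[mu xi]_(x in `[0%R, +oo[%classic) (Num.max x 0)%R%:E).
    rewrite (half xi (fun x => Num.max x 0)%R).
    - by apply: eq_integral => x _; rewrite -maxA maxxx.
    - by apply: measurable_maxr.
    - by move=> x; rewrite le_max lexx orbT.
  by apply: eq_integral => x; rewrite inE/= in_itv/= andbT => /max_l ->.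
rewrite -mu_mean annealed_cst; first by apply: eq_integral => xi _; rewrite mean.
by move=> xi; rewrite -mean; apply: lmean_ge0; exact: (laplace_rep_kernel mpos pos0 phiE').
Qed.

Lemma laplace_rep_class (c : R) phi : laplace_rep phi ->
  \int[tau]_xi lmean phi xi = c%:E -> laplace_class tau P c phi.
Proof.
move=> phi_rep phi_mean; have [Z [mZ Z0 phiE]] := phi_rep.
pose mu : R.-pker X ~> R := mkimage (kcst unif) (@measurable_id _ X setT) mZ.
have muE xi (g : R -> R) : measurable_fun [set: R] g -> (forall x, 0 <= x -> 0 <= g x)%R ->
    \int[mu xi]_(x in `[0%R, +oo[%classic) (g x)%:E = \int[unif]_s (g (Z (xi, s)))%:E.
  move=> mg g0; rewrite integral_mkcond /mu integral_kimage.
  - by apply: eq_integral => s _; rewrite patchE mem_set//= in_itv/= Z0.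
  - apply/(measurable_restrictT _ _).1 => //.
    by apply: measurable_funTS; exact/measurable_EFinP.
  - move=> x; rewrite patchE; case: ifPn => // /set_mem.
    by rewrite /= in_itv/= andbT => x0; rewrite lee_fin g0.
have mean xi : \int[mu xi]_(x in `[0%R, +oo[%classic) x%:E = lmean phi xi.
  by rewrite (muE xi id)// (lmean_kernel (k := kcst unif) mZ Z0 phiE).
exists mu; split.
- move=> xi; rewrite /mu /mkimage/= /kimage /pushforward/=.
  rewrite (_ : _ @^-1` _ = setT); first exact: probability_setT.
  by apply/seteqP; split => s //= _; rewrite in_itv/= Z0.
- rewrite annealed_cst; first by rewrite -phi_mean; apply: eq_integral => xi _; rewrite mean.
  by move=> xi; rewrite mean lmean_ge0.
- move=> xi u u0; rewrite (phiE _ _ u0) (muE xi (fun x => expR (- (u * x))))//.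
  by apply: measurableT_comp => //; apply: measurableT_comp => //; exact: measurable_funM.
Qed.

End laplace_class_representation.

Section moments.
Context {R : realType} d d' (Theta : measurableType d) (Omega : measurableType d').
Variables (tau : probability (seq_space Theta) R) (P : R.-pker (seq_space Theta) ~> Omega).
Variables (eta : R.-pker Theta ~> seq_space R) (Y0 : {mfun Omega >-> seq_space R}).
Local Notation X := (seq_space Theta).
Hypotheses (eta_offspring : forall theta, eta theta (@offspring_seq R) = 1)
  (Y0_law : forall (xi : X) (A : set (seq_space R)), measurable A ->
    P xi (Y0 @^-1` A) = eta (xi 0%N) A)
  (mean_one : {ae tau, forall xi, \int[P xi]_w total_mass (Y0 w) = 1}).
Local Notation w := (pweight eta).
Local Notation wfin := (pweight_fin eta).
Local Notation k := (offspring_pair eta).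
Local Notation nu := (offspring_law k tau).
Let mw := measurable_pweight eta.
Let w0 := pweight_ge0 eta.
Let mass1 := mass_pweight eta_offspring.
Let nu_mass : \int[nu]_v (mass wfin v)%:E = 1 := offspring_law_mass mw w0 mass1 tau.

(** [log^+ <= 1 + (log^+)^2], and the size-biased law has mass 1. *)
Lemma size_bias_logplus_fin :
  annealed tau P (fun _ w => sum_ylogplus2 (Y0 w)) < +oo ->
  exists lam, size_bias w nu logplus = lam%:E.
Proof.
have m2 : measurable_fun [set: R] (fun t : R => logplus t ^+ 2)%R.
  by apply: measurable_funX; exact: measurable_logplus.
have p2 (t : R) : (0 <= logplus t ^+ 2)%R by exact: sqr_ge0.
rewrite (annealed_weights eta_offspring Y0_law mean_one
  (Gp := wsum w (fun t => logplus t ^+ 2)%R) (Gn := cst 0)) => [fin|||||p rp|p rp] //.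
- exists (fine (size_bias w nu logplus)); rewrite fineK// ge0_fin_numE; last first.
    by apply: (size_bias_ge0 w0 wfin) => t _; exact: logplus_ge0.
  apply: (@le_lt_trans _ _ (size_bias w nu (fun t => 1 + logplus t ^+ 2)%R)).
    apply: (size_bias_le mw w0 wfin).
    + exact: measurable_logplus.
    + exact: measurable_funD.
    + by move=> t _; exact: logplus_ge0.
    + by move=> t _; have := sqr_ge0 (logplus t - 1)%R; have := logplus_ge0 t; nra.
  rewrite (size_biasD mw w0 wfin nu (f := cst 1%R))//.
  rewrite (size_bias_cst mw w0 nu_mass)// lte_add_pinfty ?ltry//.
  by move: fin; rewrite integral0 sube0.
- exact: measurable_wsum.
- by move=> p; apply: (wsum_ge0 w0 wfin).
- rewrite /sum_ylogplus2 (pweight_series (fun t => logplus t ^+ 2)%R rp) max_l//.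
  by apply: (wsum_ge0 w0 wfin).
- rewrite /sum_ylogplus2 (pweight_series (fun t => logplus t ^+ 2)%R rp) max_r// oppe_le0.
  by apply: (wsum_ge0 w0 wfin).
Qed.

Lemma mass_logplus_fin :
  annealed tau P (fun _ w => mass_abslog_mass (Y0 w)) < +oo ->
  \int[nu]_v (mass wfin v * logplus (mass wfin v))%:E < +oo.
Proof.
have mM : measurable_fun [set: _] (mass wfin) by exact: measurable_mass.
have M0 p : (0 <= mass wfin p)%R by exact: mass_ge0.
have ml : measurable_fun [set: _] (fun p => (mass wfin p * `|ln (mass wfin p)|)%R%:E).
  apply/measurable_EFinP; apply: measurable_funM => //.
  by apply: measurableT_comp => //; exact: measurableT_comp.
have l0 p : 0 <= (mass wfin p * `|ln (mass wfin p)|)%R%:E by rewrite lee_fin mulr_ge0.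
have E p : regular eta p ->
    mass_abslog_mass p.2 = (mass wfin p * `|ln (mass wfin p)|)%R%:E.
  move=> rp; rewrite /mass_abslog_mass (pweight_mass rp).
  have [->|m0] := eqVneq (mass wfin p) 0%R; first by rewrite mul0e mul0r.
  by rewrite lne_EFin// lt0r m0 M0.
rewrite (annealed_weights eta_offspring Y0_law mean_one
  (Gp := fun p => (mass wfin p * `|ln (mass wfin p)|)%R%:E) (Gn := cst 0))
  => [fin|||||p rp|p rp] //.
- move: fin; rewrite integral0 sube0; apply: le_lt_trans; apply: ge0_le_integral => //.
  + by move=> p _; rewrite lee_fin mulr_ge0// logplus_ge0.
  + apply/measurable_EFinP; apply: measurable_funM => //.
    by apply: measurableT_comp => //; exact: measurable_logplus.
  + by move=> p _; rewrite lee_fin ler_wpM2l// /logplus ge_max normr_ge0 ler_norm.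
- by rewrite E// max_l.
- by rewrite E// max_r// oppe_le0.
Qed.

Lemma drift_lneg (lam : R) : size_bias w nu logplus = lam%:E ->
  annealed tau P (fun _ w => sum_ylog (Y0 w)) < 0 ->
  exists K kap, [/\ (0 <= K)%R, size_bias w nu (lneg K) = kap%:E & (lam < kap)%R].
Proof.
move=> SBp; have ml := measurable_wlog mw w0 wfin.
have E p : regular eta p -> sum_ylog p.2 = (wlog wfin p)%:E.
  by move=> rp; rewrite /sum_ylog (pweight_series (@ln R) rp) (wsumE wfin).
rewrite (annealed_weights eta_offspring Y0_law mean_one
  (Gp := fun p => (Num.max (wlog wfin p) 0)%R%:E)
  (Gn := fun p => (Num.max (- wlog wfin p) 0)%R%:E)).
- exact: (drift_truncation mw w0 nu_mass SBp).
- by apply/measurable_EFinP; apply: measurable_maxr.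
- by move=> p; rewrite lee_fin le_max lexx orbT.
- by apply/measurable_EFinP; apply: measurable_maxr => //; exact: measurableT_comp.
- by move=> p; rewrite lee_fin le_max lexx orbT.
- by move=> p rp; rewrite E// EFin_max.
- by move=> p rp; rewrite E// EFin_max.
Qed.

(** In a normalized environment the original and the modified offspring differ on a null event only,
    so the two integrals agree; almost every environment is normalized. *)
Lemma solves_functional_equationE (phi : X -> R -> R) : laplace_rep phi ->
  solves_functional_equation tau P Y0 phi <->
  {ae tau, forall xi, forall u, (0 <= u)%R -> phi xi u = smooth k w phi xi u}.
Proof.
move=> phi_rep.
have H (xi : X) u : normalized eta (xi 0%N) -> (0 <= u)%R ->
    \int[P xi]_om (limn (fun n => \prod_(i < n) phi (seq_shift xi) (u * Y0 om i))%R)%:E =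
    (smooth k w phi xi u)%:E.
  move=> nxi u0; rewrite (smoothE k mw w0 wfin xi phi_rep u0).
  apply: (integral_Y0_pair eta_offspring Y0_law
    (F := fun y => (limn (fun n => \prod_(i < n) phi (seq_shift xi) (u * y i))%R)%:E)
    (G := fun p => (branch_prod w (fun t => phi (seq_shift xi) (u * t)%R) p)%:E) nxi).
  - apply/measurable_EFinP.
    exact: (measurable_fun_pair2 xi (measurable_branch_prod mw w0 wfin phi_rep u0)).
  - by move=> p; rewrite lee_fin; have /andP[] := branch_prod01 mw w0 wfin xi p phi_rep u0.
  move=> p rp; rewrite /branch_prod; congr (limn _)%:E; apply/funext => n.
  by apply: eq_bigr => i _; rewrite pweightE.
have nae := ae_normalized eta_offspring Y0_law mean_one.
have aeF := ae_filter_ringOfSetsType tau.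
split=> ae_sol; apply: filterS2 nae ae_sol => xi nxi sol u u0.
  by have := sol u u0; rewrite H// => -[].
by rewrite H// sol.
Qed.

End moments.

Theorem theorem1p1 (R : realType)
    (d : measure_display) (Theta : measurableType d)
    (d' : measure_display) (Omega : measurableType d')
    (tau : probability (seq_space Theta) R)
    (tau_iid : iid_law tau)
    (eta : R.-pker Theta ~> seq_space R)
    (eta_offspring : forall theta, eta theta (@offspring_seq R) = 1)
    (P : R.-pker (seq_space Theta) ~> Omega)
    (Y : nat -> {mfun Omega >-> seq_space R})
    (Y_law : forall (n : nat) (xi : seq_space Theta) (A : set (seq_space R)),
      measurable A -> P xi (Y n @^-1` A) = eta (xi n) A)
    (mean_one : forall n : nat,
      {ae tau, forall xi, \int[P xi]_w total_mass (Y n w) = 1})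
    (finitely_many : forall n : nat,
      {ae tau, forall xi, P xi [set w | num_positive (Y n w) < +oo] = 1})
    (supercritical : forall n : nat,
      0 < annealed tau P (fun xi _ => lne (\int[P xi]_w num_positive (Y n w))))
    (moment_ylog2 : annealed tau P (fun _ w => sum_ylogplus2 (Y 0%N w)) < +oo)
    (moment_mass : annealed tau P (fun _ w => mass_abslog_mass (Y 0%N w)) < +oo)
    (negative_drift : annealed tau P (fun _ w => sum_ylog (Y 0%N w)) < 0) :
  exists phi : seq_space Theta -> R -> R,
    [/\ laplace_class tau P 1%R phi,
        solves_functional_equation tau P (Y 0%N) phi
      & forall psi : seq_space Theta -> R -> R,
          laplace_class tau P 1%R psi ->
          solves_functional_equation tau P (Y 0%N) psi ->
          {ae tau, forall xi, forall u : R, (0 <= u)%R -> phi xi u = psi xi u}].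
Proof.
have Y0_law := Y_law 0%N; have mean0 := mean_one 0%N.
set w := pweight eta; set k := offspring_pair eta; set nu := offspring_law k tau.
have mw : forall i, measurable_fun setT (w i) := measurable_pweight eta.
have w0 : forall i p, (0 <= w i p)%R := @pweight_ge0 _ _ _ eta.
pose wfin := pweight_fin eta.
have mass1 : forall theta, \int[k theta]_p (mass wfin p)%:E = 1.
  exact: mass_pweight.
have [lam SBlam] := size_bias_logplus_fin eta_offspring Y0_law mean0 moment_ylog2.
have mass_log := mass_logplus_fin eta_offspring Y0_law mean0 moment_mass.
have [K [kap [K0 SBkap drift]]] :=
  drift_lneg eta_offspring Y0_law mean0 SBlam negative_drift.
have [phi [phi_rep phi_mean phi_fixed]] := exists_fixed_point mw w0 mass1 tau_iid
  K0 mass_log SBlam SBkap drift.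
have phi_sol : {ae tau, forall xi, forall u, (0 <= u)%R -> phi xi u = smooth k w phi xi u}.
  by apply: aeW => xi u u0; rewrite phi_fixed.
have solE := solves_functional_equationE eta_offspring Y0_law mean0.
exists phi; split.
- exact: laplace_rep_class.
- exact/(solE _ phi_rep).
move=> psi /laplace_class_rep[psi_rep psi_mean] /(solE _ psi_rep) psi_sol.
exact: (solution_unique mw w0 mass1 tau_iid phi_rep phi_mean phi_sol psi_rep psi_mean
  psi_sol K0 SBlam SBkap drift).
Qed.
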